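(* Let $\mathbf s_0$ be a fixed initial seed with index set $I$, $|I|=n$, and let $f\in\mathcal O_q(\mathcal X)$ be a polynomial in the initial quantum cluster variables $X_i$, that is, $f=\sum_{\vec v}c_{\vec v}\,z^{\sum_i v_i\mathbf e_i}$ with all $\vec v=(v_i)_{i\in I}\in\mathbb Z_{\ge0}^n$; the vectors $\vec v$ with $c_{\vec v}\neq0$ are called the vectors of the monomials appearing in $f$. For $t\in\mathfrak T$ let $\widetilde G_t$ be the $n\times n$ matrix whose $(i,j)$ entry is $g^\dagger_{ji;t}$. Then $f$ is universally polynomial if and only if $\widetilde G_t\vec v\in\mathbb Z_{\ge0}^n$ for all $t\in\mathfrak T$ and all vectors $\vec v$ of monomials appearing in $f$.
   Context: **Seeds.** Let $N$ be a lattice of rank $n$ with a skew-symmetric form $\{\cdot,\cdot\}:N\times N\to\mathbb Q$; $I$ an index set with $|I|=n$, $I_{\mathrm{uf}}\subset I$ the unfrozen indices; $d_i$ ($i\in I$) positive integers with gcd $1$. The initial seed $\mathbf s_0=(\mathbf e_i)_{i\in I}$ is a $\mathbb Z$-basis of $N$ such that $\varepsilon_{ij}:=d_i\{\mathbf e_i,\mathbf e_j\}\in\mathbb Z$ whenever $i$ or $j$ lies in $I_{\mathrm{uf}}$. Write $[a]_+=\max(0,a)$. For $k\in I_{\mathrm{uf}}$ the mutated seed $\mu_k(\mathbf s)$ has $\mathbf e_i'=\mathbf e_i+[\varepsilon_{ki}]_+\mathbf e_k$ for $i\ne k$ and $\mathbf e_k'=-\mathbf e_k$. $\mathfrak T$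 is the infinite rooted tree with root $t_0$ and one outgoing edge for each $k\in I_{\mathrm{uf}}$ at each vertex; each $t\in\mathfrak T$ carries the seed $\mathbf s_t=(\mathbf e_{i;t})$ obtained from $\mathbf s_{t_0}=\mathbf s_0$ by the corresponding mutations, with $\varepsilon_{ij;t}=d_i\{\mathbf e_{i;t},\mathbf e_{j;t}\}$. **Quantum cluster algebra.** Let $\Bbbk$ be a field of characteristic $0$, $q$ a formal parameter, $d$ a positive integer divisible by all $d_i$ with $\{N,N\}\subset\frac1d\mathbb Z$, $\Bbbk_q=\Bbbk[q^{\pm1/d}]$, $q_k=q^{1/d_k}$. $\Bbbk_q[N]$ is the $\Bbbk_q$-algebra with basis $z^n$ ($n\in N$) and $q^{\{n_1,n_2\}}z^{n_1}z^{n_2}=z^{n_1+n_2}$. The pullback $\mu_k^*$ on skew fields of fractions, from the seed $\mu_k(\mathbf s)$ to the seed $\mathbf s$, is conjugation by $\Psi_{q_k}(z^{\mathbf e_k})$ with $\Psi_q(x)=\prod_{r\ge1}(1+q^{2r-1}x)^{-1}$; explicitly, with $c=-d_k\{\mathbf e_k,n\}$, $\mu_k^*(z^n)=z^n\prod_{r=1}^{c}(1+q_k^{2r-1}z^{\mathbf e_k})$ if $c\ge0$, and $\mu_k^*(z^n)=z^n\prod_{r=1}^{|c|}(1+q_k^{-(2r-1)}z^{\mathbf e_k})^{-1}$ if $c<0$. $\mu_t^*$ denotes the composite pullback from $\mathbf s_t$ to $\mathbf s_{t_0}$, and $\mathcal O_q(\mathcal X)=\bigcap_{t\in\mathfrak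 T}\mu_t^*(\Bbbk_q[N])$. The quantum cluster variables of $\mathbf s_t$ are $X_{i;t}=z^{\mathbf e_{i;t}}$, $i\in I$. An element $f\in\mathcal O_q(\mathcal X)$ is *universally polynomial* if for every $t\in\mathfrak T$, $f=\mu_t^*(f_t)$ with $f_t$ a $\Bbbk_q$-linear combination of elements $z^n$, $n\in\bigoplus_i\mathbb Z_{\ge0}\mathbf e_{i;t}$. **Transposed $g$-vectors.** $g^\dagger_{ij;t}$ denotes the $i$-th coordinate of the $j$-th $g$-vector at $t$ for the transposed exchange matrices $\varepsilon^\dagger_{ij;t}:=\varepsilon_{ji;t}$. Explicitly, $c^\dagger$ and $g^\dagger$ are given by $c^\dagger_{ij;t_0}=g^\dagger_{ij;t_0}=\delta_{ij}$ and, for $t\xrightarrow{k}t'$ in $\mathfrak T$, $$c^\dagger_{ik;t'}=-c^\dagger_{ik;t},\qquad c^\dagger_{ij;t'}=c^\dagger_{ij;t}+c^\dagger_{ik;t}[\varepsilon^\dagger_{kj;t}]_++[-c^\dagger_{ik;t}]_+\varepsilon^\dagger_{kj;t}\ (j\ne k),$$ $$g^\dagger_{ij;t'}=g^\dagger_{ij;t}\ (j\neq k),\qquad g^\dagger_{ik;t'}=-g^\dagger_{ik;t}+\sum_{l\in I}g^\dagger_{il;t}[\varepsilon^\dagger_{lk;t}]_+-\sum_{l\in I}\varepsilon^\dagger_{il;t_0}[c^\dagger_{lk;t}]_+ .$$ *)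

(* Defs.v *)
From HB Require Import structures.
From mathcomp Require Import all_boot all_order all_algebra.
From mathcomp Require Import finmap.
From mathcomp.multinomials Require Import monalg.

Set Implicit Arguments.
Unset Strict Implicit.
Unset Printing Implicit Defensive.

Import Order.TTheory GRing.Theory Num.Theory.
Local Open Scope ring_scope.

Section LinearExtension.
Context (R : nzRingType) (G : choiceType) (V : lmodType R).
Implicit Types (h : G -> V) (f g : {malg R[G]}).

Definition lext h f : V := \sum_(x <- msupp f) f@_x *: h x.

Lemma lextEw h f (d : {fset G}) :
  (msupp f `<=` d)%fset -> lext h f = \sum_(x <- d) f@_x *: h x.
Proof.
move=> sfd; rewrite /lext (big_fset_incl _ sfd) // => x _ /mcoeff_outdom ->.
by rewrite scale0r.
Qed.

Lemma lextU h c x : lext h << c *g x >> = c *: h x.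
Proof.
by rewrite (lextEw _ msuppU_le) big_seq_fset1 mcoeffUU.
Qed.

Lemma lext_linear h : linear (lext h).
Proof.
move=> c f g; set d := (msupp f `|` msupp g `|` msupp (c *: f + g))%fset.
have [sf sg sfg] : [/\ msupp f `<=` d, msupp g `<=` d
                     & msupp (c *: f + g) `<=` d]%fset.
  by split; apply/fsubsetP => x xf; rewrite !in_fsetU xf ?orbT.
rewrite (lextEw _ sf) (lextEw _ sg) (lextEw _ sfg) scaler_sumr -big_split /=.
by apply: eq_bigr => x _; rewrite mcoeffD mcoeffZ scalerDl scalerA.
Qed.

HB.instance Definition _ h :=
  GRing.isLinear.Build R {malg R[G]} V *:%R (lext h) (lext_linear h).

Lemma eq_lext h h' f : h =1 h' -> lext h f = lext h' f.
Proof. by move=> eqh; apply: eq_bigr => x _; rewrite eqh. Qed.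

Lemma linear_lext (W : lmodType R) (L : {linear V -> W}) h f :
  L (lext h f) = \sum_(x <- msupp f) f@_x *: L (h x).
Proof. by rewrite linear_sum; apply: eq_bigr => x _; rewrite linearZ. Qed.

End LinearExtension.

Lemma lext_basis (R : nzRingType) (G : choiceType) (f : {malg R[G]}) :
  lext (fun x => << 1 *g x >>) f = f.
Proof.
rewrite [RHS]monalgE; apply: eq_bigr => x _; apply/malgP => y.
by rewrite mcoeffZ !mcoeffU mulrnAr mulr1.
Qed.

(* Normalized 2-cocycles, so that [x][y] = cocycle x y *: [x + y] is
   associative with unit [0]. *)
Record cocycle (R : comNzRingType) (G : zmodType) := Cocycle {
  cocycle_fun :> G -> G -> R;
  cocycle0x : forall x, cocycle_fun 0 x = 1;
  cocyclex0 : forall x, cocycle_fun x 0 = 1;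
  cocycleA : forall x y z,
    cocycle_fun y z * cocycle_fun x (y + z) =
    cocycle_fun x y * cocycle_fun (x + y) z }.

Definition twisted (R : comNzRingType) (G : zmodType) (s : cocycle R G) :=
  {malg R[G]}.

Section TwistedGroupAlgebra.
Context (R : comNzRingType) (G : zmodType) (s : cocycle R G).
Local Notation A := (twisted s).
Implicit Types (f g h : A).

HB.instance Definition _ := GRing.Lmodule.on A.

Definition basis (x : G) : A := << 1 *g x >>.

Definition twmul f g : A :=
  lext (fun x => lext (fun y => s x y *: basis (x + y)) g : A) f.

Lemma lextb (V : lmodType R) (h : G -> V) x : lext h (basis x) = h x.
Proof. by rewrite lextU scale1r. Qed.

Lemma twmulDl : left_distributive twmul +%R.
Proof. by move=> f g h; rewrite /twmul linearD. Qed.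

Lemma twmulDr : right_distributive twmul +%R.
Proof.
move=> f g h; rewrite /twmul /lext -big_split /=; apply: eq_bigr => x _.
by rewrite -scalerDr -/(lext _ (g + h)) linearD.
Qed.

Lemma twmulZl c f g : twmul (c *: f) g = c *: twmul f g.
Proof. by rewrite /twmul linearZ. Qed.

Lemma twmulZr c f g : twmul f (c *: g) = c *: twmul f g.
Proof.
rewrite /twmul /lext scaler_sumr; apply: eq_bigr => x _.
by rewrite -/(lext _ (c *: g)) linearZ /= !scalerA mulrC.
Qed.

Lemma twmul_basis x y : twmul (basis x) (basis y) = s x y *: basis (x + y).
Proof. by rewrite /twmul lextb lextb. Qed.

Lemma basis_ind (P : A -> Prop) :
  P 0 -> (forall f g, P f -> P g -> P (f + g)) ->
  (forall c f, P f -> P (c *: f)) -> (forall x, P (basis x)) ->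
  forall f, P f.
Proof.
move=> P0 PD PZ Pb f; rewrite -(lext_basis (f : {malg R[G]})).
by apply: big_ind => // x _; apply/PZ/Pb.
Qed.

Lemma twmul0l f : twmul 0 f = 0.
Proof. by rewrite /twmul linear0. Qed.

Lemma twmul0r f : twmul f 0 = 0.
Proof. by rewrite -[X in twmul _ X](scale0r (0 : A)) twmulZr scale0r. Qed.

Lemma twmulA : associative twmul.
Proof.
move=> f g h; elim/basis_ind: f => [|f1 f2 e1 e2|c f e|x].
- by rewrite !twmul0l.
- by rewrite !twmulDl e1 e2.
- by rewrite !twmulZl e.
elim/basis_ind: g => [|f1 f2 e1 e2|c f e|y].
- by rewrite twmul0r !twmul0l twmul0r.
- by rewrite twmulDl !twmulDr twmulDl e1 e2.
- by rewrite twmulZl !twmulZr twmulZl e.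
elim/basis_ind: h => [|f1 f2 e1 e2|c f e|z].
- by rewrite !twmul0r.
- by rewrite !twmulDr e1 e2.
- by rewrite !twmulZr e.
by rewrite !twmul_basis twmulZl twmulZr !twmul_basis !scalerA cocycleA addrA.
Qed.

Lemma twmul1l : left_id (basis 0) twmul.
Proof.
elim/basis_ind => [|f1 f2 e1 e2|c f e|y].
- by rewrite twmul0r.
- by rewrite twmulDr e1 e2.
- by rewrite twmulZr e.
by rewrite twmul_basis cocycle0x scale1r add0r.
Qed.

Lemma twmul1r : right_id (basis 0) twmul.
Proof.
elim/basis_ind => [|f1 f2 e1 e2|c f e|y].
- by rewrite twmul0l.
- by rewrite twmulDl e1 e2.
- by rewrite twmulZl e.
by rewrite twmul_basis cocyclex0 scale1r addr0.
Qed.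

Lemma basis0_neq0 : basis 0 != 0.
Proof. by rewrite monalgU_eq0 oner_neq0. Qed.

HB.instance Definition _ := GRing.Zmodule_isNzRing.Build A
  twmulA twmul1l twmul1r twmulDl twmulDr basis0_neq0.

Lemma twscaleAl c f g : c *: (f * g) = (c *: f) * g.
Proof. by rewrite [RHS]twmulZl. Qed.

HB.instance Definition _ := GRing.Lmodule_isLalgebra.Build R A twscaleAl.

Lemma twscaleAr c f g : c *: (f * g) = f * (c *: g).
Proof. by rewrite [RHS]twmulZr. Qed.

HB.instance Definition _ := GRing.Lalgebra_isAlgebra.Build R A twscaleAr.

Lemma basisM x y : basis x * basis y = s x y *: basis (x + y).
Proof. exact: twmul_basis. Qed.

End TwistedGroupAlgebra.

Section LaurentPolynomials.
Context (k : fieldType).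

Definition trivial_cocycle : cocycle k int.
Proof. by exists (fun _ _ => 1) => *; rewrite // ?mulr1. Defined.

(* The element [basis a] of [laurent] is the a-th power of the variable. *)
Definition laurent := twisted trivial_cocycle.
HB.instance Definition _ := GRing.Algebra.on laurent.

Lemma laurent_mulC : commutative (@GRing.mul laurent).
Proof.
elim/basis_ind => [g|f1 f2 e1 e2 g|c f e g|x].
- by rewrite mul0r mulr0.
- by rewrite mulrDl mulrDr e1 e2.
- by rewrite -scalerAl -scalerAr e.
elim/basis_ind => [|f1 f2 e1 e2|c f e|y].
- by rewrite mul0r mulr0.
- by rewrite mulrDl mulrDr e1 e2.
- by rewrite -scalerAl -scalerAr e.
by rewrite !basisM addrC.
Qed.

HB.instance Definition _ :=
  GRing.PzRing_hasCommutativeMul.Build laurent laurent_mulC.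

End LaurentPolynomials.

(* The lattice N is free with basis [seed0], hence of rank #|I|. *)
Record seed_datum (I : finType) (N : zmodType) := SeedDatum {
  form : N -> N -> rat;
  uf : {set I};
  mult : I -> nat;
  qden : nat;
  seed0 : I -> N;
  formDl : forall x y z, form (x + y) z = form x z + form y z;
  form_skew : forall x y, form y x = - form x y;
  mult_gt0 : forall i, (0 < mult i)%N;
  mult_gcd : \big[gcdn/0%N]_i mult i = 1%N;
  seed0_basis :
    forall x, exists! v : {ffun I -> int}, x = \sum_i seed0 i *~ v i;
  seed0_int : forall i j, (i \in uf) || (j \in uf) ->
    (mult i)%:R * form (seed0 i) (seed0 j) \is a Num.int;
  qden_gt0 : (0 < qden)%N;
  qden_mult : forall i, (mult i %| qden)%N;
  qden_form : forall x y, qden%:R * form x y \is a Num.int }.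

Definition pos_part (x : rat) : rat := Num.max 0 x.

Section Seeds.
Context (I : finType) (N : zmodType) (S : seed_datum I N).
Implicit Types (s : I -> N) (i j k l : I).

Definition eps s i j : rat := (mult S i)%:R * form S (s i) (s j).

(* For k in [uf S] and s reachable from [seed0 S], [eps s k i] is an integer,
   so that the floor only converts it from [rat] to [int]. *)
Definition mutate k s : I -> N := fun i =>
  if i == k then - s k else s i + s k *~ Num.floor (pos_part (eps s k i)).

Inductive tree := Root | Child (t : tree) (k : {k | k \in uf S}).

Fixpoint seed (t : tree) : I -> N :=
  if t is Child t k then mutate (val k) (seed t) else seed0 S.

Definition eps_dag (t : tree) i j : rat := eps (seed t) j i.

Fixpoint c_dag (t : tree) i j : rat :=
  match t with
  | Root => (i == j)%:R
  | Child t k0 => let k := val k0 in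
    if j == k then - c_dag t i k
    else c_dag t i j + c_dag t i k * pos_part (eps_dag t k j)
         + pos_part (- c_dag t i k) * eps_dag t k j
  end.

Fixpoint g_dag (t : tree) i j : rat :=
  match t with
  | Root => (i == j)%:R
  | Child t k0 => let k := val k0 in
    if j == k then
      - g_dag t i k + \sum_l g_dag t i l * pos_part (eps_dag t l k)
      - \sum_l eps_dag Root i l * pos_part (c_dag t l k)
    else g_dag t i j
  end.

Definition G_tilde (t : tree) i j : rat := g_dag t j i.

End Seeds.

Section QuantumTorus.
Context (kk : fieldType) (I : finType) (N : zmodType) (S : seed_datum I N).

(* [laurent kk] is kk[q^{+-1/d}] with d = [qden S]: its variable is q^{1/d}.
   [qpow a] is q^a, for a in (1/d)Z. *)
Definition qpow (a : rat) : laurent kk :=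
  basis (trivial_cocycle kk) (Num.floor ((qden S)%:R * a)).

Lemma qpowD a b : (qden S)%:R * a \is a Num.int ->
  qpow (a + b) = qpow a * qpow b.
Proof. by move=> aZ; rewrite /qpow basisM scale1r mulrDr floorDzr. Qed.

Lemma qpow0 : qpow 0 = 1.
Proof. by rewrite /qpow mulr0 floor0. Qed.

Lemma formDr x y z : form S x (y + z) = form S x y + form S x z.
Proof. by rewrite form_skew formDl opprD -!(form_skew _ _ x). Qed.

Lemma form0l x : form S 0 x = 0.
Proof. by apply: (addrI (form S 0 x)); rewrite -formDl !addr0. Qed.

Lemma form0r x : form S x 0 = 0.
Proof. by rewrite form_skew form0l oppr0. Qed.

Lemma qden_formN x y : (qden S)%:R * - form S x y \is a Num.int.
Proof. by rewrite -form_skew qden_form. Qed.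

Definition form_cocycle : cocycle (laurent kk) N.
Proof.
exists (fun x y => qpow (- form S x y)) => [x|x|x y z].
- by rewrite form0l oppr0 qpow0.
- by rewrite form0r oppr0 qpow0.
- rewrite -!qpowD ?qden_formN // formDl formDr !opprD.
  by congr qpow; rewrite [LHS]addrC addrA.
Defined.

Definition qtorus := twisted form_cocycle.
HB.instance Definition _ := GRing.Algebra.on qtorus.

Definition z (n : N) : qtorus := basis form_cocycle n.

Lemma zM n1 n2 : qpow (form S n1 n2) *: (z n1 * z n2) = z (n1 + n2).
Proof.
by rewrite /z basisM scalerA -qpowD ?qden_form // subrr qpow0 scale1r.
Qed.

Definition polynomial_in (s : I -> N) (f : qtorus) :=
  forall n, f@_n != 0 -> exists v : {ffun I -> nat}, n = \sum_i s i *+ v i.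

End QuantumTorus.

(* An (Ore) skew field of fractions, unique up to unique isomorphism. *)
Record fraction_skew_field (A : nzRingType) := FractionSkewField {
  frac_sort :> unitRingType;
  emb : {rmorphism A -> frac_sort};
  frac_unit : forall x : frac_sort, x != 0 -> x \is a GRing.unit;
  emb_inj : injective emb;
  fracP : forall x : frac_sort,
    exists ab : A * A, (ab.2 != 0) && (x == emb ab.1 / emb ab.2) }.
Arguments emb {A}.

Definition fraction (A : nzRingType) (F : fraction_skew_field A) (x : F) :=
  xchoose (fracP x).

Section Pullback.
Context (kk : fieldType) (I : finType) (N : zmodType) (S : seed_datum I N).
Local Notation A := (qtorus kk S).
Context (F : fraction_skew_field A).
Implicit Types (s : I -> N) (k : I).

(* The factor 1 + q_k^m z^{e_k}, where q_k = q^{1/d_k}. *)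
Definition binomial_factor s k (m : rat) : F :=
  emb F (1 + qpow kk S (m / (mult S k)%:R) *: z kk S (s k)).

(* For k in [uf S] and s reachable from [seed0 S], the argument of floor is an
   integer c; it is negative with |c| = m.+1 in the case [Negz m]. *)
Definition mutation_monomial s k (n : N) : F :=
  match Num.floor (- (mult S k)%:R * form S (s k) n) with
  | Posz c => emb F (z kk S n) *
      \prod_(1 <= r < c.+1) binomial_factor s k (2 * r%:R - 1)
  | Negz m => emb F (z kk S n) *
      \prod_(1 <= r < m.+2) (binomial_factor s k (- (2 * r%:R - 1)))^-1
  end.

Definition mutation_torus s k (f : A) : F :=
  \sum_(n <- msupp f) emb F (f@_n *: 1) * mutation_monomial s k n.

(* The pullback from the seed [mutate k s] to the seed s. For k in [uf S] and s
   reachable from [seed0 S], [mutation_torus s k] is an injective ring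
   morphism, hence extends uniquely to F, and the value of the extension at x
   can be read off from any representation of x as a fraction. *)
Definition mutation_pullback s k (x : F) : F :=
  let ab := fraction x in mutation_torus s k ab.1 / mutation_torus s k ab.2.

Fixpoint pullback (t : tree S) (x : F) : F :=
  if t is Child t k then pullback t (mutation_pullback (seed t) (val k) x)
  else x.

Definition quantum_cluster_algebra (f : F) :=
  forall t : tree S, exists ft : A, f = pullback t (emb F ft).

Definition universally_polynomial (f : F) :=
  quantum_cluster_algebra f /\
  forall t : tree S, exists ft : A,
    polynomial_in (seed t) ft /\ f = pullback t (emb F ft).

End Pullback.

(* Main.v *)
(** An additive map v : N -> Q is a monomial valuation, and f is polynomial in
the seed s_t iff v >= 0 on the support of the expansion of f at t for every
coordinate form v of s_t.  Clearing denominators in a mutation and looking at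
extremal coefficients shows that this is equivalent to u >= 0 on the support of
the initial expansion, where u is v carried back to the root by the tropical
mutations T_k u = u + d_k {e_k, .} min(0, u(e_k)).  So it remains to see that
the matrix carrying the coordinate forms of s_t back to the root is G~_t.

Each T_k is one of two linear maps, id or u |-> u o tau_k, according to the sign
of u(e_k), so T is linear on the chamber u >= 0 of s_t provided that the images
of the chambers do not cross the walls, which is sign-coherence of c-vectors.
This is obtained from a quantum scattering diagram, encoded by one formal series
g on the cone of the initial seed: for every u, g factors as a product of series
supported on u > 0, u = 0 and u < 0, whose middle factor Pi u g is the wall
function at u; g is determined by its incoming walls, the quantum dilogarithms
Psi(z^(e_i)), and a mutation of the seed moves g by dropping its factor
Psi(z^(e_k)).  The walls of a chamber carry nontrivial functions while its
interior carries none, so the interior never meets a hyperplane u(e_k) = 0.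
The value q^(1/d) = 2 is enough for this. *)

Require Import Defs.
From mathcomp Require Import all_boot all_order all_algebra.
From mathcomp.multinomials Require Import monalg.
From HB Require Import structures.
From mathcomp Require Import finmap ring lra zify.
From mathcomp.classical Require Import boolp.
Import Defs.
Import Order.TTheory GRing.Theory Num.Theory.
Local Open Scope ring_scope.

Set Implicit Arguments.
Unset Strict Implicit.
Unset Printing Implicit Defensive.

(** The form may be degenerate, so n is not recovered from the linear form {n, .}; the conditions on
    the diagram are therefore indexed by exponents n. At the point {n, .} one prescribes the
    coefficient at n of the logarithm of the wall function. All exponents m of that function satisfy
    {n, m} = 0, so z^n is central there and this coefficient is additive under products, although
    the torus is noncommutative. To first order it equals g n, so the conditions determine g
    recursively by height.

    The diagram only serves to settle signs, so numerical coefficients do: with q^(1/d) = 2 every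
    q_k exceeds 1, no denominator of a dilogarithm coefficient vanishes, and the first coefficient
    q_k / (q_k^2 - 1) is nonzero and recovers d_k.

    Two inductions run in opposite directions. The tree grows at the far end of a path, but a
    diagram lives on the initial seed and its mutation replaces that seed; so linearity on chambers
    is proved from the root end, for all initial seeds at once. *)

Lemma addrBK (V : zmodType) (a b : V) : a + (b - a) = b.
Proof. by rewrite addrC subrK. Qed.

Lemma big_supp (T : eqType) (V : nmodType) (F : T -> V) (r1 r2 : seq T) :
  uniq r1 -> uniq r2 ->
  (forall x, F x != 0 -> (x \in r1) = (x \in r2)) ->
  \sum_(x <- r1) F x = \sum_(x <- r2) F x.
Proof.
move=> u1 u2 e12.
have supp r : \sum_(x <- r) F x = \sum_(x <- [seq x <- r | F x != 0]) F x.
  rewrite big_filter [RHS]big_mkcond; apply: eq_bigr => x _.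
  by case: eqP.
rewrite supp [RHS]supp; apply: perm_big; apply: uniq_perm.
- exact: filter_uniq.
- exact: filter_uniq.
- by move=> x; rewrite !mem_filter; case: eqP => //= /eqP /e12.
Qed.

(** * Formal series in a quantum torus *)

(* The multiplier of z^a z^b = w(a, b) z^(a + b) in a quantum torus over Q. *)
Record twist (N : zmodType) := Twist {
  tw :> N -> N -> rat;
  twDl : forall a b c, tw (a + b) c = tw a c * tw b c;
  twDr : forall a b c, tw a (b + c) = tw a b * tw a c;
  tw_diag : forall a, tw a a = 1 }.

Section TwistTheory.
Context (N : zmodType) (w : twist N).
Implicit Types a b : N.

Lemma twC1 a b : w a b * w b a = 1.
Proof.
have := tw_diag w (a + b); rewrite twDl !twDr !tw_diag.
by rewrite mul1r mulr1.
Qed.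

Lemma tw_neq0 a b : w a b != 0.
Proof. by apply/eqP => e; have := twC1 a b; rewrite e mul0r => /eqP; rewrite eq_sym oner_eq0. Qed.

Lemma tw0l a : w 0 a = 1.
Proof. by apply: (mulfI (tw_neq0 0 a)); rewrite -twDl addr0 mulr1. Qed.

Lemma tw0r a : w a 0 = 1.
Proof. by apply: (mulfI (tw_neq0 a 0)); rewrite -twDr addr0 mulr1. Qed.

Lemma twNl a b : w (- a) b = (w a b)^-1.
Proof.
apply: (mulfI (tw_neq0 a b)); rewrite -twDl subrr tw0l mulfV //.
exact: tw_neq0.
Qed.

Lemma twNr a b : w a (- b) = (w a b)^-1.
Proof.
apply: (mulfI (tw_neq0 a b)); rewrite -twDr subrr tw0r mulfV //.
exact: tw_neq0.
Qed.

Lemma twC a b : w b a = (w a b)^-1.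
Proof.
apply: (mulfI (tw_neq0 a b)); rewrite twC1 mulfV //; exact: tw_neq0.
Qed.

Lemma tw_mulrnl a b j : w (a *+ j) b = w a b ^+ j.
Proof. by elim: j => [|j IH]; rewrite ?tw0l // mulrS twDl IH exprS. Qed.

End TwistTheory.

(* A submonoid graded by [ht], in which every n has only finitely many
   decompositions n = a + (n - a), listed by the a's in [dec n]. *)
Record cone (N : zmodType) := Cone {
  cmem : pred N;
  ht : N -> nat;
  dec : N -> seq N;
  cmem0 : cmem 0;
  cmemD : forall a b, cmem a -> cmem b -> cmem (a + b);
  htD : forall a b, cmem a -> cmem b -> ht (a + b) = (ht a + ht b)%N;
  ht_eq0 : forall a, cmem a -> ht a = 0%N -> a = 0;
  dec_uniq : forall n, uniq (dec n);
  mem_dec : forall n a, (a \in dec n) = cmem a && cmem (n - a) }.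

Section ConeTheory.
Context (N : zmodType) (C : cone N).
Implicit Types a b n : N.

Lemma ht0 : ht C 0 = 0%N.
Proof.
by have := htD (cmem0 C) (cmem0 C); rewrite addr0 => /eqP; rewrite -{1}[ht C 0]addn0 eqn_add2l => /eqP.
Qed.

Lemma dec_mem n a : a \in dec C n -> cmem C n.
Proof.
by rewrite mem_dec => /andP[ma mb]; rewrite -(subrK a n) cmemD.
Qed.

Lemma dec_ht n a : a \in dec C n -> (ht C n = ht C a + ht C (n - a))%N.
Proof. by rewrite mem_dec => /andP[ma mb]; rewrite -htD //; rewrite [a + _]addrC subrK. Qed.

Lemma dec_sub n a : a \in dec C n -> (n - a) \in dec C n.
Proof. by rewrite !mem_dec andbC subKr. Qed.

Lemma dec_trans n a b : a \in dec C n -> b \in dec C a -> b \in dec C n.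
Proof.
rewrite !mem_dec => /andP[ma mna] /andP[-> mab] /=.
by rewrite -(subrK a n) -addrA cmemD.
Qed.

Lemma dec_proper n a : a \in dec C n -> a != n -> (ht C a < ht C n)%N.
Proof.
move=> an ne; rewrite (dec_ht an) -[X in (X < _)%N]addn0 ltn_add2l lt0n.
apply/eqP => e0; move: ne; rewrite eq_sym -subr_eq0 (ht_eq0 _ e0) ?eqxx //.
by move: an; rewrite mem_dec => /andP[].
Qed.

Lemma dec_proper_sub n a : a \in dec C n -> a != 0 -> (ht C (n - a) < ht C n)%N.
Proof.
move=> an ne; apply: dec_proper; first exact: dec_sub.
by rewrite -subr_eq0 addrAC subrr add0r oppr_eq0.
Qed.

Lemma mem_dec0 n : (0 \in dec C n) = cmem C n.
Proof. by rewrite mem_dec cmem0 subr0. Qed.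

Lemma mem_opp n : cmem C n -> cmem C (- n) -> n = 0.
Proof.
move=> mn mo; apply: (ht_eq0 mn); have := htD mn mo; rewrite subrr ht0.
by move=> /esym/eqP; rewrite addn_eq0 => /andP[/eqP].
Qed.

End ConeTheory.

Record ser (N : zmodType) (w : twist N) (C : cone N) := Ser {
  coef :> N -> rat;
  coef_out : forall n, ~~ cmem C n -> coef n = 0 }.

Arguments coef {N w C} _ _ : simpl never.

Section SeriesRing.
Context (N : zmodType) (w : twist N) (C : cone N).
Local Notation ser := (ser w C).
Implicit Types (f g h : ser) (n a b : N).

Lemma serP f g : (forall n, f n = g n) -> f = g.
Proof.
case: f g => [f pf] [g pg] efg; have {}efg : f = g by exact/funext.
case: _ / efg in pg *; by congr Ser; exact: Prop_irrelevance.
Qed.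

Lemma ser_supp f n : f n != 0 -> cmem C n.
Proof. by apply: contraNT => /coef_out ->. Qed.

Definition mkser (F : N -> rat) : ser.
Proof.
by exists (fun n => if cmem C n then F n else 0) => n /negbTE ->.
Defined.

Lemma mkserE F n : mkser F n = if cmem C n then F n else 0.
Proof. by []. Qed.

HB.instance Definition _ := gen_eqMixin ser.
HB.instance Definition _ := gen_choiceMixin ser.

Definition ser_add f g := mkser (fun n => f n + g n).
Definition ser_opp f := mkser (fun n => - f n).
Definition ser_zero := mkser (fun=> 0).
Definition ser_one := mkser (fun n => (n == 0)%:R).
Definition ser_mul f g := mkser (fun n =>
  \sum_(a <- dec C n) w a (n - a) * (f a * g (n - a))).

Arguments mkser : simpl never.
Arguments ser_add : simpl never.
Arguments ser_opp : simpl never.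
Arguments ser_mul : simpl never.
Arguments ser_zero : simpl never.
Arguments ser_one : simpl never.

Lemma ser_addE f g n : ser_add f g n = f n + g n.
Proof. by rewrite mkserE; case: ifP => // /negbT m; rewrite !coef_out ?addr0. Qed.

Lemma ser_oppE f n : ser_opp f n = - f n.
Proof. by rewrite mkserE; case: ifP => // /negbT m; rewrite !coef_out ?oppr0. Qed.

Lemma ser_zeroE n : ser_zero n = 0.
Proof. by rewrite mkserE if_same. Qed.

Lemma ser_oneE n : ser_one n = (n == 0)%:R.
Proof. by rewrite mkserE; case: ifP => // /negbT; case: eqP => // ->; rewrite cmem0. Qed.

Lemma ser_mulE f g n (r : seq N) : uniq r ->
  (forall a, f a != 0 -> g (n - a) != 0 -> a \in r) ->
  ser_mul f g n = \sum_(a <- r) w a (n - a) * (f a * g (n - a)).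
Proof.
move=> ur sr; transitivity (\sum_(a <- dec C n) w a (n - a) * (f a * g (n - a))).
  rewrite mkserE; case: ifP => // /negbT mn; apply/esym.
  by apply: big1_seq => a /= /dec_mem mn'; rewrite mn' in mn.
apply: big_supp => // [|a]; first exact: dec_uniq.
rewrite !mulf_eq0 !negb_or => /and3P[_ fa ga].
by rewrite sr // mem_dec !(ser_supp fa, ser_supp ga).
Qed.

Lemma ser_mulE0 f g n :
  ser_mul f g n = \sum_(a <- dec C n) w a (n - a) * (f a * g (n - a)).
Proof.
apply: ser_mulE; first exact: dec_uniq.
by move=> a fa ga; rewrite mem_dec !(ser_supp fa, ser_supp ga).
Qed.

Lemma ser_addA : associative ser_add.
Proof. by move=> f g h; apply: serP => n; rewrite !ser_addE addrA. Qed.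
Lemma ser_addC : commutative ser_add.
Proof. by move=> f g; apply: serP => n; rewrite !ser_addE addrC. Qed.
Lemma ser_add0 : left_id ser_zero ser_add.
Proof. by move=> f; apply: serP => n; rewrite ser_addE ser_zeroE add0r. Qed.
Lemma ser_addN : left_inverse ser_zero ser_opp ser_add.
Proof. by move=> f; apply: serP => n; rewrite ser_addE ser_oppE ser_zeroE addNr. Qed.

HB.instance Definition _ := GRing.isZmodule.Build ser ser_addA ser_addC ser_add0 ser_addN.

Lemma ser_mul1l : left_id ser_one ser_mul.
Proof.
move=> f; apply: serP => n; rewrite (@ser_mulE _ _ _ [:: 0]) //.
  by rewrite big_seq1 ser_oneE eqxx tw0l subr0 !mul1r.
by move=> a; rewrite ser_oneE inE; case: (a =P 0) => // _; rewrite eqxx.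
Qed.

Lemma ser_mul1r : right_id ser_one ser_mul.
Proof.
move=> f; apply: serP => n; rewrite (@ser_mulE _ _ _ [:: n]) //.
  by rewrite big_seq1 ser_oneE subrr eqxx tw0r mulr1 mul1r.
by move=> a _; rewrite ser_oneE inE subr_eq0 [a == n]eq_sym; case: (n =P a) => // _; rewrite eqxx.
Qed.

Lemma ser_mulDl : left_distributive ser_mul ser_add.
Proof.
move=> f g h; apply: serP => n; rewrite ser_addE !ser_mulE0 -big_split.
by apply: eq_bigr => a _; rewrite ser_addE mulrDl mulrDr.
Qed.

Lemma ser_mulDr : right_distributive ser_mul ser_add.
Proof.
move=> f g h; apply: serP => n; rewrite ser_addE !ser_mulE0 -big_split.
by apply: eq_bigr => a _; rewrite ser_addE !mulrDr.
Qed.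

Lemma ser_mulA : associative ser_mul.
Proof.
move=> f g h; apply: serP => n.
(* [G] is the term of a decomposition of n into three parts, the first two recorded in [p]; both
   bracketings enumerate the same decompositions. *)
pose G (p : N * N) := w p.1 (n - p.1) * w p.2 (n - p.1 - p.2) *
  (f p.1 * g p.2 * h (n - p.1 - p.2)).
transitivity (\sum_(p <- [seq (a, c) | a <- dec C n, c <- dec C (n - a)]) G p).
  rewrite big_allpairs_dep ser_mulE0; apply: eq_bigr => a _.
  rewrite ser_mulE0 !mulr_sumr; apply: eq_bigr => c _; rewrite /G /=; ring.
transitivity (\sum_(p <- [seq (a, b - a) | b <- dec C n, a <- dec C b]) G p); last first.
  rewrite big_allpairs_dep ser_mulE0; apply: eq_bigr => b _.
  rewrite ser_mulE0 mulr_suml mulr_sumr; apply: eq_bigr => a _; rewrite /G /=.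
  have -> : n - a - (b - a) = n - b by rewrite opprB addrA subrK.
  have -> : w b (n - b) = w a (n - b) * w (b - a) (n - b).
    by rewrite -twDl addrBK.
  have -> : w a (n - a) = w a (n - b) * w a (b - a).
    by rewrite -twDr addrA subrK.
  ring.
apply: perm_big; apply: uniq_perm.
- apply: allpairs_uniq_dep => [|a _|[a c] [a' c'] _ _ [-> ->]] //; exact: dec_uniq.
- apply: allpairs_uniq_dep => [|a _|[b a] [b' a'] _ _ [/= e1 e2]]; try exact: dec_uniq.
  by subst a'; move/addIr: e2 => <-.
move=> [x y]; apply/allpairsPdep/allpairsPdep => /=.
- case=> a [c [ma mc [-> ->]]]; exists (a + c), a.
  have e : a + c - a = c by rewrite addrAC subrr add0r.
  move: ma mc; rewrite !mem_dec => /andP[ma _] /andP[mc mnac].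
  by rewrite e ma mc cmemD //= opprD addrA mnac.
- case=> b [a [mb ma [-> ->]]]; exists a, (b - a); split => //.
    exact: (dec_trans mb ma).
  move: ma mb; rewrite !mem_dec => /andP[_ mba] /andP[_ mnb].
  by rewrite mba opprB addrA subrK.
Qed.

HB.instance Definition _ := GRing.Zmodule_isPzRing.Build ser
  ser_mulA ser_mul1l ser_mul1r ser_mulDl ser_mulDr.

Lemma coefD f g n : (f + g) n = f n + g n. Proof. exact: ser_addE. Qed.
Lemma coefN f n : (- f) n = - f n. Proof. exact: ser_oppE. Qed.
Lemma coefB f g n : (f - g) n = f n - g n. Proof. by rewrite coefD coefN. Qed.
Lemma coef0 n : (0 : ser) n = 0. Proof. exact: ser_zeroE. Qed.
Lemma coef1 n : (1 : ser) n = (n == 0)%:R. Proof. exact: ser_oneE. Qed.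
Lemma coefM f g n :
  (f * g) n = \sum_(a <- dec C n) w a (n - a) * (f a * g (n - a)).
Proof. exact: ser_mulE0. Qed.
Lemma coefMr f g n (r : seq N) : uniq r ->
  (forall a, f a != 0 -> g (n - a) != 0 -> a \in r) ->
  (f * g) n = \sum_(a <- r) w a (n - a) * (f a * g (n - a)).
Proof. exact: ser_mulE. Qed.

Lemma coef_sum (J : Type) (r : seq J) (P : pred J) (F : J -> ser) n :
  (\sum_(j <- r | P j) F j) n = \sum_(j <- r | P j) F j n.
Proof.
apply: (big_ind2 (fun (x : ser) y => x n = y)); first exact: coef0.
  by move=> x1 y1 x2 y2 <- <-; rewrite coefD.
by [].
Qed.

Lemma coefM0 f g : (f * g) 0 = f 0 * g 0.
Proof.
rewrite (@coefMr _ _ _ [:: 0]) // ?big_seq1 ?subr0 ?tw0l ?mul1r //.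
move=> a fa ga; rewrite inE; apply/eqP/(@mem_opp _ C); first exact: (ser_supp fa).
by have := ser_supp ga; rewrite sub0r.
Qed.

Lemma coefM_neq0 f g n : (f * g) n != 0 ->
  exists a, [/\ a \in dec C n, f a != 0 & g (n - a) != 0].
Proof.
move=> ne; have [|a an] := @hasP _ (fun a => f a * g (n - a) != 0) (dec C n) _.
  apply/negPn/negP => /hasPn none; move: ne; rewrite coefM big1_seq ?eqxx //.
  by move=> a /= an; have := none a an; rewrite negbK => /eqP ->; rewrite mulr0.
by rewrite mulf_eq0 negb_or => /andP[? ?]; exists a.
Qed.

End SeriesRing.

(** * Recursion by height, factorization by sign, and logarithms *)

Section Agreement.
Context (N : zmodType) (w : twist N) (C : cone N).
Local Notation ser := (ser w C).
Implicit Types (f g h a b c : ser) (n m : N).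

(* f and f' agree at all proper parts of n; statements about the coefficient at n
   modulo those at proper parts replace arguments modulo an ideal of the cone. *)
Definition agree n f f' := forall m, m \in dec C n -> m != n -> f m = f' m.

Lemma agree_refl n f : agree n f f. Proof. by []. Qed.

Lemma agree_dec n m f f' : agree n f f' -> m \in dec C n -> m != n ->
  agree m f f'.
Proof.
move=> e mn ne a am _; apply: e; first exact: dec_trans mn am.
apply: contraTneq (dec_proper mn ne) => E; rewrite E in am.
by rewrite (dec_ht am) ltnNge leq_addr.
Qed.

Lemma agree_at0 n f f' : n != 0 -> cmem C n -> agree n f f' -> f 0 = f' 0.
Proof. by move=> n0 mn; apply; rewrite ?mem_dec0 // eq_sym. Qed.

(** A coefficient at n itself enters the product only next to a constant term; all other terms
    involve proper parts. To first order the product thus obeys the Leibniz rule. *)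
Lemma coefM_agree n f f' g g' : n != 0 -> agree n f f' -> agree n g g' ->
  (f * g) n - (f' * g') n = (f n - f' n) * g 0 + f 0 * (g n - g' n).
Proof.
move=> n0 ef eg; case mn: (cmem C n); last first.
  by rewrite !(coef_out _ (negbT mn)) !subrr mul0r mulr0 addr0.
have -> : (f * g) n - (f' * g') n = ((f - f') * g) n + (f' * (g - g')) n.
  by rewrite -coefB -coefD mulrBl mulrBr addrA subrK.
congr (_ + _).
- rewrite (@coefMr _ _ _ _ _ _ [:: n]) // ?big_seq1 ?subrr ?tw0r ?mul1r ?coefB //.
  move=> a; rewrite inE coefB => fa ga; apply: contraNT fa => an.
  case ma: (cmem C a); last by rewrite !(coef_out _ (negbT ma)) subrr.
  by rewrite ef ?subrr // mem_dec ma (ser_supp ga).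
- rewrite (@coefMr _ _ _ _ _ _ [:: 0]) //.
    by rewrite big_seq1 subr0 tw0l mul1r coefB (agree_at0 n0 mn ef).
  move=> a; rewrite inE coefB => fa ga; apply: contraNT ga => a0.
  case ma: (cmem C (n - a)); last by rewrite !(coef_out _ (negbT ma)) subrr.
  rewrite eg ?subrr // ?mem_dec ?ma ?subKr ?(ser_supp fa) //.
  by rewrite -subr_eq0 addrAC subrr add0r oppr_eq0.
Qed.

Lemma agreeM n f f' g g' :
  agree n f f' -> agree n g g' -> agree n (f * g) (f' * g').
Proof.
move=> ef eg m mn ne; rewrite !coefM; apply: eq_big_seq => a am.
have e h h' : agree n h h' -> forall m1, m1 \in dec C m -> h m1 = h' m1.
  move=> eh m1 bm; have [->|bne] := eqVneq m1 m; first exact: eh.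
  exact: (agree_dec eh mn ne).
by rewrite (e _ _ ef) // (e _ _ eg) // dec_sub.
Qed.

Lemma agreeB n f f' g g' :
  agree n f f' -> agree n g g' -> agree n (f - g) (f' - g').
Proof. by move=> ef eg a an ne; rewrite !coefB ef // eg. Qed.

Lemma agreeX n f f' j : agree n f f' -> agree n (f ^+ j) (f' ^+ j).
Proof. by move=> ef; elim: j => [|j IH]; rewrite ?expr0 // !exprS; apply: agreeM. Qed.

Lemma agree_all f f' :
  (forall n, cmem C n -> agree n f f' -> f n = f' n) -> f = f'.
Proof.
move=> step; apply: serP => n.
elim: {n}(ht C n).+1 {-2}n (ltnSn (ht C n)) => // H IH n nH.
case mn: (cmem C n); last by rewrite !(coef_out _ (negbT mn)).
apply: step => // a an ne; apply: IH; apply: leq_trans (dec_proper an ne) _.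
by [].
Qed.

(** A contraction principle: iterating from 0, the coefficient at n is stable once the number of
    steps exceeds the height of n, and the fixed point collects these stable values. *)
Lemma fix_ser (Phi : ser -> ser) :
  (forall f f' n, cmem C n -> agree n f f' -> Phi f n = Phi f' n) ->
  exists f, Phi f = f.
Proof.
move=> contr; pose G j := iter j Phi 0.
have stab j n : (ht C n < j)%N -> G j.+1 n = G j n.
  elim: j n => // j IH n nj; case mn: (cmem C n); last first.
    by rewrite !(coef_out _ (negbT mn)).
  apply: contr => // a an ne; apply: IH.
  by apply: leq_trans (dec_proper an ne) _.
have stabD j i n : (ht C n < j)%N -> G (i + j)%N n = G j n.
  move=> nj; elim: i => // i <-; rewrite addSn; apply: stab.
  exact: leq_trans nj (leq_addl _ _).
pose f : ser := mkser w C (fun n => G (ht C n).+1 n).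
have fE n j : (ht C n < j)%N -> f n = G j n.
  move=> nj; rewrite -(subnK nj) stabD // mkserE.
  by case: ifP => // /negbT mn; rewrite coef_out.
exists f; apply: serP => n; case mn: (cmem C n); last first.
  by rewrite !(coef_out _ (negbT mn)).
rewrite (@fE n (ht C n).+2) //; apply: contr => // a an ne.
by apply: (fE a (ht C n).+1); apply: leq_trans (dec_proper an ne) _.
Qed.

(** The quotient is the fixed point of h = g - (f - 1) h, a contraction because f - 1 has no
    constant term. *)
Lemma ser_div f g : f 0 = 1 -> exists h, f * h = g.
Proof.
move=> f0; have [|h E] := fix_ser (Phi := fun h => g - (f - 1) * h); last first.
  exists h; move/eqP: E; rewrite mulrBl mul1r opprB addrCA -subr_eq0.
  by rewrite [h + _]addrC addrK subr_eq0 => /eqP.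
move=> h h' n mn e; have [->|n0] := eqVneq n 0.
  by rewrite !coefB !coefM0 !coefB coef1 eqxx f0 subrr !mul0r.
apply/eqP; rewrite -subr_eq0 !coefB opprB addrC addrA subrK -opprB oppr_eq0.
by rewrite (coefM_agree n0 (@agree_refl n _) e) subrr mul0r add0r coefB coef1 eqxx f0 subrr mul0r.
Qed.

Lemma ser_divr f g : f 0 = 1 -> exists h, h * f = g.
Proof.
move=> f0; have [|h E] := fix_ser (Phi := fun h => g - h * (f - 1)); last first.
  exists h; move/eqP: E; rewrite mulrBr mulr1 opprB addrCA -subr_eq0.
  by rewrite [h + _]addrC addrK subr_eq0 => /eqP.
move=> h h' n mn e; have [->|n0] := eqVneq n 0.
  by rewrite !coefB !coefM0 !coefB coef1 eqxx f0 subrr !mulr0.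
apply/eqP; rewrite -subr_eq0 !coefB opprB addrC addrA subrK -opprB oppr_eq0.
by rewrite (coefM_agree n0 e (@agree_refl n _)) subrr mulr0 addr0 coefB coef1 eqxx f0 subrr mulr0.
Qed.

Lemma ser_inv f : f 0 = 1 -> exists f', [/\ f * f' = 1, f' * f = 1 & f' 0 = 1].
Proof.
move=> f0; have [f' e] := ser_div 1 f0; have [f'' e'] := ser_divr 1 f0.
have E : f'' = f' by rewrite -[f'']mulr1 -e mulrA e' mul1r.
exists f'; split => //; first by rewrite -E.
by have /(congr1 (fun x : ser => x 0)) := e; rewrite coefM0 f0 mul1r coef1 eqxx.
Qed.

Record fact (u : N -> rat) f a b c : Prop := Fact {
  fact_eq : f = a * b * c;
  fact_a0 : a 0 = 1; fact_b0 : b 0 = 1; fact_c0 : c 0 = 1;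
  fact_a : forall n, n != 0 -> a n != 0 -> 0 < u n;
  fact_b : forall n, n != 0 -> b n != 0 -> u n = 0;
  fact_c : forall n, n != 0 -> c n != 0 -> u n < 0 }.

Lemma coefM3_agree n a a' b b' c c' : n != 0 ->
  a 0 = 1 -> b 0 = 1 -> c 0 = 1 ->
  agree n a a' -> agree n b b' -> agree n c c' ->
  (a * b * c) n - (a' * b' * c') n = (a n - a' n) + (b n - b' n) + (c n - c' n).
Proof.
move=> n0 a0 b0 c0 ea eb ec.
by rewrite !(coefM_agree n0) ?coefM0 ?a0 ?b0 ?c0 ?mulr1 ?mul1r //; apply: agreeM.
Qed.

(** By [coefM3_agree] the change of f at n is the sum of the three changes, and the sign of u n lets
    only one of the factors have a coefficient at n. *)
Lemma fact_diff u n f a b c f' a' b' c' : n != 0 ->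
  fact u f a b c -> fact u f' a' b' c' ->
  agree n a a' -> agree n b b' -> agree n c c' ->
  [/\ a n - a' n = if 0 < u n then f n - f' n else 0,
      b n - b' n = if u n == 0 then f n - f' n else 0 &
      c n - c' n = if u n < 0 then f n - f' n else 0].
Proof.
move=> n0 F F' ea eb ec.
have := coefM3_agree n0 (fact_a0 F) (fact_b0 F) (fact_c0 F) ea eb ec.
rewrite -(fact_eq F) -(fact_eq F') => ->.
have za (h h' : ser) (Q : bool) : (h n != 0 -> Q) -> (h' n != 0 -> Q) ->
    ~~ Q -> h n - h' n = 0.
  move=> H H' nQ; have [/eqP -> /eqP ->] : h n == 0 /\ h' n == 0.
    by split; apply: contraNT nQ.
  by rewrite subrr.
have A := za _ _ _ (fact_a F n0) (fact_a F' n0).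
have B := za b b' (u n == 0) (fun x => introT eqP (fact_b F n0 x))
  (fun x => introT eqP (fact_b F' n0 x)).
have Cc := za _ _ _ (fact_c F n0) (fact_c F' n0).
case: (ltrgtP (u n) 0) A B Cc => _ A B Cc.
- by rewrite (A isT) (B isT) !add0r.
- by rewrite (B isT) (Cc isT) !addr0.
- by rewrite (A isT) (Cc isT) addr0 add0r.
Qed.

Lemma fact_agree u n f a b c f' a' b' c' : n != 0 ->
  fact u f a b c -> fact u f' a' b' c' -> agree n f f' ->
  [/\ agree n a a', agree n b b' & agree n c c'].
Proof.
move=> n0 F F' e.
have key m : m \in dec C n -> m != n -> [/\ a m = a' m, b m = b' m & c m = c' m].
  elim: {m}(ht C m).+1 {-2}m (ltnSn (ht C m)) => // H IH m mH mn ne.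
  have [->|m0] := eqVneq m 0.
    by rewrite !(fact_a0 F, fact_a0 F', fact_b0 F, fact_b0 F', fact_c0 F, fact_c0 F').
  have sub (m1 : N) : m1 \in dec C m -> m1 != m ->
      [/\ a m1 = a' m1, b m1 = b' m1 & c m1 = c' m1].
    move=> am ne1; apply: IH.
    - exact: leq_trans (dec_proper am ne1) _.
    - exact: dec_trans mn am.
    - apply: contraTneq (dec_proper mn ne) => E; rewrite -E -leqNgt.
      exact: ltnW (dec_proper am ne1).
  have [||| ] := fact_diff m0 F F'.
  1-3: by move=> a1 h1 h2; case: (sub _ h1 h2).
  rewrite (e _ mn ne) subrr !if_same.
  by move=> /subr0_eq -> /subr0_eq -> /subr0_eq ->.
by split=> m mn ne; case: (key m mn ne).
Qed.

Lemma fact_uniq u f a b c a' b' c' :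
  fact u f a b c -> fact u f a' b' c' -> b = b'.
Proof.
move=> F F'; apply: agree_all => n mn _.
have [->|n0] := eqVneq n 0; first by rewrite (fact_b0 F) (fact_b0 F').
have [ea eb ec] := fact_agree n0 F F' (@agree_refl n f).
have [_ + _] := fact_diff n0 F F' ea eb ec.
by rewrite subrr if_same => /subr0_eq.
Qed.

(** A single series d, cut into three by the sign of u, encodes all factors. At n the product of the
    parts varies exactly as d does, so their difference depends on proper parts only and the
    equation for d is a contraction. *)
Lemma fact_exists u f : f 0 = 1 -> exists a b c, fact u f a b c.
Proof.
move=> f0.
pose part (P : pred N) (d : ser) : ser :=
  mkser w C (fun n => if n == 0 then 1 else if P n then d n else 0).
pose pa := part (fun n => 0 < u n); pose pb := part (fun n => u n == 0).
pose pc := part (fun n => u n < 0).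
have part0 P d : part P d 0 = 1 by rewrite mkserE eqxx cmem0.
have partE P d n : n != 0 -> part P d n = if P n then d n else 0.
  move=> /negbTE n0; rewrite mkserE n0; case: ifP => // /negbT mn.
  by rewrite coef_out ?if_same.
have agp P n d d' : agree n d d' -> agree n (part P d) (part P d').
  move=> e m mn ne; have [->|m0] := eqVneq m 0; first by rewrite !part0.
  by rewrite !partE // e.
pose Phi (d : ser) : ser := mkser w C (fun n =>
  if n == 0 then 0 else (f - (pa d * pb d * pc d - d)) n).
have PhiE d n : n != 0 -> Phi d n = (f - (pa d * pb d * pc d - d)) n.
  move=> /negbTE n0; rewrite mkserE n0; case: ifP => // /negbT mn.
  by rewrite (coef_out _ mn).
have [|d Ed] := @fix_ser Phi.
  move=> d d' n mn e; have [->|n0] := eqVneq n 0; first by rewrite !mkserE eqxx.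
  apply/eqP; rewrite -subr_eq0 !PhiE // !coefB.
  have -> : forall x y z t s : rat, x - (y - z) - (x - (t - s)) = (z - s) - (y - t).
    by move=> *; ring.
  rewrite (coefM3_agree n0) ?part0 //; try exact: agp.
  rewrite !partE //; case: (ltrgtP (u n) 0) => _;
  by rewrite ?subrr ?addr0 ?add0r ?subrr.
exists (pa d), (pb d), (pc d); split; rewrite ?part0 //.
- apply: serP => n; have [->|n0] := eqVneq n 0; first by rewrite !coefM0 !part0 f0 !mulr1.
  have := PhiE d n n0; rewrite Ed !coefB => H; lra.
- by move=> n n0; rewrite partE //; case: ifP.
- by move=> n n0; rewrite partE //; case: (u n =P 0).
- by move=> n n0; rewrite partE //; case: ifP.
Qed.

Lemma Pi_exists u f : exists b, f 0 = 1 -> exists a c, fact u f a b c.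
Proof.
case: (eqVneq (f 0) 1) => [/(fact_exists u)[a [b [c F]]]|/eqP ne].
  by exists b => _; exists a, c.
by exists 1.
Qed.

(* The wall function at u of the scattering diagram encoded by f (a junk value
   unless f 0 = 1). *)
Definition Pi u f : ser := projT1 (cid (Pi_exists u f)).

Lemma PiP u f : f 0 = 1 -> exists a c, fact u f a (Pi u f) c.
Proof. by rewrite /Pi; case: cid. Qed.

Lemma PiE u f a b c : fact u f a b c -> Pi u f = b.
Proof.
move=> F; have [|a' [c' F']] := @PiP u f; last exact: fact_uniq F' F.
by rewrite (fact_eq F) !coefM0 (fact_a0 F) (fact_b0 F) (fact_c0 F) !mulr1.
Qed.

Lemma Pi0 u f : f 0 = 1 -> Pi u f 0 = 1.
Proof. by move=> /(PiP u)[a [c F]]; exact: fact_b0 F. Qed.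

Lemma Pi_supp u f n : f 0 = 1 -> n != 0 -> Pi u f n != 0 -> u n = 0.
Proof. by move=> /(PiP u)[a [c F]] n0 fn; exact: (fact_b F n0 fn). Qed.

Lemma Pi_agree u f f' n : f 0 = 1 -> f' 0 = 1 -> n != 0 -> u n = 0 ->
  agree n f f' ->
  agree n (Pi u f) (Pi u f') /\ Pi u f n - Pi u f' n = f n - f' n.
Proof.
move=> /(PiP u)[a [c F]] /(PiP u)[a' [c' F']] n0 un e.
have [ea eb ec] := fact_agree n0 F F' e; split => //.
by have [_ -> _] := fact_diff n0 F F' ea eb ec; rewrite un eqxx.
Qed.

Fact lam_key : unit. Proof. by []. Qed.

(* The coefficient at n of log f, for f 0 = 1; locked, since comparing two values up to
   conversion would evaluate rational sums. *)
Definition lam n f : rat := locked_with lam_key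
  (\sum_(j < ht C n) (-1) ^+ j / j.+1%:R * ((f - 1) ^+ j.+1) n).

Lemma lam_def n f :
  lam n f = \sum_(j < ht C n) (-1) ^+ j / j.+1%:R * ((f - 1) ^+ j.+1) n.
Proof. by rewrite /lam locked_withE. Qed.

Lemma coefX_ht f j n : f 0 = 0 -> (f ^+ j) n != 0 -> (j <= ht C n)%N.
Proof.
move=> f0; elim: j n => // j IH n; rewrite exprS => /coefM_neq0[m [mn fm /IH jm]].
have m0 : m != 0 by apply: contraNneq fm => ->; rewrite f0.
exact: leq_ltn_trans jm (dec_proper_sub mn m0).
Qed.

Lemma subr1_0 f : f 0 = 1 -> (f - 1) 0 = 0.
Proof. by move=> f0; rewrite coefB coef1 eqxx f0 subrr. Qed.

Lemma lamE J n f : f 0 = 1 -> (ht C n <= J)%N ->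
  lam n f = \sum_(j < J) (-1) ^+ j / j.+1%:R * ((f - 1) ^+ j.+1) n.
Proof.
move=> f0 nJ; rewrite lam_def (big_ord_widen _ (fun j => (-1) ^+ j / j.+1%:R * ((f - 1) ^+ j.+1) n) nJ).
rewrite [RHS](bigID (fun j : 'I_J => (j < ht C n)%N)) /=.
rewrite [X in _ = _ + X]big1 ?addr0 // => j; rewrite -leqNgt => nj.
have [->|/(coefX_ht (subr1_0 f0))] := eqVneq (((f - 1) ^+ j.+1) n) 0; first by rewrite mulr0.
by rewrite ltnNge nj.
Qed.

Lemma lam_out n f : ~~ cmem C n -> lam n f = 0.
Proof. by move=> mn; rewrite lam_def big1 // => j _; rewrite coef_out ?mulr0. Qed.

(** To first order log f is f - 1: higher powers of f - 1 see only proper parts of n, since every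
    factor lacks a constant term. *)
Lemma lam_agree n f f' : n != 0 -> f 0 = 1 -> f' 0 = 1 -> agree n f f' ->
  lam n f - lam n f' = f n - f' n.
Proof.
move=> n0 f0 f'0 e; case mn: (cmem C n); last first.
  by rewrite !lam_out ?mn // !coef_out ?mn.
have hn : (0 < ht C n)%N.
  by rewrite lt0n; apply: contraNneq n0 => /(ht_eq0 mn) ->.
rewrite !lam_def -(prednK hn) !big_ord_recl /=.
rewrite !expr1 !divr1 !mul1r !coefB.
have -> : forall x y z s t : rat, x - z + s - (y - z + t) = x - y + (s - t).
  by move=> *; ring.
rewrite -[RHS]addr0; congr (_ + _); rewrite -sumrB big1 // => j _.
rewrite -mulrBr; apply/eqP; rewrite mulf_eq0; apply/orP; right; apply/eqP.
have eB : agree n (f - 1) (f' - 1) by exact: agreeB.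
rewrite !exprS (coefM_agree n0 eB) ?(subr1_0 f0) ?mul0r ?addr0; last exact/agreeM/agreeX.
by rewrite coefM0 (subr1_0 f0) mul0r mulr0.
Qed.

Lemma lam_Pi_agree u n f f' : n != 0 -> u n = 0 -> f 0 = 1 -> f' 0 = 1 ->
  agree n f f' -> lam n (Pi u f) - lam n (Pi u f') = f n - f' n.
Proof.
move=> n0 un f0 f'0 e; have [eP <-] := Pi_agree f0 f'0 n0 un e.
by apply: lam_agree; rewrite ?Pi0.
Qed.

End Agreement.

(** * Transport of series along lattice automorphisms preserving the twist *)

Record isom (N : zmodType) (w : twist N) := Isom {
  iso :> N -> N;
  isoV : N -> N;
  isoK : cancel iso isoV;
  isoVK : cancel isoV iso;
  isoD : forall a b, iso (a + b) = iso a + iso b;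
  isotw : forall a b, w (iso a) (iso b) = w a b }.

Section Transfer.
Context (N : zmodType) (w : twist N) (phi : isom w) (C C' : cone N).
Implicit Types (f g a b c : ser w C) (fs gs : ser w C') (n m : N).

Lemma iso0 : phi 0 = 0.
Proof. by apply: (addrI (phi 0)); rewrite -isoD !addr0. Qed.

Lemma isoN n : phi (- n) = - phi n.
Proof. by apply: (addrI (phi n)); rewrite -isoD !subrr iso0. Qed.

Lemma isoB n m : phi (n - m) = phi n - phi m.
Proof. by rewrite isoD isoN. Qed.

Lemma iso_eq0 n : (phi n == 0) = (n == 0).
Proof. by rewrite -[RHS](inj_eq (can_inj (isoK phi))) iso0. Qed.

(* fs is the image of f under phi, as a series on another cone. *)
Definition sim f (fs : ser w C') := forall n, f n = fs (phi n).

Lemma sim1 : sim 1 1.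
Proof. by move=> n; rewrite !coef1 iso_eq0. Qed.

Lemma simB f fs g gs : sim f fs -> sim g gs -> sim (f - g) (fs - gs).
Proof. by move=> ef eg n; rewrite !coefB ef eg. Qed.

Lemma simM f fs g gs : sim f fs -> sim g gs -> sim (f * g) (fs * gs).
Proof.
move=> ef eg n; rewrite coefM (@coefMr _ _ _ fs gs _ (map phi (dec C n))).
- rewrite big_map; apply: eq_bigr => m _.
  by rewrite -isoB isotw -ef -eg.
- by rewrite map_inj_uniq ?dec_uniq //; exact: can_inj (isoK phi).
- move=> m; rewrite -(isoVK phi m) -isoB -ef -eg => fm gm.
  by rewrite (mem_map (can_inj (isoK phi))) mem_dec (ser_supp fm) (ser_supp gm).
Qed.

Lemma simX f fs j : sim f fs -> sim (f ^+ j) (fs ^+ j).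
Proof.
by move=> e; elim: j => [|j IH]; rewrite ?expr0 ?exprS; [exact: sim1|exact: simM].
Qed.

Lemma sim_at0 f fs : sim f fs -> fs 0 = f 0.
Proof. by move=> e; rewrite e iso0. Qed.

Lemma lam_sim f fs n : f 0 = 1 -> sim f fs -> lam n f = lam (phi n) fs.
Proof.
move=> f0 e; have fs0 := sim_at0 e; rewrite f0 in fs0.
rewrite (lamE f0 (leq_maxl _ (ht C' (phi n)))) (lamE fs0 (leq_maxr (ht C n) _)).
apply: eq_bigr => j _; congr (_ * _); exact: (simX _ (simB e sim1)).
Qed.

Lemma sim_exists f : (forall n, cmem C n -> cmem C' (phi n)) -> exists fs, sim f fs.
Proof.
move=> sub; exists (mkser w C' (fun n => f (isoV phi n))) => n.
rewrite mkserE isoK; case: ifP => // /negbT.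
by case mn: (cmem C n); [rewrite sub | rewrite coef_out ?mn].
Qed.

Lemma Pi_sim u f fs : f 0 = 1 -> (forall n, cmem C n -> cmem C' (phi n)) ->
  sim f fs -> sim (Pi (u \o phi) f) (Pi u fs).
Proof.
move=> f0 sub e; have [a [c F]] := PiP (u \o phi) f0; move: (Pi _ f) F => b F.
have [[a' ea] [b' eb] [c' ec]] := And3 (sim_exists a sub) (sim_exists b sub) (sim_exists c sub).
suff -> : Pi u fs = b' by [].
apply: (@PiE _ _ _ _ _ a' _ c'); split.
- apply: serP => n; rewrite -(isoVK phi n) -e (fact_eq F).
  by apply: simM => //; apply: simM.
- by rewrite (sim_at0 ea) (fact_a0 F).
- by rewrite (sim_at0 eb) (fact_b0 F).
- by rewrite (sim_at0 ec) (fact_c0 F).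
- by move=> n; rewrite -(isoVK phi n) iso_eq0 -ea; exact: (fact_a F).
- by move=> n; rewrite -(isoVK phi n) iso_eq0 -eb; exact: (fact_b F).
- by move=> n; rewrite -(isoVK phi n) iso_eq0 -ec; exact: (fact_c F).
Qed.

End Transfer.

(** * The logarithm at a central exponent *)

Section Euler.
Context (N : zmodType) (w : twist N) (C : cone N).
Local Notation ser := (ser w C).
Implicit Types (f g : ser) (n : N).

Definition euler f : ser := mkser w C (fun n => (ht C n)%:R * f n).

Lemma eulerE f n : euler f n = (ht C n)%:R * f n.
Proof. by rewrite mkserE; case: ifP => // /negbT mn; rewrite coef_out ?mulr0. Qed.

Lemma eulerB f g : euler (f - g) = euler f - euler g.
Proof. by apply: serP => n; rewrite !(eulerE, coefB) mulrBr. Qed.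

Lemma euler1 : euler 1 = 0.
Proof.
apply: serP => n; rewrite eulerE coef1 coef0.
by have [->|_] := eqVneq n 0; rewrite ?ht0 ?mul0r ?mulr0.
Qed.

Lemma eulerM f g : euler (f * g) = euler f * g + f * euler g.
Proof.
apply: serP => n; rewrite coefD eulerE !coefM mulr_sumr -big_split.
apply: eq_big_seq => a /dec_ht h /=; rewrite !eulerE h natrD; ring.
Qed.

Variable n : N.
Hypothesis central : forall a, cmem C a -> w n a = 1.

Lemma coefMC f g : (f * g) n = (g * f) n.
Proof.
have w1 a : a \in dec C n -> w a (n - a) = 1.
  rewrite mem_dec => /andP[ma _].
  by rewrite twDr twNr tw_diag invr1 mulr1 twC central ?invr1.
rewrite coefM [RHS](@coefMr _ _ _ _ _ _ [seq n - a | a <- dec C n]).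
- rewrite big_map; apply: eq_big_seq => a an.
  by rewrite !w1 ?dec_sub // subKr [g _ * _]mulrC.
- by rewrite map_inj_uniq ?dec_uniq // => x y /addrI/oppr_inj.
- move=> a ga fa; apply/mapP; exists (n - a); last by rewrite subKr.
  by rewrite mem_dec subKr (ser_supp fa) (ser_supp ga).
Qed.

Lemma coef_eulerX f j m :
  (euler (f ^+ j) * f ^+ m) n = j%:R * (f ^+ (j + m).-1 * euler f) n.
Proof.
elim: j m => [|j IH] m; first by rewrite expr0 euler1 mul0r coef0 mul0r.
rewrite exprS eulerM mulrDl coefD -mulrA -exprD coefMC.
rewrite -[f * _ * _]mulrA [X in _ + X]coefMC -mulrA -exprSr IH addnS /= -natr1 mulrDl mul1r.
by rewrite addrC.
Qed.

(* The coefficient at n of a product is invariant under cyclic permutations when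
   z^n is central, so that log behaves as in the commutative case there. *)
Lemma lam_trace f f' : f 0 = 1 -> f * f' = 1 ->
  (ht C n)%:R * lam n f = (f' * euler f) n.
Proof.
move=> f0 ff'; set F := f - 1; pose J := (ht C n).+1.
have F0 : F 0 = 0 by exact: subr1_0.
have eF : euler F = euler f by rewrite eulerB euler1 subr0.
have f'f : f' * f = 1.
  have [h [fh hf _]] := ser_inv f0.
  by have -> : f' = h; rewrite // -[f']mul1r -hf -mulrA ff' mulr1.
rewrite (lamE f0 (leqnSn _)) -/J mulr_sumr.
transitivity ((\sum_(j < J) (- F) ^+ j * euler F) n).
  rewrite coef_sum; apply: eq_bigr => j _; rewrite mulrCA -eulerE -/F.
  have := coef_eulerX F j.+1 0; rewrite expr0 mulr1 addn0 /= => ->.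
  rewrite mulrA divfK ?pnatr_eq0 // [(- F) ^+ _]exprNn.
  by rewrite -[in LHS]signr_odd -[in RHS]signr_odd; case: (odd j); rewrite ?expr1 ?expr0 ?mul1r ?mulNr ?mul1r ?coefN.
rewrite -mulr_suml eF.
have fS : f * \sum_(j < J) (- F) ^+ j = 1 - (- F) ^+ J.
  elim: (J) => [|j IH]; first by rewrite big_ord0 mulr0 expr0 subrr.
  have fE : f = 1 - - F by rewrite opprK addrBK.
  by rewrite big_ord_recr mulrDr IH fE mulrBl mul1r -exprS addrA subrK.
have -> : \sum_(j < J) (- F) ^+ j = f' - f' * (- F) ^+ J.
  by rewrite -[LHS]mul1r -f'f -mulrA fS mulrBr mulr1.
rewrite mulrBl coefB -[X in _ - X]opprK opprK; apply/eqP.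
rewrite subr_eq addrC -subr_eq subrr eq_sym; apply/eqP.
(* The remainder of the geometric sum contains J = ht n + 1 factors without constant term, too many
   for the height of n. *)
rewrite -mulrA coefMC; apply/eqP; apply: contraT => /coefM_neq0[a [an ha _]].
move: ha => /coefM_neq0[b [ba hb _]].
have := coefX_ht _ hb; rewrite coefN F0 oppr0 => /(_ erefl).
by rewrite /J (dec_ht an) (dec_ht ba); lia.
Qed.

(** By [lam_trace] the coefficient is that of the logarithmic derivative, which is additive under
    products up to a conjugation that the coefficient at a central exponent does not see. *)
Lemma lamM_central f g : n != 0 -> f 0 = 1 -> g 0 = 1 ->
  lam n (f * g) = lam n f + lam n g.
Proof.
move=> n0 f0 g0; case mn: (cmem C n); last by rewrite !lam_out ?mn ?addr0.
have hn : (ht C n)%:R != 0 :> rat.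
  by rewrite pnatr_eq0; apply: contraNneq n0 => /(ht_eq0 mn) ->.
apply: (mulfI hn); rewrite mulrDr.
have [f' [ff' f'f _]] := ser_inv f0; have [g' [gg' g'g _]] := ser_inv g0.
rewrite (lam_trace f0 ff') (lam_trace g0 gg') (@lam_trace _ (g' * f')); first last.
- by rewrite mulrA -[f * g * _]mulrA gg' mulr1 ff'.
- by rewrite coefM0 f0 g0 mulr1.
rewrite eulerM mulrDr coefD; congr (_ + _).
  by rewrite -!mulrA coefMC !mulrA -[_ * g * g']mulrA gg' mulr1.
by rewrite -mulrA [f' * (f * _)]mulrA f'f mul1r.
Qed.

End Euler.

Section Subcone.
Context (N : zmodType) (C : cone N) (P : pred N).
Hypotheses (P0 : P 0) (PD : forall a b, P a -> P b -> P (a + b)).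

(** Turns a support condition closed under addition into a cone, so that results valid for all
    series on a cone apply to series with restricted support. *)
Definition subcone : cone N.
Proof.
exists (fun n => cmem C n && P n) (ht C)
  (fun n => [seq a <- dec C n | P a && P (n - a)]).
- by rewrite cmem0.
- by move=> a b /andP[? ?] /andP[? ?]; rewrite cmemD ?PD.
- by move=> a b /andP[? ?] /andP[? ?]; rewrite htD.
- by move=> a /andP[ma _]; exact: ht_eq0.
- by move=> n; rewrite filter_uniq // dec_uniq.
- by move=> n a; rewrite mem_filter mem_dec; case: (P a); case: (P (n - a));
    rewrite ?andbT ?andbF.
Defined.

Lemma subconeE n : cmem subcone n = cmem C n && P n. Proof. by []. Qed.

End Subcone.

Definition iso_id (N : zmodType) (w : twist N) : isom w.
Proof. by exists id id. Defined.

Section LamMul.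
Context (N : zmodType) (w : twist N) (C : cone N).
Implicit Types (f g : ser w C) (n : N).

Lemma ser_restr (C' : cone N) f : (forall n, f n != 0 -> cmem C' n) ->
  exists f' : ser w C', sim (iso_id w) f' f.
Proof.
move=> sub; exists (mkser w C' f) => n; rewrite mkserE /=; case: ifP => // /negbT mn.
by apply/esym/eqP; apply: contraNT mn => /sub.
Qed.

(** Centrality on the two supports is enough: the exponents commuting with z^n form a submonoid, and
    both series live on that subcone. *)
Lemma lamM n f g : n != 0 -> f 0 = 1 -> g 0 = 1 ->
  (forall a, f a != 0 -> w n a = 1) -> (forall a, g a != 0 -> w n a = 1) ->
  lam n (f * g) = lam n f + lam n g.
Proof.
move=> n0 f0 g0 cf cg.
pose P a := w n a == 1.
have P0 : P 0 by rewrite /P tw0r.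
have PD a b : P a -> P b -> P (a + b) by rewrite /P twDr => /eqP -> /eqP ->; rewrite mulr1.
pose C' := subcone C P0 PD.
have [f' ef] : exists f' : ser w C', sim (iso_id w) f' f.
  by apply: ser_restr => a fa; rewrite subconeE (ser_supp fa) /P cf /=.
have [g' eg] : exists g' : ser w C', sim (iso_id w) g' g.
  by apply: ser_restr => a ga; rewrite subconeE (ser_supp ga) /P cg /=.
have f'0 : f' 0 = 1 by rewrite ef.
have g'0 : g' 0 = 1 by rewrite eg.
have fg'0 : (f' * g') 0 = 1 by rewrite coefM0 f'0 g'0 mulr1.
rewrite -(lam_sim n f'0 ef) -(lam_sim n g'0 eg) -(lam_sim n fg'0 (simM ef eg)).
apply: lamM_central => // a; rewrite subconeE => /andP[_ /eqP]; exact.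
Qed.

End LamMul.

(** * Quantum dilogarithms *)

Section QIdentities.
Variable q : rat.
Hypothesis q_gt1 : 1 < q.

Let q_neq0 : q != 0.
Proof. by rewrite gt_eqF // (lt_trans _ q_gt1). Qed.

(* The coefficients of the quantum dilogarithm
   Psi(x) = prod_(r >= 1) (1 + q^(2r-1) x)^-1. *)
Fixpoint psi (j : nat) : rat :=
  if j is i.+1 then psi i * (q / (q ^+ (2 * j) - 1)) else 1.

(** Coefficientwise form of Psi(q^2 x) = (1 + q x) Psi(x). *)
Lemma psiS j : psi j.+1 * q ^+ (2 * j.+1) = psi j.+1 + q * psi j.
Proof.
have : q ^+ (2 * j.+1) - 1 != 0.
  by rewrite subr_eq0 gt_eqF // exprn_egt1.
by rewrite /=; move: (q ^+ _) => x x1; field.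
Qed.

Lemma psi_ge0 j : psi j > 0.
Proof.
elim: j => // j IH; rewrite /= mulr_gt0 // divr_gt0 ?(lt_trans _ q_gt1) //.
by rewrite subr_gt0 exprn_egt1.
Qed.

(* The coefficients of prod_(1 <= r <= c) (1 + q^(2r-1-c) y). *)
Fixpoint sig (c : nat) (j : int) : rat :=
  if c is b.+1 then q ^ (- j) * sig b j + q ^ (c%:Z - j) * sig b (j - 1)
  else (j == 0)%:R.

Lemma sig_out c (j : int) : (j < 0) || (c%:Z < j) -> sig c j = 0.
Proof.
elim: c j => [|c IH] j H /=; first by case: eqP H => // ->.
by rewrite !IH ?mulr0 ?addr0 //; move: H; lia.
Qed.

(** The defining recursion splits off the factor with the highest power of q, this one the factor
    with the lowest; together they give the palindromic symmetry [sig_sym]. *)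
Lemma sigS' c j : sig c.+1 j = q ^ j * sig c j + q ^ (j - c.+1%:Z) * sig c (j - 1).
Proof.
elim: c j => [|c IH] j.
  rewrite /=; have [->|_] := eqVneq j 0; first by rewrite oppr0 !expr0z !mulr0.
  have [/subr0_eq ->|_] := eqVneq (j - 1) 0; last by rewrite !mulr0.
  by rewrite !mulr0.
rewrite [LHS]/= -/(sig c.+1 j) -/(sig c.+1 (j - 1)) [in LHS]IH [in LHS](IH (j - 1)).
rewrite [in RHS]/= !mulrDr !mulrA -!expfzDr //.
have -> : j - 1 - 1 = j - 2 :> int by lia.
have -> : - j + j = 0 :> int by lia.
have -> : - j + (j - c.+1%:Z) = - c.+1%:Z :> int by lia.
have -> : c.+2%:Z - j + (j - 1) = c.+1%:Z :> int by lia.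
have -> : c.+2%:Z - j + (j - 1 - c.+1%:Z) = 0 :> int by lia.
have -> : j + - j = 0 :> int by lia.
have -> : j + (c.+1%:Z - j) = c.+1%:Z :> int by lia.
have -> : j - c.+2%:Z + - (j - 1) = - c.+1%:Z :> int by lia.
have -> : j - c.+2%:Z + (c.+1%:Z - (j - 1)) = 0 :> int by lia.
ring.
Qed.

Lemma sig_sym c j : sig c (c%:Z - j) = sig c j.
Proof.
elim: c j => [|c IH] j; first by rewrite /= sub0r oppr_eq0.
rewrite [LHS]/= sigS' addrC; congr (_ * _ + _ * _).
- by congr (q ^ _); lia.
- by rewrite -IH; congr (sig c _); lia.
- by congr (q ^ _); lia.
- by rewrite -IH; congr (sig c _); lia.
Qed.

Lemma sigS c j : sig c.+1 j = q ^ (- j) * sig c j + q ^ (c.+1%:Z - j) * sig c (j - 1).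
Proof. by []. Qed.

Arguments psi _ : simpl never.
Arguments sig _ _ : simpl never.

(** Coefficientwise form of sig_c(x) Psi(q^(-c) x) = Psi(q^c x), by induction on c through
    [psiS]. *)
Lemma psi_sig c m :
  \sum_(j < m.+1) sig c j%:Z * (psi (m - j) * q ^ (- (c * (m - j))%:Z)) =
  psi m * q ^ (c * m)%:Z.
Proof.
elim: c m => [|c IH] m.
  rewrite big_ord_recl /= subn0 !mul0n oppr0 expr0z big1 ?addr0 ?mul1r //.
  by move=> j _; rewrite mul0r.
transitivity (q ^ (- m%:Z) * (psi m * q ^ (c * m)%:Z) +
   if m is l.+1 then q ^ (c.+1%:Z - m%:Z) * (psi l * q ^ (c * l)%:Z) else 0).
  rewrite -IH mulr_sumr; case: m => [|l].
    rewrite !big_ord1 sigS sub0r (@sig_out c (-1)) // subn0 !muln0.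
    by rewrite !oppr0 !expr0z; ring.
  rewrite -IH mulr_sumr big_ord_recl [X in _ = X + _]big_ord_recl.
  rewrite -addrA -big_split /=; congr (_ + _).
    rewrite sigS sub0r (@sig_out c (-1)) // !oppr0 !expr0z !subn0.
    have -> : q ^ (- (c.+1 * l.+1)%:Z) = q ^ (- l.+1%:Z) * q ^ (- (c * l.+1)%:Z).
      by rewrite -expfzDr //; congr (q ^ _); rewrite mulSn; lia.
    ring.
  apply: eq_bigr => j _; rewrite /bump leq0n add1n subSS sigS.
  have -> : j.+1%:Z - 1 = j%:Z :> int by lia.
  have -> : q ^ (- (c.+1 * (l - j))%:Z) =
     q ^ (- l.+1%:Z + j.+1%:Z) * q ^ (- (c * (l - j))%:Z).
    rewrite -expfzDr //; congr (q ^ _); have jl := ltn_ord j.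
    by move: (nat_of_ord j) jl => i il; rewrite mulSn; lia.
  rewrite mulrDl; congr (_ + _).
    have -> : q ^ (- l.+1%:Z) = q ^ (- j.+1%:Z) * q ^ (- l.+1%:Z + j.+1%:Z).
      by rewrite -expfzDr //; congr (q ^ _); lia.
    ring.
  have -> : q ^ (c.+1%:Z - l.+1%:Z) =
      q ^ (c.+1%:Z - j.+1%:Z) * q ^ (- l.+1%:Z + j.+1%:Z).
    by rewrite -expfzDr //; congr (q ^ _); lia.
  ring.
case: m => [|l]; first by rewrite !muln0 oppr0 !expr0z mul1r addr0.
have -> : q ^ (c.+1 * l.+1)%:Z = q ^+ (2 * l.+1) * (q ^ (- l.+1%:Z) * q ^ (c * l.+1)%:Z).
  by rewrite [q ^+ _]exprnP -!expfzDr //; congr (q ^ _); rewrite mulSn; lia.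
rewrite [RHS]mulrA psiS.
have e : q ^ (c.+1%:Z - l.+1%:Z) * q ^ (c * l)%:Z =
    q * (q ^ (- l.+1%:Z) * q ^ (c * l.+1)%:Z).
  transitivity (q ^ 1 * (q ^ (- l.+1%:Z) * q ^ (c * l.+1)%:Z)); last by rewrite expr1z.
  by rewrite -!expfzDr //; congr (q ^ _); rewrite mulnS; lia.
have -> : q ^ (c.+1%:Z - l.+1%:Z) * (psi l * q ^ (c * l)%:Z) =
          psi l * (q ^ (c.+1%:Z - l.+1%:Z) * q ^ (c * l)%:Z) by ring.
rewrite e; ring.
Qed.

Section Convolution.
Variables (B c : nat) (X : nat -> rat).
Hypothesis X_out : forall j, (B <= j)%N -> X j = 0.

Lemma sum_shift (a : nat -> rat) l j :
  \sum_(i < B) a i * X (l + i + j)%N =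
  \sum_(m < B) (if (j <= m)%N then a (m - j)%N else 0) * X (l + m)%N.
Proof.
pose G m := (if (j <= m)%N then a (m - j)%N else 0) * X (l + m)%N.
transitivity (\sum_(m < B + j) G m); last first.
  rewrite big_split_ord /= [X in _ + X]big1 ?addr0 // => i _.
  by rewrite /G X_out ?mulr0 //; lia.
rewrite addnC big_split_ord /= [X in _ = X + _]big1 ?add0r => [|i _].
  apply: eq_bigr => i _; rewrite /G leq_addr addKn; congr (_ * X _); lia.
by rewrite /G leqNgt ltn_ord mul0r.
Qed.

(** [psi_sig] read as an identity of power series in the shift operator, which acts nilpotently on
    X. *)
Lemma sig_convolution l :
  \sum_(i < B) psi i * q ^ (- (c * i)%:Z) *
      (\sum_(j < c.+1) sig c j%:Z * X (l + i + j)%N) =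
  \sum_(i < B) psi i * q ^ (c * i)%:Z * X (l + i)%N.
Proof.
transitivity (\sum_(j < c.+1) sig c j%:Z *
   \sum_(i < B) psi i * q ^ (- (c * i)%:Z) * X (l + i + j)%N).
  under eq_bigr do rewrite mulr_sumr.
  rewrite exchange_big /=; apply: eq_bigr => j _; rewrite mulr_sumr.
  by apply: eq_bigr => i _; rewrite mulrCA.
under eq_bigr => j _ do rewrite (sum_shift (fun i => psi i * q ^ (- (c * i)%:Z))) mulr_sumr.
rewrite exchange_big /=; apply: eq_bigr => m _.
under eq_bigr do rewrite mulrA.
rewrite -mulr_suml; congr (_ * _); rewrite -psi_sig.
pose G j := sig c j%:Z * (if (j <= m)%N then psi (m - j) * q ^ (- (c * (m - j))%:Z) else 0).
have Gc : forall d, (c <= d)%N -> \sum_(j < c.+1) G j = \sum_(j < d.+1) G j.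
  move=> d cd; rewrite (big_ord_widen d.+1 G) // big_mkcond /=; apply: eq_bigr => j _.
  by case: ifP => // /negbT jc; rewrite /G sig_out ?mul0r //; lia.
have Gm : forall d, (m <= d)%N -> \sum_(j < m.+1) G j = \sum_(j < d.+1) G j.
  move=> d md; rewrite (big_ord_widen d.+1 G) // big_mkcond /=; apply: eq_bigr => j _.
  by case: ifP => // /negbT jc; rewrite /G ifN ?mulr0 //; lia.
transitivity (\sum_(j < m.+1) G j).
  by rewrite (Gm (maxn c m)) ?leq_maxr // -(Gc (maxn c m)) ?leq_maxl.
by apply: eq_bigr => j _; rewrite /G; have := ltn_ord j; rewrite ltnS => ->.
Qed.

Lemma psi_cancel (s : int) (D : nat -> rat) : (forall j, (B <= j)%N -> D j = 0) ->
  (forall l, \sum_(i < B) psi i * q ^ (s * i%:Z) * D (l + i)%N = 0) ->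
  forall l, D l = 0.
Proof.
move=> D0 H; suff key d l : (B <= l + d)%N -> D l = 0.
  by move=> l; apply: (key B); rewrite leq_addl.
elim: d l => [|d IH] l Bl; first by rewrite D0 // -[l]addn0.
have [Bl'|lB] := leqP B l; first exact: D0.
have Bp : (0 < B)%N by apply: leq_ltn_trans lB.
have := H l; rewrite -(prednK Bp) big_ord_recl /= mulr0 expr0z !mul1r addn0 big1 ?addr0 //.
move=> i _; rewrite IH ?mulr0 // /bump leq0n add1n; lia.
Qed.

(** With T the shift, the hypothesis says Psi(q^c T) X = Psi(q^(-c) T) Y. A power series in T with
    constant term 1 can be cancelled ([psi_cancel]), which leaves Y = sig_c(T) X. *)
Lemma sig_solve (Y : nat -> rat) : (forall j, (B <= j)%N -> Y j = 0) ->
  (forall l, \sum_(i < B) psi i * q ^ (c * i)%:Z * X (l + i)%N =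
             \sum_(i < B) psi i * q ^ (- (c * i)%:Z) * Y (l + i)%N) ->
  forall l, Y l = \sum_(j < c.+1) sig c j%:Z * X (l + j)%N.
Proof.
move=> Y0 H l; apply/eqP; rewrite -subr_eq0; apply/eqP; move: l.
apply: (psi_cancel (s := - c%:Z)) => [j Bj|l].
  rewrite Y0 // big1 ?subrr // => i _; rewrite X_out ?mulr0 //; lia.
under eq_bigr => i _ do rewrite mulrBr.
rewrite sumrB; apply/eqP; rewrite subr_eq0; apply/eqP.
have e (i : nat) : - c%:Z * i%:Z = - (c * i)%:Z :> int by rewrite mulNr PoszM.
under eq_bigr do rewrite e.
by under [RHS]eq_bigr do rewrite e; rewrite -H -sig_convolution.
Qed.

End Convolution.
End QIdentities.

(** * Seeds and their cones *)

Section Form.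
Context (I : finType) (N : zmodType) (S : seed_datum I N).
Implicit Types x y : N.

Lemma formNl x y : form S (- x) y = - form S x y.
Proof. by apply: (addrI (form S x y)); rewrite -formDl !subrr form0l. Qed.

Lemma formNr x y : form S x (- y) = - form S x y.
Proof. by rewrite form_skew formNl -form_skew form_skew. Qed.

Lemma form_diag x : form S x x = 0.
Proof. have := form_skew S x x; lra. Qed.

Lemma form_mulrzr x y (m : int) : form S x (y *~ m) = form S x y * m%:~R.
Proof.
have nat_case j : form S x (y *+ j) = form S x y * j%:R.
  elim: j => [|j IH]; first by rewrite !mulr0n form0r mulr0.
  by rewrite mulrS formDr IH -natr1 mulrDr mulr1 addrC.
case: m => j; first by rewrite -pmulrn nat_case.
by rewrite NegzE mulrNz formNr -pmulrn nat_case mulrNz mulrN.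
Qed.

Lemma form_mulrzl x y (m : int) : form S (x *~ m) y = form S x y * m%:~R.
Proof. by rewrite form_skew form_mulrzr form_skew mulNr opprK. Qed.

Lemma form_sumr x (F : I -> N) : form S x (\sum_i F i) = \sum_i form S x (F i).
Proof. by apply: (big_morph (form S x)); [exact: formDr | exact: form0r]. Qed.

Definition tw_exp x y : int := Num.floor (- ((qden S)%:R * form S x y)).

Lemma tw_expE x y : (tw_exp x y)%:~R = - ((qden S)%:R * form S x y).
Proof. by apply/eqP; rewrite -intrEfloor rpredN qden_form. Qed.

(* The quantum torus of S specialized at q^(1/d) = 2. *)
Definition form_twist : twist N.
Proof.
exists (fun x y => 2 ^ tw_exp x y) => [x y z|x y z|x].
- rewrite -expfzDr //; congr (_ ^ _); apply: (@intr_inj rat).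
  by rewrite intrD !tw_expE formDl mulrDr opprD.
- rewrite -expfzDr //; congr (_ ^ _); apply: (@intr_inj rat).
  by rewrite intrD !tw_expE formDr mulrDr opprD.
- by rewrite /tw_exp form_diag mulr0 oppr0 floor0 expr0z.
Defined.

(** This is q_k = q^(1/d_k) under the specialization q^(1/d) = 2. *)
Definition qk (k : I) : rat := 2 ^+ (qden S %/ mult S k)%N.

Lemma qk_gt1 k : 1 < qk k.
Proof.
by rewrite /qk exprn_egt1 // -lt0n divn_gt0 ?mult_gt0 // dvdn_leq ?qden_gt0 ?qden_mult.
Qed.

(** Inductions along paths change the initial seed, so every seed has to carry its dual coordinates
    and its integrality. *)
Record bseed := BSeed {
  bs :> I -> N;
  co : I -> N -> int;
  coD : forall i x y, co i (x + y) = co i x + co i y;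
  coE : forall n, n = \sum_i bs i *~ co i n;
  co_bs : forall i j, co i (bs j) = (i == j)%:R;
  bs_int : forall i j, (i \in uf S) || (j \in uf S) -> eps S bs i j \is a Num.int }.

Section SeedTheory.
Context (s : bseed).
Implicit Types (i j k : I) (n : N).

Lemma co0 i : co s i 0 = 0.
Proof. by apply: (addrI (co s i 0)); rewrite -coD !addr0. Qed.

Lemma coN i n : co s i (- n) = - co s i n.
Proof. by apply: (addrI (co s i n)); rewrite -coD !subrr co0. Qed.

Lemma coB i n m : co s i (n - m) = co s i n - co s i m.
Proof. by rewrite coD coN. Qed.

Lemma coMn i n m : co s i (n *+ m) = co s i n *+ m.
Proof. by elim: m => [|m IH]; rewrite ?mulr0n ?co0 // !mulrS coD IH. Qed.

Lemma coMz i n (m : int) : co s i (n *~ m) = co s i n * m.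
Proof.
case: m => m; first by rewrite -!pmulrn coMn -mulr_natr natz.
by rewrite NegzE mulrNz coN -pmulrn coMn mulrN -mulr_natr natz.
Qed.

Lemma co_sum (F : I -> N) i : co s i (\sum_j F j) = \sum_j co s i (F j).
Proof. by apply: (big_morph (co s i)); [exact: coD | exact: co0]. Qed.

Lemma co_inj n m : (forall i, co s i n = co s i m) -> n = m.
Proof. by move=> e; rewrite (coE s n) (coE s m); apply: eq_bigr => i _; rewrite e. Qed.

Definition ps k n : int := Num.floor ((mult S k)%:R * form S (s k) n).

Lemma psE k n : k \in uf S -> (ps k n)%:~R = (mult S k)%:R * form S (s k) n.
Proof.
move=> ku; apply/eqP; rewrite -intrEfloor (coE s n) form_sumr mulr_sumr.
apply: rpred_sum => i _; rewrite form_mulrzr mulrA rpredM ?rpred_int //.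
by have := @bs_int s k i; rewrite ku; apply.
Qed.

Section Direction.
Context (k : I) (ku : k \in uf S).

Lemma psD n m : ps k (n + m) = ps k n + ps k m.
Proof. by apply: (@intr_inj rat); rewrite intrD !psE // formDr mulrDr. Qed.

Lemma psk : ps k (s k) = 0.
Proof. by rewrite /ps form_diag mulr0 floor0. Qed.

Lemma ps0 : ps k 0 = 0.
Proof. by rewrite /ps form0r mulr0 floor0. Qed.

Lemma psN n : ps k (- n) = - ps k n.
Proof. by apply: (addrI (ps k n)); rewrite -psD !subrr ps0. Qed.

Lemma psMz n (m : int) : ps k (n *~ m) = ps k n * m.
Proof. by apply: (@intr_inj rat); rewrite intrM !psE // form_mulrzr mulrA. Qed.

Lemma psMn n (m : nat) : ps k (n *+ m) = ps k n *+ m.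
Proof. by rewrite pmulrn psMz -[RHS]mulr_natr natz. Qed.

Lemma twE n : form_twist (s k) n = qk k ^ (- ps k n).
Proof.
rewrite /= /qk exprnP exprz_exp; congr (_ ^ _); apply: (@intr_inj rat).
rewrite intrM intrN psE // tw_expE mulrN; congr (- _).
by rewrite mulrA -[X in _ = X * _]natrM divnK ?qden_mult.
Qed.

Definition tau n : N := n + s k *~ ps k n.
Definition tauV n : N := n - s k *~ ps k n.

Lemma tauE n : tau n = n + s k *~ ps k n. Proof. by []. Qed.

Lemma ps_tau n : ps k (tau n) = ps k n.
Proof. by rewrite /tau psD psMz psk mul0r addr0. Qed.

Lemma ps_tauV n : ps k (tauV n) = ps k n.
Proof. by rewrite /tauV psD psN psMz psk mul0r subr0. Qed.

Lemma tauK : cancel tau tauV.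
Proof. by move=> n; rewrite /tauV ps_tau /tau addrK. Qed.

Lemma tauVK : cancel tauV tau.
Proof. by move=> n; rewrite /tau ps_tauV /tauV subrK. Qed.

Lemma tauD n m : tau (n + m) = tau n + tau m.
Proof. by rewrite /tau psD mulrzDr addrACA. Qed.

Lemma form_tau n m : form S (tau n) (tau m) = form S n m.
Proof.
rewrite /tau formDl !formDr !form_mulrzl !form_mulrzr form_diag.
rewrite !psE // (form_skew S (s k) n); ring.
Qed.

Definition iso_tau : isom form_twist.
Proof.
exists tau tauV; [exact: tauK | exact: tauVK | exact: tauD |].
by move=> a b /=; rewrite /tw_exp form_tau.
Defined.

Lemma tau_k : tau (s k) = s k.
Proof. by rewrite /tau psk mulr0z addr0. Qed.

Definition rect i : int := Num.floor (pos_part (eps S s k i)).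

Lemma rectE i : rect i = Num.max 0 (ps k (s i)).
Proof.
rewrite /rect; have -> : eps S s k i = (ps k (s i))%:~R by rewrite psE.
rewrite /pos_part; have [h|/ltW h] := leP 0 (ps k (s i)).
  by rewrite !max_r ?ler0z // intrKfloor.
by rewrite !max_l ?lerz0 // floor0.
Qed.

Lemma rect_k : rect k = 0.
Proof. by rewrite rectE psk maxxx. Qed.

Definition bmut_co i n : int :=
  if i == k then - co s k n + \sum_j co s j n * rect j else co s i n.

Definition bmut : bseed.
Proof.
exists (mutate S k s) bmut_co.
- move=> i x y; rewrite /bmut_co; case: ifP => _; last exact: coD.
  under eq_bigr do rewrite coD mulrDl.
  by rewrite big_split coD opprD /= addrACA.
- move=> n; rewrite [LHS](coE s n) (bigD1 k) // [RHS](bigD1 k) //=.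
  rewrite /mutate /bmut_co eqxx mulrzDr mulNrz mulrNz opprK -addrA; congr (_ + _).
  under [in RHS]eq_bigr => i /negbTE ik do rewrite ik mulrzDl.
  rewrite big_split /= addrCA -[LHS]addr0; congr (_ + _).
  rewrite mulNrz mulrz_sumr (bigD1 k) //= rect_k mulr0 mulr0z add0r addrC -sumrB.
  by rewrite big1 // => i _; rewrite -mulrzA mulrC subrr.
- move=> i j; rewrite /mutate /bmut_co -/(rect j).
  case: (eqVneq i k) => [?|ik]; case: (eqVneq j k) => [?|jk]; try subst i; try subst j.
  + rewrite coN co_bs eqxx opprK big1 ?addr0 // => i _.
    by rewrite coN co_bs; case: eqP => [->|_]; rewrite ?rect_k ?mulr0 ?mul0r // oppr0 mul0r.
  + rewrite coD coMz !co_bs eqxx mul1r [k == j]eq_sym (negbTE jk) add0r.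
    rewrite (bigD1 j) //= coD coMz !co_bs eqxx (negbTE jk) mul0r addr0 mul1r.
    rewrite big1 ?addr0 ?addNr // => i ij; rewrite coD coMz !co_bs (negbTE ij) add0r.
    by case: eqP => [->|_]; rewrite ?mul0r // rect_k mulr0.
  + by rewrite coN co_bs (negbTE ik) oppr0 //.
  + by rewrite coD coMz !co_bs (negbTE ik) mul0r addr0.
- have H i j : (i \in uf S) || (j \in uf S) ->
     (mult S i)%:R * form S (s i) (s j) \is a Num.int := @bs_int s i j.
  have Hk i : (mult S i)%:R * form S (s i) (s k) \is a Num.int.
    by apply: H; rewrite ku orbT.
  have Hk' i : (mult S k)%:R * form S (s k) (s i) \is a Num.int.
    by apply: H; rewrite ku.
  move=> i j ij; rewrite /eps /mutate -/(rect i) -/(rect j).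
  case: ifP => ik; case: ifP => jk.
  + by rewrite formNl formNr !mulrN rpredN (eqP ik) rpredN.
  + by rewrite formNl formDr form_mulrzr form_diag mul0r addr0 (eqP ik) mulrN rpredN.
  + by rewrite formNr formDl form_mulrzl form_diag mul0r addr0 mulrN rpredN Hk.
  (* Here d_i {e_k, e_j} alone may fail to be an integer; a nonzero rect_i equals d_k {e_k, e_i},
     and regrouping gives minus the product of the integers eps_ik and eps_kj. *)
  + have hb : (mult S i)%:R * form S (s k) (s j) * (rect i)%:~R \is a Num.int.
      rewrite rectE; have [h|/ltW h] := leP 0 (ps k (s i)); last by rewrite mulr0.
      rewrite psE //; have := rpredM (Hk i) (Hk' j); rewrite (form_skew S (s k) (s i)).
      by rewrite mulrN mulNr rpredN; apply: etrans; congr (_ \is a Num.int); ring.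
    have -> : (mult S i)%:R * form S (s i + s k *~ rect i) (s j + s k *~ rect j) =
        (mult S i)%:R * form S (s i) (s j) +
        (mult S i)%:R * form S (s i) (s k) * (rect j)%:~R +
        (mult S i)%:R * form S (s k) (s j) * (rect i)%:~R.
      rewrite formDl !formDr !form_mulrzl !form_mulrzr form_diag; ring.
    by rewrite !rpredD // ?H // rpredM // ?Hk // rpred_int.
Defined.

Lemma bmutE i : bmut i = mutate S k s i. Proof. by []. Qed.

Lemma bmut_co_neq i n : i != k -> co bmut i n = co s i n.
Proof. by rewrite /= /bmut_co => /negbTE ->. Qed.

Lemma bmut_k : bmut k = - s k.
Proof. by rewrite bmutE /mutate eqxx. Qed.

Lemma bmut_neq i : i != k -> bmut i = s i + s k *~ rect i.
Proof. by move=> /negbTE ik; rewrite bmutE /mutate ik. Qed.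

Lemma bmut_neg i : i != k -> ps k (s i) <= 0 -> bmut i = s i.
Proof. by move=> ik h; rewrite bmut_neq // rectE max_l // mulr0z addr0. Qed.

Lemma bmut_pos i : i != k -> 0 <= ps k (s i) -> bmut i = tau (s i).
Proof. by move=> ik h; rewrite bmut_neq // rectE max_r. Qed.

End Direction.

(** Only unfrozen directions carry incoming walls, so the diagram lives in the cone they span. *)
Definition cone_mem n :=
  [forall i, if i \in uf S then 0 <= co s i n else co s i n == 0].

Definition cone_ht n : nat := (\sum_i `|co s i n|)%N.

Lemma cone_memP n : reflect
  ((forall i, 0 <= co s i n) /\ (forall i, i \notin uf S -> co s i n = 0))
  (cone_mem n).
Proof.
apply: (iffP forallP) => [H|[H1 H2] i].
  split=> [i|i /negbTE iu]; have := H i; rewrite ?iu; last by move/eqP.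
  by case: ifP => // _ /eqP ->.
by case: ifP => // /negbT /H2 ->.
Qed.

Definition cone_dec n : seq N :=
  undup [seq a <- [seq \sum_i s i *+ v i | v : {ffun I -> 'I_(cone_ht n).+1}]
        | cone_mem a && cone_mem (n - a)].

Definition seed_cone : cone N.
Proof.
exists cone_mem cone_ht cone_dec.
- by apply/cone_memP; split=> i; rewrite co0.
- move=> a b /cone_memP[a0 au] /cone_memP[b0 bu]; apply/cone_memP; split=> i.
    by rewrite coD addr_ge0.
  by move=> iu; rewrite coD au ?bu.
- move=> a b /cone_memP[a0 _] /cone_memP[b0 _]; rewrite /cone_ht -big_split /=.
  by apply: eq_bigr => i _; have := a0 i; have := b0 i; rewrite coD; lia.
- move=> a _ /eqP; rewrite sum_nat_eq0 => /forallP H; apply: co_inj => i.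
  by rewrite co0; have := H i; rewrite absz_eq0 => /eqP.
- by move=> n; exact: undup_uniq.
- move=> n a; rewrite mem_undup mem_filter; case: (boolP (cone_mem a)) => //= ma.
  case: (boolP (cone_mem (n - a))) => //= mna; apply/mapP.
  move/cone_memP: ma => [a0 _]; move/cone_memP: mna => [na0 _].
  have bound i : (`|co s i a| < (cone_ht n).+1)%N.
    rewrite ltnS /cone_ht (bigD1 i) //=; apply: leq_trans (leq_addr _ _).
    by have := a0 i; have := na0 i; rewrite coB; lia.
  exists [ffun i => Ordinal (bound i)]; first by rewrite mem_enum.
  rewrite {1}(coE s a); apply: eq_bigr => i _; rewrite ffunE /= pmulrn.
  by congr (_ *~ _); have := a0 i; lia.
Defined.

Lemma seed_coneP n : reflect
  ((forall i, 0 <= co s i n) /\ (forall i, i \notin uf S -> co s i n = 0))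
  (cmem seed_cone n).
Proof. exact: cone_memP. Qed.

Lemma cmem_mulrn k (m : nat) : k \in uf S -> cmem seed_cone (s k *+ m).
Proof.
move=> ku; apply/seed_coneP; split=> i; rewrite coMn co_bs.
  by case: eqP => _; lia.
by case: eqP => [->|_]; rewrite ?ku // mul0rn.
Qed.

Lemma ht_mulrn k (m : nat) : ht seed_cone (s k *+ m) = m.
Proof.
rewrite /= /cone_ht (bigD1 k) //= coMn co_bs big1 ?addn0 => [|i /negbTE ik].
  by rewrite eqxx; lia.

by rewrite coMn co_bs ik mul0rn.
Qed.

End SeedTheory.
End Form.

(** * Wall functions of products *)

Section PiProduct.
Context (N : zmodType) (w : twist N) (C : cone N).
Implicit Types (p f a b c : ser w C) (n m : N).
Variable u : N -> rat.
Hypothesis uD : forall x y, u (x + y) = u x + u y.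

Let u0 : u 0 = 0. Proof. by apply: (addrI (u 0)); rewrite -uD !addr0. Qed.

Lemma suppM (P : rat -> Prop) f p : (P 0) -> (forall x y, P x -> P y -> P (x + y)) ->
  (forall n, f n != 0 -> P (u n)) -> (forall n, p n != 0 -> P (u n)) ->
  forall n, (f * p) n != 0 -> P (u n).
Proof.
move=> P0 PD hf hp n /coefM_neq0[m [_ fm pm]].
by rewrite -(addrBK m n) uD; apply: PD; [exact: hf | exact: hp].
Qed.

Lemma PiM_pos p f : p 0 = 1 -> f 0 = 1 ->
  (forall n, n != 0 -> p n != 0 -> 0 < u n) -> Pi u (p * f) = Pi u f.
Proof.
move=> p0 f0 hp; have [a [c F]] := PiP u f0; move: (Pi u f) F => b F.
apply: (@PiE _ _ _ _ _ (p * a) _ c); split.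
- by rewrite (fact_eq F) !mulrA.
- by rewrite coefM0 p0 (fact_a0 F) mulr1.
- exact: fact_b0 F.
- exact: fact_c0 F.
- move=> n n0 /coefM_neq0[m [_ pm am]].
  have [m0|m0] := eqVneq m 0; first by apply: (fact_a F) => //; move: am; rewrite m0 subr0.
  have um := hp m m0 pm; have [e|nm] := eqVneq (n - m) 0; first by rewrite (subr0_eq e).
  by rewrite -(addrBK m n) uD addr_gt0 // (fact_a F nm am).
- exact: fact_b F.
- exact: fact_c F.
Qed.

Lemma PiM_neg p f : p 0 = 1 -> f 0 = 1 ->
  (forall n, n != 0 -> p n != 0 -> u n < 0) -> Pi u (f * p) = Pi u f.
Proof.
move=> p0 f0 hp; have [a [c F]] := PiP u f0; move: (Pi u f) F => b F.
apply: (@PiE _ _ _ _ _ a _ (c * p)); split.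
- by rewrite (fact_eq F) !mulrA.
- exact: fact_a0 F.
- exact: fact_b0 F.
- by rewrite coefM0 p0 (fact_c0 F) mulr1.
- exact: fact_a F.
- exact: fact_b F.
- move=> n n0 /coefM_neq0[m [_ am pm]].
  have [m0|m0] := eqVneq m 0; first by apply: hp => //; move: pm; rewrite m0 subr0.
  have um := fact_c F m0 am; have [e|nm] := eqVneq (n - m) 0; first by rewrite (subr0_eq e).
  by rewrite -(addrBK m n) uD -oppr_gt0 opprD addr_gt0 // oppr_gt0 // hp.
Qed.

(** Conjugation by a series on the hyperplane u = 0 preserves supports in u > 0: a term of a' - 1 of
    least height with u <= 0 would survive in (a' - 1) p, whereas p (a - 1) has no such term. *)
Lemma conj_pos p a : p 0 = 1 -> (forall n, p n != 0 -> u n = 0) -> a 0 = 1 ->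
  (forall n, n != 0 -> a n != 0 -> 0 < u n) ->
  exists a', [/\ a' * p = p * a, a' 0 = 1 &
                 forall n, n != 0 -> a' n != 0 -> 0 < u n].
Proof.
move=> p0 hp a0 ha; have [a' e] := ser_divr (p * a) p0.
have a'0 : a' 0 = 1.
  by move/(congr1 (fun x : ser w C => x 0)): e; rewrite !coefM0 p0 a0 !mulr1.
exists a'; split => // n n0 a'n; rewrite ltNge; apply/negP => un.
have E : (a' - 1) * p = p * (a - 1) by rewrite mulrBl mulrBr e mul1r mulr1.
suff key m : u m <= 0 -> (a' - 1) m = 0.
  by move: (key n un); rewrite coefB coef1 (negbTE n0) subr0 => /eqP; rewrite (negbTE a'n).
elim: {m}(ht C m).+1 {-2}m (ltnSn (ht C m)) => // H IH m mH um.
apply/eqP; apply: contraT => Xm; have mm := ser_supp Xm.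
have : (p * (a - 1)) m = 0.
  apply/eqP; apply: contraT => /coefM_neq0[x [_ px]].
  have [->|mx] := eqVneq (m - x) 0; first by rewrite coefB a0 coef1 eqxx subrr.
  rewrite coefB coef1 (negbTE mx) subr0 => /(ha _ mx).
  by rewrite -(addrBK x m) uD (hp x px) add0r in um; rewrite ltNge um.
rewrite -E (@coefMr _ _ _ _ _ _ [:: m]) //.
  by rewrite big_seq1 subrr tw0r p0 mulr1 mul1r => /eqP; rewrite (negbTE Xm).
move=> x Xx px; rewrite inE; apply/negPn/negP => xm.
have xdec : x \in dec C m by rewrite mem_dec (ser_supp Xx) (ser_supp px).
move/eqP: Xx; apply; apply: IH; first exact: leq_trans (dec_proper xdec xm) _.
by move: um; rewrite -(addrBK x m) uD (hp _ px) addr0.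
Qed.

Lemma conj_neg p c : p 0 = 1 -> (forall n, p n != 0 -> u n = 0) -> c 0 = 1 ->
  (forall n, n != 0 -> c n != 0 -> u n < 0) ->
  exists c', [/\ p * c' = c * p, c' 0 = 1 &
                 forall n, n != 0 -> c' n != 0 -> u n < 0].
Proof.
move=> p0 hp c0 hc; have [c' e] := ser_div (c * p) p0.
have c'0 : c' 0 = 1.
  by move/(congr1 (fun x : ser w C => x 0)): e; rewrite !coefM0 p0 c0 !mul1r.
exists c'; split => // n n0 c'n; rewrite ltNge; apply/negP => un.
have E : p * (c' - 1) = (c - 1) * p by rewrite mulrBl mulrBr e mul1r mulr1.
suff key m : 0 <= u m -> (c' - 1) m = 0.
  by move: (key n un); rewrite coefB coef1 (negbTE n0) subr0 => /eqP; rewrite (negbTE c'n).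
elim: {m}(ht C m).+1 {-2}m (ltnSn (ht C m)) => // H IH m mH um.
apply/eqP; apply: contraT => Xm; have mm := ser_supp Xm.
have : ((c - 1) * p) m = 0.
  apply/eqP; apply: contraT => /coefM_neq0[x [_ cx px]]; move: cx.
  have [->|x0] := eqVneq x 0; first by rewrite coefB c0 coef1 eqxx subrr.
  rewrite coefB coef1 (negbTE x0) subr0 => /(hc _ x0).
  by move: um; rewrite -{1}(addrBK x m) uD (hp _ px) addr0 => um; rewrite ltNge um.
rewrite -E (@coefMr _ _ _ _ _ _ [:: 0]) //.
  by rewrite big_seq1 subr0 tw0l p0 !mul1r => /eqP; rewrite (negbTE Xm).
move=> x px Xx; rewrite inE; apply/negPn/negP => x0.
have xdec : x \in dec C m by rewrite mem_dec (ser_supp Xx) (ser_supp px).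
move/eqP: Xx; apply; apply: IH; first exact: leq_trans (dec_proper_sub xdec x0) _.
by move: um; rewrite -{1}(addrBK x m) uD (hp _ px) add0r.
Qed.

(** For f = a b c, conjugating a gives p a b c = a' (p b) c, again a factorization sorted by the
    sign of u. *)
Lemma PiM_levell p f : p 0 = 1 -> f 0 = 1 -> (forall n, p n != 0 -> u n = 0) ->
  Pi u (p * f) = p * Pi u f.
Proof.
move=> p0 f0 hp; have [a [c F]] := PiP u f0; move: (Pi u f) F => b F.
have [a' [e a'0 ha']] := conj_pos p0 hp (fact_a0 F) (fact_a F).
apply: (@PiE _ _ _ _ _ a' _ c); split => //.
- by rewrite (fact_eq F) mulrA mulrA -e -!mulrA.
- by rewrite coefM0 p0 (fact_b0 F) mulr1.
- exact: fact_c0 F.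
- move=> n n0; apply: (suppM (P := fun x => x = 0)) => // [x y -> ->|m bm].
    exact: addr0.
  by have [->|m0] := eqVneq m 0; [exact: u0 | exact: (fact_b F m0 bm)].
- exact: fact_c F.
Qed.

Lemma PiM_levelr p f : p 0 = 1 -> f 0 = 1 -> (forall n, p n != 0 -> u n = 0) ->
  Pi u (f * p) = Pi u f * p.
Proof.
move=> p0 f0 hp; have [a [c F]] := PiP u f0; move: (Pi u f) F => b F.
have [c' [e c'0 hc']] := conj_neg p0 hp (fact_c0 F) (fact_c F).
apply: (@PiE _ _ _ _ _ a _ c'); split => //.
- by rewrite (fact_eq F) -!mulrA -e.
- exact: fact_a0 F.
- by rewrite coefM0 p0 (fact_b0 F) mulr1.
- exact: fact_a F.
- move=> n n0; apply: (suppM (P := fun x => x = 0)) => // [x y -> ->|m bm].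
    exact: addr0.
  by have [->|m0] := eqVneq m 0; [exact: u0 | exact: (fact_b F m0 bm)].
Qed.

Lemma Pi_level f : f 0 = 1 -> (forall n, f n != 0 -> u n = 0) -> Pi u f = f.
Proof.
move=> f0 hf; apply: (@PiE _ _ _ _ _ 1 _ 1); split.
- by rewrite mul1r mulr1.
- by rewrite coef1 eqxx.
- by [].
- by rewrite coef1 eqxx.
- by move=> n /negbTE n0; rewrite coef1 n0.
- by move=> n _; exact: hf.
- by move=> n /negbTE n0; rewrite coef1 n0.
Qed.

End PiProduct.

Section Supports.
Context (N : zmodType) (w : twist N) (C : cone N) (P : pred N).
Hypotheses (P0 : P 0) (PD : forall a b, P a -> P b -> P (a + b)).
Implicit Types f : ser w C.

Lemma lam_supp f n : f 0 = 1 -> (forall m, f m != 0 -> P m) -> ~~ P n ->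
  lam n f = 0.
Proof.
move=> f0 hf nP; have [|f' e] := @ser_restr _ _ _ (subcone C P0 PD) f.
  by move=> m fm; rewrite subconeE (ser_supp fm) hf.
by rewrite -(lam_sim n _ e) ?e // lam_out // subconeE negb_and nP orbT.
Qed.

Lemma lam_Pi_restr (u : N -> rat) f : f 0 = 1 -> (forall m, f m != 0 -> P m) ->
  exists f' : ser w (subcone C P0 PD),
    [/\ forall m, f' m = f m, f' 0 = 1, forall m, Pi u f' m = Pi u f m
      & forall n, lam n (Pi u f') = lam n (Pi u f)].
Proof.
move=> f0 hf; have [|f' e] := @ser_restr _ _ _ (subcone C P0 PD) f.
  by move=> m fm; rewrite subconeE (ser_supp fm) hf.
have f'0 : f' 0 = 1 by rewrite e.
have eP := @Pi_sim _ _ (iso_id w) (subcone C P0 PD) C u _ _ f'0 _ e.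
exists f'; split => // [m|n].
  by apply: eP => k; rewrite subconeE => /andP[].
apply: (lam_sim (phi := iso_id w)) => [|m]; first by rewrite Pi0.
by apply: eP => k; rewrite subconeE => /andP[].
Qed.

Lemma lam_Pi_supp (u : N -> rat) f n : f 0 = 1 -> (forall m, f m != 0 -> P m) ->
  ~~ P n -> lam n (Pi u f) = 0.
Proof.
move=> f0 hf nP; have [f' [_ _ _ <-]] := lam_Pi_restr u f0 hf.
by rewrite lam_out // subconeE negb_and nP orbT.
Qed.

End Supports.

(** * Quantum scattering diagrams and their mutation *)

Section Dilogarithm.
Context (I : finType) (N : zmodType) (S : seed_datum I N).
Local Notation w := (form_twist S).
Local Notation C s := (seed_cone s).
Implicit Types (s : bseed S) (k i : I) (n m : N).

Definition on_axis s i : pred N := fun n => n == s i *+ `|co s i n|%N.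

Lemma axis_mulrn s i j : `|co s i (s i *+ j)|%N = j.
Proof. by rewrite coMn co_bs eqxx; lia. Qed.

Lemma on_axisP s i n : reflect (exists j, n = s i *+ j) (on_axis s i n).
Proof.
apply: (iffP eqP) => [e|[j ->]]; last by rewrite axis_mulrn.
by exists `|co s i n|%N.
Qed.

Lemma on_axis0 s i : on_axis s i 0.
Proof. by apply/on_axisP; exists 0%N. Qed.

Lemma on_axisD s i a b : on_axis s i a -> on_axis s i b -> on_axis s i (a + b).
Proof.
move=> /on_axisP[j ->] /on_axisP[l ->]; apply/on_axisP; exists (j + l)%N.
by rewrite mulrnDr.
Qed.

Lemma axis_inj s i : injective (fun j => s i *+ j).
Proof. by move=> j l e; rewrite -(axis_mulrn s i j) e axis_mulrn. Qed.

Definition Psi s k : ser w (C s) := mkser w (C s)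
  (fun n => if on_axis s k n then psi (qk S k) `|co s k n|%N else 0).

Lemma Psi_axis s k j : k \in uf S -> Psi s k (s k *+ j) = psi (qk S k) j.
Proof.
move=> ku; rewrite mkserE cmem_mulrn // axis_mulrn.
by rewrite (introT (on_axisP s k _)) //; exists j.
Qed.

Lemma Psi_supp s k n : Psi s k n != 0 -> on_axis s k n.
Proof. by rewrite mkserE; case: ifP => // _; case: ifP. Qed.

Lemma Psi0 s k : k \in uf S -> Psi s k 0 = 1.
Proof. by move=> ku; rewrite -(mulr0n (s k)) Psi_axis. Qed.

Lemma Psi_u s k (u : N -> rat) (P : rat -> Prop) :
  (forall x y, u (x + y) = u x + u y) -> P 0 ->
  (forall j : nat, P (u (s k) *+ j)) -> forall n, Psi s k n != 0 -> P (u n).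
Proof.
move=> uD P0 Pj n /Psi_supp/on_axisP[j ->].
have -> : u (s k *+ j) = u (s k) *+ j.
  elim: j => [|j IH]; last by rewrite !mulrS uD IH.
  by apply: (addrI (u 0)); rewrite mulr0n -uD !addr0.
exact: Pj.
Qed.

Lemma lam_Psi_out s k n : k \in uf S -> ~~ on_axis s k n -> lam n (Psi s k) = 0.
Proof.
move=> ku; apply: (lam_supp (@on_axis0 s k) (@on_axisD s k)); first exact: Psi0.
exact: Psi_supp.
Qed.

(* Left and right multiplication by Psi act along the fibres n + Z e_k as
   multiplication by one-variable power series, with x rescaled by q^(-/+ p(n)). *)
Lemma PsiMl s k (h : ser w (C s)) n B : k \in uf S ->
  (forall j, (B <= j)%N -> h (n - s k *+ j) = 0) ->
  (Psi s k * h) n =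
  \sum_(j < B) psi (qk S k) j * qk S k ^ (- ps s k n * j%:Z) * h (n - s k *+ j).
Proof.
move=> ku hB; rewrite (@coefMr _ _ _ _ _ _ [seq s k *+ j | j <- iota 0 B]).
- rewrite big_map -[B in iota _ B]subn0 -/(index_iota 0 B) big_mkord; apply: eq_bigr => j _.
  rewrite Psi_axis // twDr twNr tw_diag invr1 mulr1 tw_mulrnl twE //.
  by rewrite exprnP exprz_exp mulrA [_ * psi _ _]mulrC.
- by rewrite map_inj_uniq ?iota_uniq //; exact: axis_inj.
- move=> a /Psi_supp/on_axisP[j ->] hj; apply/mapP; exists j => //.
  by rewrite mem_iota add0n ltnNge; apply: contraNN hj => /hB ->.
Qed.

Lemma PsiMr s k (h : ser w (C s)) n B : k \in uf S ->
  (forall j, (B <= j)%N -> h (n - s k *+ j) = 0) ->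
  (h * Psi s k) n =
  \sum_(j < B) psi (qk S k) j * qk S k ^ (ps s k n * j%:Z) * h (n - s k *+ j).
Proof.
move=> ku hB; rewrite (@coefMr _ _ _ _ _ _ [seq n - s k *+ j | j <- iota 0 B]).
- rewrite big_map -[B in iota _ B]subn0 -/(index_iota 0 B) big_mkord; apply: eq_bigr => j _.
  rewrite subKr Psi_axis // twDl twNl tw_diag invr1 mulr1 twC tw_mulrnl twE //.
  by rewrite exprnP exprz_exp invr_expz mulNr opprK [h _ * _]mulrC mulrA [_ * psi _ _]mulrC.
- by rewrite map_inj_uniq ?iota_uniq // => a b /addrI/oppr_inj/axis_inj.
- move=> a ha /Psi_supp/on_axisP[j e]; have ea : a = n - s k *+ j by rewrite -e subKr.
  apply/mapP; exists j => //.
  by rewrite mem_iota add0n ltnNge; apply: contraNN ha => /hB; rewrite ea => ->.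
Qed.

Lemma ser_fibre_out s k (h : ser w (C s)) n j : k \in uf S ->
  (ht (C s) n < j)%N -> h (n - s k *+ j) = 0.
Proof.
move=> ku nj; apply/eqP; apply: contraT => /ser_supp mnj.
have := htD mnj (cmem_mulrn s j ku); rewrite subrK ht_mulrn => e.
by move: nj; rewrite e ltnNge leq_addl.
Qed.

Lemma ps_fibre s k n j : k \in uf S -> ps s k (n - s k *+ j) = ps s k n.
Proof. by move=> ku; rewrite psD // psN // psMn // psk mul0rn subr0. Qed.

Lemma fibre_shift s k n l j : n - s k *+ l - s k *+ j = n - s k *+ (l + j).
Proof. by rewrite mulrnDr opprD addrA. Qed.

(* Conjugation by Psi multiplies by a Laurent polynomial (the palindromic [sig])
   along a fibre on which p = d_k {e_k, .} is nonpositive, and divides by one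
   where p is nonnegative; the latter is read as a formula for h in terms of f. *)
Lemma sharp_neg s k (h f : ser w (C s)) n : k \in uf S ->
  Psi s k * h = f * Psi s k -> ps s k n <= 0 ->
  f n = \sum_(j < `|ps s k n|.+1) sig (qk S k) `|ps s k n| j%:Z * h (n - s k *+ j).
Proof.
move=> ku e pn; pose B := (ht (C s) n).+1; set c := `|ps s k n|%N.
have out (g : ser w (C s)) j : (B <= j)%N -> g (n - s k *+ j) = 0.
  exact: ser_fibre_out.
have := @sig_solve (qk S k) (qk_gt1 S k) B c (fun j => h (n - s k *+ j)) (out h)
  (fun j => f (n - s k *+ j)) (out f).
move=> /(_ _ 0%N); rewrite mulr0n subr0; apply=> l.
have := congr1 (fun g : ser w (C s) => g (n - s k *+ l)) e.
have out' (g : ser w (C s)) j : (B <= j)%N -> g (n - s k *+ l - s k *+ j) = 0.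
  by move=> Bj; rewrite fibre_shift out //; lia.
rewrite /= (PsiMl ku (out' h)) (PsiMr ku (out' f)) !ps_fibre //.
have pc : ps s k n = - c%:Z by rewrite /c; lia.
rewrite pc opprK => E; apply: etrans (etrans E _); apply: eq_bigr => j _.
  by rewrite -fibre_shift PoszM.
by rewrite -fibre_shift mulNr PoszM.
Qed.

Lemma sharp_pos s k (h f : ser w (C s)) n : k \in uf S ->
  Psi s k * h = f * Psi s k -> 0 <= ps s k n ->
  h n = \sum_(j < `|ps s k n|.+1) sig (qk S k) `|ps s k n| j%:Z * f (n - s k *+ j).
Proof.
move=> ku e pn; pose B := (ht (C s) n).+1; set c := `|ps s k n|%N.
have out (g : ser w (C s)) j : (B <= j)%N -> g (n - s k *+ j) = 0.
  exact: ser_fibre_out.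
have := @sig_solve (qk S k) (qk_gt1 S k) B c (fun j => f (n - s k *+ j)) (out f)
  (fun j => h (n - s k *+ j)) (out h).
move=> /(_ _ 0%N); rewrite mulr0n subr0; apply=> l.
have := congr1 (fun g : ser w (C s) => g (n - s k *+ l)) e.
have out' (g : ser w (C s)) j : (B <= j)%N -> g (n - s k *+ l - s k *+ j) = 0.
  by move=> Bj; rewrite fibre_shift out //; lia.
rewrite /= (PsiMl ku (out' h)) (PsiMr ku (out' f)) !ps_fibre //.
have pc : ps s k n = c%:Z by rewrite /c; lia.
rewrite pc => /esym E; apply: etrans (etrans E _); apply: eq_bigr => j _.
  by rewrite -fibre_shift PoszM.
by rewrite -fibre_shift mulNr PoszM.
Qed.

Lemma shift_eq (x y z a b : rat) : a - b = x - y -> x + z - a = y + z - b.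
Proof. lra. Qed.

(* The incoming walls are exactly e_i^perp with function Psi(z^(e_i)). *)
Definition inc s n : rat := \sum_(i in uf S) lam n (Psi s i).

(** A consistent scattering diagram with prescribed incoming walls. A wall with normal n is incoming
    when it contains its own direction {n, .}, so only the coefficient at n at that point is
    prescribed. *)
Definition scattering s (g : ser w (C s)) :=
  g 0 = 1 /\ forall n, n != 0 -> lam n (Pi (form S n) g) = inc s n.

(** By [lam_Pi_agree] the prescribed coefficient at n is g n plus an expression in proper parts, so
    the condition can be solved for g n. The auxiliary [nrm] forces constant term 1, without which
    [Pi] takes junk values. *)
Lemma scattering_exists s : exists g, scattering (s := s) g.
Proof.
pose nrm (g : ser w (C s)) : ser w (C s) :=
  mkser w (C s) (fun n => if n == 0 then 1 else g n).
have nrm0 g : nrm g 0 = 1 by rewrite mkserE eqxx cmem0.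
have nrmE g n : n != 0 -> nrm g n = g n.
  by move=> /negbTE n0; rewrite mkserE n0; case: ifP => // /negbT mn; rewrite coef_out.
pose Phi (g : ser w (C s)) : ser w (C s) := mkser w (C s) (fun n =>
  if n == 0 then 1 else g n + inc s n - lam n (Pi (form S n) (nrm g))).
have PhiE (g : ser w (C s)) n : cmem (C s) n -> n != 0 ->
    Phi g n = g n + inc s n - lam n (Pi (form S n) (nrm g)).
  by move=> mn /negbTE n0; rewrite {1}/Phi mkserE mn n0.
have Phi0 g : Phi g 0 = 1 by rewrite {1}/Phi mkserE eqxx cmem0.
clearbody Phi; clearbody nrm.
have [|g Eg] := @fix_ser _ _ _ Phi.
  move=> f f' n mn e; have [->|n0] := eqVneq n 0; first by rewrite !Phi0.
  rewrite (PhiE f n mn n0) (PhiE f' n mn n0).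
  have := @lam_Pi_agree _ _ _ (form S n) n (nrm f) (nrm f') n0 (form_diag S n) (nrm0 f) (nrm0 f').
  rewrite (nrmE f n n0).
  rewrite (nrmE f' n n0).
  move=> H.
  apply: shift_eq.
  apply: H => a an ane; have [->|a0] := eqVneq a 0; first by rewrite !nrm0.
  by rewrite !nrmE // e.
have g0 : g 0 = 1 by rewrite -Eg Phi0.
have gn : nrm g = g.
  by apply: serP => n; have [->|n0] := eqVneq n 0; rewrite ?nrm0 ?nrmE.
exists g; split => // n n0; case mn: (cmem (C s) n); last first.
  rewrite lam_out ?mn // /inc big1 // => i _; rewrite lam_out ?mn //.
have := PhiE g n mn n0; rewrite Eg gn -addrA => /eqP; rewrite -subr_eq0.
by rewrite opprD addrA subrr sub0r oppr_eq0 subr_eq0 eq_sym => /eqP.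
Qed.

End Dilogarithm.

Section Wall.
Context (I : finType) (N : zmodType) (S : seed_datum I N).
Local Notation w := (form_twist S).
Local Notation C s := (seed_cone s).
Context (s : bseed S) (k : I) (ku : k \in uf S) (g : ser w (C s)).
Hypothesis scat : scattering g.
Implicit Types (i j : I) (n m : N).

Let g0 : g 0 = 1 := proj1 scat.

Lemma dec_axis j (l : nat) n : n \in dec (C s) (s j *+ l) -> on_axis s j n.
Proof.
rewrite mem_dec => /andP[/seed_coneP[n0 _] /seed_coneP[l0 _]].
apply/eqP; apply: (@co_inj _ _ _ s) => i; rewrite coMn co_bs.
have := n0 i; have := l0 i; rewrite coB coMn co_bs.
have [->|ij] := eqVneq i j; first by have := n0 j; lia.
lia.
Qed.

Lemma axis_eq0 (j : nat) i : (s i *+ j == 0) = (j == 0%N).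
Proof.
apply/eqP/eqP => [e|->]; last by rewrite mulr0n.
by rewrite -(axis_mulrn s i j) e co0.
Qed.

(** All parts of a multiple of e_k are multiples of e_k, and the other dilogarithms have no
    logarithm on this axis. So g and Psi obey the same recursion there. *)
Lemma scattering_axis n : on_axis s k n -> g n = Psi s k n.
Proof.
elim: {n}(ht (C s) n).+1 {-2}n (ltnSn (ht (C s) n)) => // H IH n nH nax.
have [->|n0] := eqVneq n 0; first by rewrite g0 Psi0.
have /on_axisP[l El] := nax.
have vk : form S n (s k) = 0.
  by rewrite El pmulrn form_mulrzl form_diag mul0r.
have Psiv m : Psi s k m != 0 -> form S n m = 0.
  apply: (Psi_u (P := fun x => x = 0)); [by move=> x y; rewrite formDr | by [] |].
  by move=> j; rewrite vk mul0rn.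
have e : agree n g (Psi s k).
  move=> m mn ne; apply: IH; first exact: leq_trans (dec_proper mn ne) _.
  by rewrite El in mn; exact: dec_axis mn.
have := lam_Pi_agree n0 (form_diag S n) g0 (Psi0 s ku) e.
rewrite (Pi_level (Psi0 s ku) Psiv) (proj2 scat) // /inc (bigD1 k) //=.
rewrite big1 ?addr0 ?subrr => [|i /andP[iu ik]]; first by move/eqP; rewrite eq_sym subr_eq0 => /eqP.
apply: lam_Psi_out => //; apply: contra n0 => /on_axisP[j Ej].
have := congr1 (co s i) El; rewrite Ej !coMn !co_bs eqxx (negbTE ik) mul0rn => e0.
have -> : j = 0%N by lia.
by rewrite mulr0n.
Qed.

(** The whole hyperplane of e_k carries a function with a known nonzero coefficient: g agrees with
    Psi on the parts of e_k, and Psi is its own wall function at u. This makes the walls of chambers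
    detectable. *)
Lemma Pi_wall (u : N -> rat) : (forall x y, u (x + y) = u x + u y) ->
  u (s k) = 0 -> Pi u g (s k) = psi (qk S k) 1.
Proof.
move=> uD uk; have u0 : u 0 = 0 by apply: (addrI (u 0)); rewrite -uD !addr0.
have sk0 : s k != 0 by rewrite -[s k]mulr1n axis_eq0.
have Psiv m : Psi s k m != 0 -> u m = 0.
  by apply: (Psi_u (P := fun x => x = 0)) => // j; rewrite uk mul0rn.
have e : agree (s k) g (Psi s k).
  by move=> m; rewrite -{1}[s k]mulr1n => /dec_axis/scattering_axis ->.
have [_] := Pi_agree g0 (Psi0 s ku) sk0 uk e.
rewrite (Pi_level (Psi0 s ku) Psiv) scattering_axis ?subrr; last first.
  by apply/on_axisP; exists 1%N; rewrite mulr1n.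
by move/subr0_eq ->; rewrite -[s k]mulr1n Psi_axis.
Qed.

Definition offht n : int := \sum_(i | i != k) co s i n.

Lemma offhtD n m : offht (n + m) = offht n + offht m.
Proof. by rewrite -big_split; apply: eq_bigr => i _; rewrite coD. Qed.

Lemma offht_axis l : offht (s k *+ l) = 0.
Proof.
by rewrite /offht big1 // => i /negbTE ik; rewrite coMn co_bs ik mul0rn.
Qed.

Lemma offht_ge0 n : cmem (C s) n -> 0 <= offht n.
Proof. by move=> /seed_coneP[n0 _]; apply: sumr_ge0 => i _. Qed.

Lemma offht_eq0 n : cmem (C s) n -> offht n = 0 -> on_axis s k n.
Proof.
move=> /seed_coneP[n0 _] /eqP; rewrite psumr_eq0 // => /allP H.
apply/eqP; apply: (@co_inj _ _ _ s) => i; rewrite coMn co_bs.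
have [->|ik] := eqVneq i k; first by have := n0 k; lia.
by have := H i; rewrite mem_index_enum ik => /(_ isT)/eqP ->; rewrite mul0rn.
Qed.

Definition off n := (n == 0) || (0 < offht n).

Lemma off0 : off 0. Proof. by rewrite /off eqxx. Qed.

Lemma offD a b : off a -> off b -> off (a + b).
Proof.
have o0 : offht 0 = 0 by apply: (addrI (offht 0)); rewrite -offhtD !addr0.
rewrite /off offhtD => /orP[/eqP ->|ha] /orP[/eqP ->|hb].
- by rewrite addr0 eqxx.
- by rewrite o0 !add0r hb orbT.
- by rewrite o0 !addr0 ha orbT.
- by rewrite addr_gt0 ?orbT.
Qed.

(* If n lies outside a submonoid P containing all lower exponents of f, then no
   product of lower terms contributes to the coefficient of z^n in log (Pi u f). *)
Lemma extremal_coef (P : pred N) (f : ser w (C s)) n :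
  P 0 -> (forall a b, P a -> P b -> P (a + b)) ->
  f 0 = 1 -> (forall m, f m != 0 -> off m) ->
  (forall m, offht m < offht n -> f m != 0 -> P m) ->
  n != 0 -> ~~ P n -> lam n (Pi (form S n) f) = 0 -> f n = 0.
Proof.
move=> P0 PD f0 foff IH n0 nP L0.
have [f' [ef f'0 _ elam]] := lam_Pi_restr off0 offD (form S n) f0 foff.
pose C' := subcone (C s) off0 offD.
pose f1 : ser w C' := mkser w C' (fun m => if P m then f m else 0).
have f1P m : f1 m != 0 -> P m by rewrite mkserE; case: ifP => // _; case: ifP.
have f10 : f1 0 = 1 by rewrite mkserE P0 f0 cmem0.
(* Inside the submonoid [off], a proper part of n has smaller off-axis height than n, so the
   hypothesis on lower exponents covers all of them. *)
have e : agree n f' f1.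
  move=> m mn ne; rewrite ef mkserE.
  have m' : cmem C' m by move: mn; rewrite mem_dec => /andP[].
  rewrite m'; case: ifP => // /negbT mP; apply/eqP; apply: contraT => fm.
  move: mn; rewrite mem_dec => /andP[_]; rewrite subconeE => /andP[_].
  rewrite /off subr_eq0 eq_sym (negbTE ne) /= => h.
  have := IH m _ fm; rewrite (negbTE mP) -[offht n](congr1 offht (addrBK m n)) offhtD => /(_ _).
  by rewrite ltrDl => /(_ h).
have := lam_Pi_agree n0 (form_diag S n) f'0 f10 e.
rewrite elam L0 (lam_Pi_supp P0 PD _ f10 f1P nP) subrr ef.
by rewrite [f1 n](_ : _ = 0) ?subr0 // mkserE (negbTE nP) if_same.
Qed.

Variables h f : ser w (C s).
Hypotheses (Eh : g = Psi s k * h) (Ef : g = f * Psi s k).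

Lemma sharp_h0 : h 0 = 1.
Proof. by have := g0; rewrite Eh coefM0 Psi0 // mul1r. Qed.

Lemma sharp_f0 : f 0 = 1.
Proof. by have := g0; rewrite Ef coefM0 Psi0 // mulr1. Qed.

Lemma sharp_axis n : n != 0 -> on_axis s k n -> h n = 0 /\ f n = 0.
Proof.
elim: {n}(ht (C s) n).+1 {-2}n (ltnSn (ht (C s) n)) => // H IH n nH n0 nax.
have parts m : m \in dec (C s) n -> m != n -> h m = (1 : ser w (C s)) m /\ f m = (1 : ser w (C s)) m.
  move=> mn ne; rewrite coef1; have [->|m0] := eqVneq m 0; first by rewrite sharp_h0 sharp_f0.
  apply: IH => //; first exact: leq_trans (dec_proper mn ne) _.
  by have /on_axisP[l El] := nax; rewrite El in mn; exact: dec_axis mn.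
have eh : agree n h 1 by move=> m mn ne; case: (parts m mn ne).
have ef : agree n f 1 by move=> m mn ne; case: (parts m mn ne).
have Hg := scattering_axis nax; split.
- have := coefM_agree n0 (@agree_refl _ _ _ n (Psi s k)) eh.
  by rewrite -Eh mulr1 Hg !subrr mul0r add0r Psi0 // mul1r coef1 (negbTE n0) subr0.
- have := coefM_agree n0 ef (@agree_refl _ _ _ n (Psi s k)).
  by rewrite -Ef mul1r Hg !subrr mulr0 addr0 Psi0 // mulr1 coef1 (negbTE n0) subr0.
Qed.

Lemma sharp_off n : (h n != 0 -> off n) /\ (f n != 0 -> off n).
Proof.
suff key (x : ser w (C s)) : (forall m, m != 0 -> on_axis s k m -> x m = 0) -> x n != 0 -> off n.
  by split; apply: key => m m0 max; have [] := sharp_axis m0 max.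
move=> hx xn; rewrite /off; have mn := ser_supp xn.
have := offht_ge0 mn; rewrite le_eqVlt => /orP[/eqP e|->]; last by rewrite orbT.
by apply/orP; left; apply: contraNT xn => n0; rewrite hx // offht_eq0.
Qed.

End Wall.

Lemma additive0 (V : zmodType) (u : V -> rat) :
  (forall x y, u (x + y) = u x + u y) -> u 0 = 0.
Proof. by move=> uD; apply: (addrI (u 0)); rewrite -uD !addr0. Qed.

Lemma additiveMn (V : zmodType) (u : V -> rat) :
  (forall x y, u (x + y) = u x + u y) -> forall x j, u (x *+ j) = u x *+ j.
Proof.
move=> uD x; elim=> [|j IH]; first by rewrite !mulr0n additive0.
by rewrite !mulrS uD IH.
Qed.

Section PiPsi.
Context (I : finType) (N : zmodType) (S : seed_datum I N).
Local Notation w := (form_twist S).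
Local Notation C s := (seed_cone s).
Context (s : bseed S) (k : I) (ku : k \in uf S) (h : ser w (C s)) (u : N -> rat).
Hypotheses (h0 : h 0 = 1) (uD : forall x y, u (x + y) = u x + u y).

Lemma axis_pos n : n != 0 -> Psi s k n != 0 -> exists2 j, (0 < j)%N & n = s k *+ j.
Proof.
move=> n0 /Psi_supp/on_axisP[j E]; exists j => //.
by rewrite lt0n; apply: contraNneq n0 => j0; rewrite E j0 mulr0n.
Qed.

Lemma Pi_Psi_pos : 0 < u (s k) -> Pi u (Psi s k * h) = Pi u h.
Proof.
move=> uk; apply: PiM_pos => // [|n n0 /(axis_pos n0)[j j0 ->]]; first exact: Psi0.
by rewrite additiveMn // pmulrn_lgt0.
Qed.

Lemma Pi_Psi_neg : u (s k) < 0 -> Pi u (h * Psi s k) = Pi u h.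
Proof.
move=> uk; apply: PiM_neg => // [|n n0 /(axis_pos n0)[j j0 ->]]; first exact: Psi0.
by rewrite additiveMn // pmulrn_llt0.
Qed.

Lemma Psi_level n : u (s k) = 0 -> Psi s k n != 0 -> u n = 0.
Proof.
by move=> uk /Psi_supp/on_axisP[j ->]; rewrite additiveMn // uk mul0rn.
Qed.

Lemma Pi_Psi_levell : u (s k) = 0 -> Pi u (Psi s k * h) = Psi s k * Pi u h.
Proof.
by move=> uk; apply: PiM_levell => // [|n]; [exact: Psi0 | exact: Psi_level].
Qed.

Lemma Pi_Psi_levelr : u (s k) = 0 -> Pi u (h * Psi s k) = Pi u h * Psi s k.
Proof.
by move=> uk; apply: PiM_levelr => // [|n]; [exact: Psi0 | exact: Psi_level].
Qed.

End PiPsi.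

Section LamPsi.
Context (I : finType) (N : zmodType) (S : seed_datum I N).
Local Notation w := (form_twist S).
Local Notation C s := (seed_cone s).
Context (s : bseed S) (k : I) (ku : k \in uf S) (b : ser w (C s)) (n : N).
Hypotheses (b0 : b 0 = 1) (n0 : n != 0) (nk : form S n (s k) = 0).
Hypothesis bn : forall m, m != 0 -> b m != 0 -> form S n m = 0.

Lemma tw_level m : form S n m = 0 -> w n m = 1.
Proof. by move=> e; rewrite /= /tw_exp e mulr0 oppr0 floor0 expr0z. Qed.

Lemma level_central m : b m != 0 -> w n m = 1.
Proof.
have [->|m0] := eqVneq m 0; first by rewrite tw0r.
by move=> bm; apply: tw_level; apply: bn.
Qed.

Lemma Psi_central m : Psi s k m != 0 -> w n m = 1.
Proof. by move=> /(Psi_level (formDr S n) nk) /tw_level. Qed.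

Lemma lam_Psil : lam n (Psi s k * b) = lam n (Psi s k) + lam n b.
Proof.
by apply: lamM => //; [exact: Psi0 | exact: Psi_central | exact: level_central].
Qed.

Lemma lam_Psir : lam n (b * Psi s k) = lam n b + lam n (Psi s k).
Proof.
by apply: lamM => //; [exact: Psi0 | exact: level_central | exact: Psi_central].
Qed.

End LamPsi.

Section Mutation.
Context (I : finType) (N : zmodType) (S : seed_datum I N).
Local Notation w := (form_twist S).
Local Notation C s := (seed_cone s).
Context (s : bseed S) (k : I) (ku : k \in uf S) (g : ser w (C s)).
Hypothesis scat : scattering g.
Variables h f : ser w (C s).
Hypotheses (Eh : g = Psi s k * h) (Ef : g = f * Psi s k).
Implicit Types (i j : I) (n m : N).

Local Notation s' := (bmut s ku).
Local Notation tau := (tau s k).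
Let g0 : g 0 = 1 := proj1 scat.
Let h0 : h 0 = 1 := sharp_h0 ku scat Eh.
Let f0 : f 0 = 1 := sharp_f0 ku scat Ef.
Let EhEf : Psi s k * h = f * Psi s k. Proof. by rewrite -Eh. Qed.

Lemma form_ps n : form S n (s k) = - ((ps s k n)%:~R / (mult S k)%:R).
Proof.
rewrite psE // form_skew mulrC mulrA mulVf ?mul1r //.
by rewrite pnatr_eq0 -lt0n mult_gt0.
Qed.

Lemma form_gt0 n : ps s k n < 0 -> 0 < form S n (s k).
Proof.
move=> h1; rewrite form_ps oppr_gt0 pmulr_llt0 ?ltrz0 //.
by rewrite invr_gt0 ltr0n mult_gt0.
Qed.

Lemma form_lt0 n : 0 < ps s k n -> form S n (s k) < 0.
Proof.
move=> h1; rewrite form_ps oppr_lt0 pmulr_lgt0 ?ltr0z //.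
by rewrite invr_gt0 ltr0n mult_gt0.
Qed.

Lemma form_eq0 n : ps s k n = 0 -> form S n (s k) = 0.
Proof. by move=> h1; rewrite form_ps h1 mul0r oppr0. Qed.

(** For p n < 0 the removed Psi lies in the positive factor at {n, .} and the wall function is
    unchanged; for p n = 0 it lies in the wall function, and its summand disappears. *)
Lemma lam_Pi_h n : n != 0 -> ps s k n <= 0 ->
  lam n (Pi (form S n) h) = \sum_(i in uf S | (i != k) || (ps s k n < 0)) lam n (Psi s i).
Proof.
move=> n0; have := proj2 scat n n0; rewrite /inc le_eqVlt => + /orP[/eqP e|pn]; last first.
  rewrite Eh Pi_Psi_pos ?form_gt0 // => [->|]; last exact: formDr.
  by apply: eq_bigl => i; rewrite pn orbT andbT.
rewrite Eh Pi_Psi_levell ?form_eq0 //; last exact: formDr.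
rewrite lam_Psil ?form_eq0 ?Pi0 //; last by move=> m; exact: Pi_supp.
rewrite (bigD1 k) //= => /addrI ->; apply: eq_bigl => i.
by rewrite e ltxx orbF.
Qed.

Lemma lam_Pi_f n : n != 0 -> 0 <= ps s k n ->
  lam n (Pi (form S n) f) = \sum_(i in uf S | (i != k) || (0 < ps s k n)) lam n (Psi s i).
Proof.
move=> n0; have := proj2 scat n n0; rewrite /inc le_eqVlt eq_sym => + /orP[/eqP e|pn]; last first.
  rewrite Ef Pi_Psi_neg ?form_lt0 // => [->|]; last exact: formDr.
  by apply: eq_bigl => i; rewrite pn orbT andbT.
rewrite Ef Pi_Psi_levelr ?form_eq0 //; last exact: formDr.
rewrite lam_Psir ?form_eq0 ?Pi0 //; last by move=> m; exact: Pi_supp.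
rewrite (bigD1 k) //= [X in _ = X -> _]addrC => /addIr ->; apply: eq_bigl => i.
by rewrite e ltxx orbF.
Qed.

Lemma bmut_axis_neg i (j : nat) n : i != k -> n = s i *+ j -> (0 < j)%N -> ps s k n <= 0 ->
  n = s' i *+ j.
Proof.
move=> ik E j0 pn; rewrite bmut_neg // -(pmulrn_lle0 _ j0) -psMn //.
by rewrite -E.
Qed.

Lemma bmut_axis_pos i (j : nat) n : i != k -> n = s i *+ j -> (0 < j)%N -> 0 <= ps s k n ->
  tau n = s' i *+ j.
Proof.
move=> ik E j0 pn; rewrite bmut_pos //; last by rewrite -(pmulrn_lge0 _ j0) -psMn // -E.
rewrite E; elim: (j) => [|l IH]; last by rewrite !mulrS tauD // IH.
by rewrite !mulr0n !tauE ps0 mulr0z addr0.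
Qed.

Lemma tau_cone_D n m : cmem (C s') (tau n) -> cmem (C s') (tau m) -> cmem (C s') (tau (n + m)).
Proof. by rewrite tauD //; exact: cmemD. Qed.

Lemma tau0 : tau 0 = 0.
Proof. by rewrite !tauE ps0 mulr0z addr0. Qed.

Lemma bmut_cone_shift n (l : nat) : cmem (C s') n -> cmem (C s') (n - s k *+ l).
Proof.
move=> mn; rewrite -mulNrn -(bmut_k s ku); apply: cmemD => //.
exact: cmem_mulrn.
Qed.

Lemma offht_shift n (l : nat) : offht s k (n - s k *+ l) = offht s k n.
Proof.
apply: (addIr (offht s k (s k *+ l))).
by rewrite -offhtD subrK offht_axis addr0.
Qed.

Lemma tau_shift n (l : nat) : tau n = n - s k *+ l + s k *~ (l%:Z + ps s k n).
Proof. by rewrite mulrzDr -pmulrn addrA subrK. Qed.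

Lemma tau_mul_shift n (l : nat) : tau (n - s k *+ l) = tau n - s k *+ l.
Proof. by rewrite !tauE ps_fibre // addrAC. Qed.

(* Induction on the height off the e_k-axis: a term of minimal such height outside
   the mutated cone would survive in the logarithm of a wall function, although
   there is no incoming wall in its direction. *)
Lemma sharp_support n :
  (h n != 0 -> cmem (C s') n) /\ (f n != 0 -> cmem (C s') (tau n)).
Proof.
suff key (d : nat) m : cmem (C s) m -> offht s k m = d ->
    (h m != 0 -> cmem (C s') m) /\ (f m != 0 -> cmem (C s') (tau m)).
  case mn: (cmem (C s) n); last first.
    by rewrite !coef_out ?mn // eqxx.
  by have o0 := offht_ge0 k mn; apply: (key `|offht s k n|%N) => //; lia.
elim/ltn_ind: d m => d IH m mm dm.
have IH' x : offht s k x < offht s k m ->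
    (h x != 0 -> cmem (C s') x) /\ (f x != 0 -> cmem (C s') (tau x)).
  move=> dx; case mx: (cmem (C s) x); last by rewrite !coef_out ?mx // eqxx.
  have := offht_ge0 k mx => x0; apply: (IH `|offht s k x|%N) => //; lia.
have [m0|m0] := eqVneq m 0; first by rewrite m0 tau0 cmem0.
have [d0|d0] := posnP d.
  have max : on_axis s k m by apply: offht_eq0 => //; rewrite dm d0.
  by have [-> ->] := sharp_axis ku scat Eh Ef m0 max; rewrite eqxx.
have offax i (j : nat) x : offht s k x = d -> x = s i *+ j -> (i != k) /\ (0 < j)%N.
  move=> dx E; split; last by rewrite lt0n; apply: contra_eqN dx => /eqP j0; rewrite E j0 mulr0n -(mulr0n (s k)) offht_axis; lia.
  by apply: contra_eqN dx => /eqP ik; rewrite E ik offht_axis; lia.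
have Hh x : cmem (C s) x -> offht s k x = d -> ps s k x <= 0 -> h x != 0 -> cmem (C s') x.
  move=> mx dx px; apply: contraNT => nx.
  have x0 : x != 0 by apply: contraNneq nx => ->; exact: cmem0.
  apply/eqP; apply: (@extremal_coef _ _ _ s k (cmem (C s')) h x) => //.
  - exact: cmem0.
  - exact: cmemD.
  - by move=> y; case: (sharp_off ku scat Eh Ef y).
  - by move=> y; rewrite dx -dm => /IH'[].
  rewrite lam_Pi_h // big1 // => i /andP[iu _]; apply: lam_Psi_out => //.
  apply: contra nx => /on_axisP[j E]; have [ik j0] := offax _ _ _ dx E.
  by rewrite (bmut_axis_neg ik E j0 px) cmem_mulrn.
have Hf x : cmem (C s) x -> offht s k x = d -> 0 <= ps s k x -> f x != 0 -> cmem (C s') (tau x).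
  move=> mx dx px; apply: contraNT => nx.
  have x0 : x != 0 by apply: contraNneq nx => ->; rewrite tau0 cmem0.
  apply/eqP; apply: (@extremal_coef _ _ _ s k (fun y => cmem (C s') (tau y)) f x) => //.
  - by rewrite tau0 cmem0.
  - exact: tau_cone_D.
  - by move=> y; case: (sharp_off ku scat Eh Ef y).
  - by move=> y; rewrite dx -dm => /IH'[].
  rewrite lam_Pi_f // big1 // => i /andP[iu _]; apply: lam_Psi_out => //.
  apply: contra nx => /on_axisP[j E]; have [ik j0] := offax _ _ _ dx E.
  by rewrite (bmut_axis_pos ik E j0 px) cmem_mulrn.
have sum_neq0 (c : nat) (a : nat -> rat) (x : ser w (C s)) :
    \sum_(j < c.+1) a j * x (m - s k *+ j) != 0 ->
    exists j : nat, (j <= c)%N /\ x (m - s k *+ j) != 0.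
  move=> ne; have [/existsP[j xj]|/existsPn none] := boolP [exists j : 'I_c.+1, x (m - s k *+ j) != 0].
    by exists j; rewrite -ltnS.
  by move: ne; rewrite big1 ?eqxx // => j _; have := none j; rewrite negbK => /eqP ->; rewrite mulr0.
(* Each of h and f is now controlled on one side of p = 0. On the other side it is a combination of
   the controlled one along a fibre, and the exponents involved differ by nonnegative multiples of
   e_k' = - e_k, which the mutated cone contains. *)
have [pm|pm] := leP (ps s k m) 0.
  split; first exact: Hh.
  rewrite (sharp_neg ku EhEf pm) => /(sum_neq0 _ (fun j : nat => sig (qk S k) `|ps s k m| j%:Z))[j [jc hj]].
  have hm : cmem (C s') (m - s k *+ j).
    by apply: Hh => //; rewrite ?offht_shift ?ps_fibre //; exact: ser_supp hj.
  have -> : tau m = m - s k *+ j - s k *+ (`|ps s k m| - j)%N.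
    rewrite (tau_shift m j) -mulNrn -mulNrn; congr (_ + _).
    rewrite mulNrn pmulrn -mulrNz; congr (_ *~ _); lia.
  exact: bmut_cone_shift.
split; last by apply: Hf => //; exact: ltW.
rewrite (sharp_pos ku EhEf (ltW pm)) => /(sum_neq0 _ (fun j : nat => sig (qk S k) `|ps s k m| j%:Z))[j [jc fj]].
have fm : cmem (C s') (tau (m - s k *+ j)).
  by apply: Hf => //; rewrite ?offht_shift ?ps_fibre ?ltW //; exact: ser_supp fj.
have -> : m = tau (m - s k *+ j) - s k *+ (`|ps s k m| - j)%N.
  rewrite tau_mul_shift !tauE -!addrA -[LHS]addr0; congr (_ + _).
  rewrite !pmulrn -!mulrNz -!mulrzDr -[LHS](mulr0z (s k)); congr (_ *~ _); lia.
exact: bmut_cone_shift.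
Qed.

End Mutation.

Section MutatedScattering.
Context (I : finType) (N : zmodType) (S : seed_datum I N).
Local Notation w := (form_twist S).
Local Notation C s := (seed_cone s).
Context (s : bseed S) (k : I) (ku : k \in uf S).
Implicit Types (i : I) (n m : N).
Local Notation s' := (bmut s ku).
Local Notation tau := (tau s k).

Lemma ps_bmut n : ps s' k n = - ps s k n.
Proof.
apply: (@intr_inj rat); rewrite intrN !psE // bmut_k formNl mulrN.
by [].
Qed.

Lemma Psi_eq (t : bseed S) i n : i \in uf S ->
  Psi t i n = if on_axis t i n then psi (qk S i) `|co t i n|%N else 0.
Proof.
move=> iu; rewrite mkserE; case: ifP => // /negbT mn.
case: ifP => // /on_axisP[j E]; move: mn; rewrite E cmem_mulrn //.
Qed.

Lemma ps_axis (t : bseed S) i n : n != 0 -> on_axis t i n ->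
  exists2 j, (0 < j)%N & ps s k n = ps s k (t i) *+ j.
Proof.
move=> n0 /on_axisP[j E]; exists j; last by rewrite E psMn.
by rewrite lt0n; apply: contraNneq n0 => j0; rewrite E j0 mulr0n.
Qed.

(** If e_i' differs from e_i, then p is positive on both vectors, so a nonzero n with p n <= 0 lies
    on neither axis and both sides vanish. *)
Lemma lam_Psi_neg i n : i \in uf S -> i != k -> n != 0 -> ps s k n <= 0 ->
  lam n (Psi s' i) = lam n (Psi s i).
Proof.
move=> iu ik n0 pn; have [pi|pi] := leP (ps s k (s i)) 0.
  apply/esym/(lam_sim (phi := iso_id w)); first exact: Psi0.
  by move=> m; rewrite !Psi_eq // /on_axis bmut_co_neq // bmut_neg.
have out (t : bseed S) : 0 < ps s k (t i) -> lam n (Psi t i) = 0.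
  move=> pt; apply: lam_Psi_out => //; apply/negP => /(ps_axis n0)[j j0 E].
  by move: pn; rewrite E pmulrn_lle0 // leNgt pt.
by rewrite !out // bmut_pos ?ps_tau // ltW.
Qed.

Lemma lam_Psi_pos i n : i \in uf S -> i != k -> n != 0 -> 0 <= ps s k n ->
  lam (tau n) (Psi s' i) = lam n (Psi s i).
Proof.
move=> iu ik n0 pn; have [pi|pi] := leP 0 (ps s k (s i)).
  apply/esym/(lam_sim (phi := iso_tau s ku)); first exact: Psi0.
  move=> m; rewrite !Psi_eq // /on_axis bmut_co_neq // bmut_pos //=.
  have -> : co s i (tau m) = co s i m.
    by rewrite coD coMz co_bs (negbTE ik) mul0r addr0.
  congr (if _ then _ else _).
  have tauMn j : tau (s i) *+ j = tau (s i *+ j).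
    by elim: j => [|j IH]; rewrite ?mulr0n ?tau0 // !mulrS tauD // IH.
  by rewrite tauMn (inj_eq (can_inj (tauK s ku))).
have out (t : bseed S) m : m != 0 -> 0 <= ps s k m -> ps s k (t i) < 0 -> lam m (Psi t i) = 0.
  move=> m0 pm pt; apply: lam_Psi_out => //; apply/negP => /(ps_axis m0)[j j0 E].
  by move: pm; rewrite E pmulrn_lge0 // leNgt pt.
have tn0 : tau n != 0 by rewrite -(tau0 s k) (inj_eq (can_inj (tauK s ku))).
rewrite (out s n n0 pn pi) out ?ps_tau //.
by rewrite bmut_neg // ltW.
Qed.

Lemma lam_Psi_k (t : bseed S) n : n != 0 -> ps s k n != 0 -> ps s k (t k) = 0 ->
  lam n (Psi t k) = 0.
Proof.
move=> n0 pn pt; apply: lam_Psi_out => //; apply/negP => /(ps_axis n0)[j j0 E].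
by move: pn; rewrite E pt mul0rn eqxx.
Qed.

Section Fibre.
Variables h f : ser w (C s).
Hypothesis EhEf : Psi s k * h = f * Psi s k.
Variables hs hp : ser w (C s').
Hypotheses (Ehs : forall n, hs n = h n) (Ehp : forall n, hp (tau n) = f n).

Lemma bmut_fibre n (l : nat) : n - s' k *+ l = n + s k *+ l.
Proof. by rewrite bmut_k mulNrn opprK. Qed.

Lemma fibre_reverse (c : nat) (n : N) l (F : N -> rat) :
  \sum_(j < c.+1) sig (qk S k) c j%:Z * F (n + s k *+ (l + c) - s k *+ j) =
  \sum_(j < c.+1) sig (qk S k) c j%:Z * F (n + s k *+ (l + j)).
Proof.
rewrite (reindex_inj rev_ord_inj) /=; apply: eq_bigr => j _; rewrite subSS.
have jc : (j <= c)%N by rewrite -ltnS.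
rewrite -subzn // sig_sym ?qk_gt1 //; congr (_ * F _).
by rewrite -addrA -mulrnBr ?leq_subr //; [congr (_ + _ *+ _)|]; lia.
Qed.

Lemma hp_neg n l : ps s k n <= 0 ->
  hp (n + s k *+ l) = \sum_(j < `|ps s k n|.+1)
     sig (qk S k) `|ps s k n| j%:Z * hs (n + s k *+ (l + j)).
Proof.
move=> pn; set c := `|ps s k n|%N.
have pc : ps s k n = - c%:Z by rewrite /c; lia.
have px j : ps s k (n + s k *+ j) = ps s k n.
  by rewrite psD // psMn // psk mul0rn addr0.
have -> : n + s k *+ l = tau (n + s k *+ (l + c)).
  by rewrite !tauE px pc mulrNz -pmulrn mulrnDr addrA addrK.
rewrite Ehp (sharp_neg ku EhEf) px // -/c.
under [RHS]eq_bigr do rewrite Ehs.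
exact: fibre_reverse.
Qed.

Lemma hs_pos n l : 0 <= ps s k n ->
  hs (n + s k *+ l) = \sum_(j < `|ps s k n|.+1)
     sig (qk S k) `|ps s k n| j%:Z * hp (n + s k *+ (l + j)).
Proof.
move=> pn; set c := `|ps s k n|%N.
have pc : ps s k n = c%:Z by rewrite /c; lia.
have px j : ps s k (n + s k *+ j) = ps s k n.
  by rewrite psD // psMn // psk mul0rn addr0.
rewrite Ehs (sharp_pos ku EhEf) px // -/c -fibre_reverse.
apply: eq_bigr => j _; rewrite -Ehp; congr (_ * hp _).
rewrite !tauE ps_fibre // px pc -pmulrn mulrnDr addrA.
by rewrite -!addrA; congr (_ + (_ + _)); rewrite addrC.
Qed.

(** Read along - e_k, a fibre shows the relation between h and f reversed. As [sig] is palindromic,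
    the shift by tau turns it into the relation produced by conjugation with the dilogarithm of z^(-
    e_k). *)
Lemma mutated_factors : hs * Psi s' k = Psi s' k * hp.
Proof.
apply: serP => n; pose B := (ht (C s') n).+1.
have out (x : ser w (C s')) j : (B <= j)%N -> x (n - s' k *+ j) = 0.
  exact: ser_fibre_out.
rewrite (PsiMl ku (out hp)) (PsiMr ku (out hs)) ps_bmut.
have [pn|/ltW pn] := leP (ps s k n) 0.
  set c := `|ps s k n|%N; have pc : ps s k n = - c%:Z by rewrite /c; lia.
  have := @sig_convolution _ (qk_gt1 S k) B c (fun j => hs (n - s' k *+ j)) (out hs) 0.
  move=> /esym E; apply: etrans (etrans E _); apply: eq_bigr => j _.
    by rewrite pc opprK.
  rewrite pc opprK; congr (_ * _); first by rewrite PoszM mulNr.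
  rewrite bmut_fibre hp_neg // -/c; apply: eq_bigr => i _.
  by rewrite bmut_fibre.
set c := `|ps s k n|%N; have pc : ps s k n = c%:Z by rewrite /c; lia.
have := @sig_convolution _ (qk_gt1 S k) B c (fun j => hp (n - s' k *+ j)) (out hp) 0.
move=> E; apply: etrans (etrans E _); apply: eq_bigr => j _; last by rewrite pc opprK.
rewrite pc; congr (_ * _); first by rewrite PoszM mulNr.
rewrite bmut_fibre hs_pos // -/c; apply: eq_bigr => i _.
by rewrite bmut_fibre.
Qed.

End Fibre.

(* If g = Psi h = f Psi, then the diagram of the mutated seed is given by
   h Psi' = Psi' tau(f), with Psi' the dilogarithm of z^(- e_k). *)
Lemma scattering_mutate (g : ser w (C s)) : scattering g ->
  exists g' : ser w (C s'), [/\ scattering g',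
    forall u, (forall x y, u (x + y) = u x + u y) -> 0 < u (s k) ->
      forall n, Pi u g' n = Pi u g n
  & forall u, (forall x y, u (x + y) = u x + u y) -> u (s k) < 0 ->
      forall n, Pi u g' (tau n) = Pi (u \o tau) g n].
Proof.
move=> scat; have g0 := proj1 scat.
have [h /esym Eh] := ser_div g (Psi0 s ku).
have [f /esym Ef] := ser_divr g (Psi0 s ku).
have EhEf : Psi s k * h = f * Psi s k by rewrite -Eh.
have h0 := sharp_h0 ku scat Eh; have f0 := sharp_f0 ku scat Ef.
have supp n := sharp_support ku scat Eh Ef n.
have [hs Ehs] : exists hs : ser w (C s'), forall n, hs n = h n.
  exists (mkser w (C s') h) => n; rewrite mkserE; case: ifP => // /negbT mn.
  by apply/esym/eqP; apply: contraNT mn => /(proj1 (supp n)).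
have [hp Ehp] : exists hp : ser w (C s'), forall n, hp (tau n) = f n.
  exists (mkser w (C s') (fun n => f (tauV s k n))) => n.
  rewrite mkserE tauK //; case: ifP => // /negbT mn.
  by apply/esym/eqP; apply: contraNT mn => /(proj2 (supp n)).
have E' := mutated_factors EhEf Ehs Ehp.
have hs0 : hs 0 = 1 by rewrite Ehs.
have hp0 : hp 0 = 1 by rewrite -(tau0 s k) Ehp.
have Thl u n : Pi u hs n = Pi u h n /\ lam n (Pi u hs) = lam n (Pi u h).
  have [h1 [e1 h10 eP el]] := lam_Pi_restr (@cmem0 _ (C s')) (@cmemD _ (C s')) u h0 (fun m => proj1 (supp m)).
  have sub m : cmem (subcone (C s) (@cmem0 _ (C s')) (@cmemD _ (C s'))) m -> cmem (C s') m by case/andP.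
  have eP' := @Pi_sim _ _ (iso_id w) _ _ u h1 hs h10 sub (fun m => etrans (e1 m) (esym (Ehs m))).
  by rewrite -eP -el -(lam_sim (phi := iso_id w) n _ eP') ?Pi0 // -eP'.
have Tfl u n : Pi u hp (tau n) = Pi (u \o tau) f n /\
    lam (tau n) (Pi u hp) = lam n (Pi (u \o tau) f).
  pose P m := cmem (C s') (tau m).
  have P0 : P 0 by rewrite /P tau0 cmem0.
  have PD : forall a b, P a -> P b -> P (a + b) by exact: tau_cone_D.
  have [f1 [e1 f10 eP el]] := lam_Pi_restr P0 PD (u \o tau) f0 (fun m => proj2 (supp m)).
  have sub m : cmem (subcone (C s) P0 PD) m -> cmem (C s') (iso_tau s ku m) by case/andP.
  have eP' := @Pi_sim _ _ (iso_tau s ku) _ _ u f1 hp f10 sub (fun m => etrans (e1 m) (esym (Ehp m))).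
  by rewrite -eP -el; split; [rewrite (eP' n) | rewrite (lam_sim n _ eP') ?Pi0].
have us' (u : N -> rat) : (forall x y, u (x + y) = u x + u y) -> u (s' k) = - u (s k).
  move=> uD; rewrite bmut_k; apply: (addrI (u (s k))).
  by rewrite -uD !subrr additive0.
exists (hs * Psi s' k); split.
- split; first by rewrite coefM0 hs0 Psi0 // mulr1.
  (* For p n < 0 the wall function is read off h, for p n > 0 off the image of f under tau; for p n
     = 0 the dropped summand of e_k is replaced by that of - e_k. *)
  move=> n n0; rewrite /inc; case: (ltrgtP (ps s k n) 0) => pn.
  + rewrite Pi_Psi_neg ?us' ?oppr_lt0 ?form_gt0 //; try exact: formDr.
    rewrite (proj2 (Thl _ n)) (lam_Pi_h ku scat Eh n0 (ltW pn)) pn.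
    under eq_bigl do rewrite orbT andbT.
    apply: eq_bigr => i iu; have [->|ik] := eqVneq i k.
      by rewrite !lam_Psi_k ?bmut_k ?psN ?psk ?oppr0 // lt_eqF.
    by rewrite lam_Psi_neg // ltW.
  + rewrite E' Pi_Psi_pos ?us' ?oppr_gt0 ?form_lt0 //; try exact: formDr.
    have [m Em] : exists m, n = tau m by exists (tauV s k n); rewrite tauVK.
    have m0 : m != 0 by apply: contraNneq n0 => m0; rewrite Em m0 tau0.
    rewrite Em ps_tau // in pn *; rewrite (proj2 (Tfl _ m)).
    have -> : form S (tau m) \o tau = form S m by apply/funext => x /=; rewrite form_tau.
    rewrite (lam_Pi_f ku scat Ef m0 (ltW pn)) pn.
    under eq_bigl do rewrite orbT andbT.
    apply: eq_bigr => i iu; have [->|ik] := eqVneq i k.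
      by rewrite !lam_Psi_k ?bmut_k ?psN ?psk ?oppr0 ?ps_tau ?gt_eqF // -Em.
    by rewrite lam_Psi_pos // ltW.
  + rewrite Pi_Psi_levelr ?us' ?form_eq0 ?oppr0 //; try exact: formDr.
    rewrite lam_Psir ?us' ?form_eq0 ?oppr0 ?Pi0 //; try (by move=> m; exact: Pi_supp); try exact: formDr.
    rewrite (proj2 (Thl _ n)) (lam_Pi_h ku scat Eh n0) ?pn // [RHS](bigD1 k) //= addrC.
    congr (_ + _); apply: eq_big => i; first by rewrite ltxx orbF.
    by rewrite ltxx orbF => /andP[iu ik]; rewrite lam_Psi_neg // pn.
- move=> u uD uk n; rewrite Pi_Psi_neg ?us' ?oppr_lt0 //.
  by rewrite (proj1 (Thl u n)) Eh Pi_Psi_pos.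
- move=> u uD uk n; rewrite E' Pi_Psi_pos ?us' ?oppr_gt0 //.
  rewrite (proj1 (Tfl u n)) Ef Pi_Psi_neg //= ?tau_k //.
  by move=> x y; rewrite tauD.
Qed.

End MutatedScattering.

(** * Tropical mutations *)

Section Tropical.
Context (I : finType) (N : zmodType) (S : seed_datum I N).
Local Notation w := (form_twist S).
Local Notation C s := (seed_cone s).
Implicit Types (s t : bseed S) (i k : I) (n m : N) (u v : N -> rat).

Definition addv u := forall x y, u (x + y) = u x + u y.

Lemma addvN u x : addv u -> u (- x) = - u x.
Proof. by move=> uD; apply: (addrI (u x)); rewrite -uD !subrr additive0. Qed.

Lemma addvMz u x (z : int) : addv u -> u (x *~ z) = u x * z%:~R.
Proof.
move=> uD; case: z => j; first by rewrite -!pmulrn additiveMn // mulr_natr.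
by rewrite NegzE !mulrNz addvN // -!pmulrn additiveMn // -mulr_natr mulrN.
Qed.

Lemma addv_coE s u n : addv u -> u n = \sum_i u (s i) * (co s i n)%:~R.
Proof.
move=> uD; rewrite {1}(coE s n) (big_morph u uD (additive0 uD)).
by apply: eq_bigr => i _; rewrite addvMz.
Qed.

Lemma addv_comp u (F : N -> N) : addv u -> (forall x y, F (x + y) = F x + F y) -> addv (u \o F).
Proof. by move=> uD FD x y /=; rewrite FD uD. Qed.

Lemma addv_lin (a b : rat) u v : addv u -> addv v -> addv (fun n => a * u n + b * v n).
Proof. by move=> uD vD x y; rewrite uD vD; ring. Qed.

Definition cov s i : N -> rat := fun n => (co s i n)%:~R.

Lemma cov_add s i : addv (cov s i).
Proof. by move=> x y; rewrite /cov coD intrD. Qed.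

Lemma cov_s s i j : cov s i (s j) = (i == j)%:R.
Proof. by rewrite /cov co_bs; case: eqP. Qed.

Definition trop s k u : N -> rat :=
  fun n => u n + (mult S k)%:R * form S (s k) n * Num.min 0 (u (s k)).

Lemma trop_add s k u : addv u -> addv (trop s k u).
Proof. by move=> uD x y; rewrite /trop uD formDr; ring. Qed.

Lemma trop_pos s k u : 0 <= u (s k) -> trop s k u = u.
Proof. by move=> h; apply/funext => n; rewrite /trop min_l // mulr0 addr0. Qed.

Lemma trop_neg s k u : k \in uf S -> addv u -> u (s k) <= 0 ->
  trop s k u = u \o tau s k.
Proof.
move=> ku uD h; apply/funext => n; rewrite /trop min_r //= /tau uD addvMz //.
by rewrite psE // [u (s k) * _]mulrC.
Qed.

(* Only the unfrozen directions bound a chamber. *)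
Definition cham s u := forall i, i \in uf S -> 0 <= u (s i).
Definition scham s u := forall i, i \in uf S -> 0 < u (s i).
Definition facet s k u :=
  u (s k) = 0 /\ forall i, i \in uf S -> i != k -> 0 < u (s i).

Lemma scham_cham s u : scham s u -> cham s u.
Proof. by move=> h i iu; exact/ltW/h. Qed.

Lemma facet_cham s k u : facet s k u -> cham s u.
Proof. by move=> [h1 h2] i iu; have [->|ik] := eqVneq i k; [rewrite h1 | exact/ltW/h2]. Qed.

Definition facet_point s k : N -> rat := fun n => \sum_(i | i != k) cov s i n.
Definition inner_point s : N -> rat := fun n => \sum_i cov s i n.

Lemma facet_point_add s k : addv (facet_point s k).
Proof. by move=> x y; rewrite -big_split; apply: eq_bigr => i _; rewrite cov_add. Qed.

Lemma inner_point_add s : addv (inner_point s).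
Proof. by move=> x y; rewrite -big_split; apply: eq_bigr => i _; rewrite cov_add. Qed.

Lemma facet_pointP s k : facet s k (facet_point s k).
Proof.
split=> [|i iu ik]; first by rewrite /facet_point big1 // => i /negbTE ik; rewrite cov_s ik.
rewrite /facet_point (bigD1 i) //= cov_s eqxx big1 ?addr0 // => j /andP[_ /negbTE ji].
by rewrite cov_s ji.
Qed.

Lemma inner_pointP s : scham s (inner_point s).
Proof.
move=> i iu; rewrite /inner_point (bigD1 i) //= cov_s eqxx big1 ?addr0 // => j /negbTE ji.
by rewrite cov_s ji.
Qed.

Section Bmut.
Context (s : bseed S) (k : I) (ku : k \in uf S).
Local Notation s' := (bmut s ku).

Lemma addv_bmut_k u : addv u -> u (s' k) = - u (s k).
Proof. by move=> uD; rewrite bmut_k addvN. Qed.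

Lemma facet_bmut u : addv u -> facet s k u -> facet s' k u.
Proof.
move=> uD [h1 h2]; split; first by rewrite addv_bmut_k // h1 oppr0.
by move=> i iu ik; rewrite bmut_neq // uD addvMz // h1 mul0r addr0 h2.
Qed.

Lemma cham_bmut_k u : addv u -> cham s' u -> u (s k) <= 0.
Proof. by move=> uD /(_ k ku); rewrite addv_bmut_k // oppr_ge0. Qed.
End Bmut.

(* A vector on which no interior point of a chamber vanishes has constant sign
   on the chamber: otherwise a positive combination would vanish on it. *)
Lemma cham_sign s y : (forall u, addv u -> scham s u -> u y != 0) ->
  (forall u, addv u -> cham s u -> 0 <= u y) \/
  (forall u, addv u -> cham s u -> u y <= 0).
Proof.
move=> H; have ip := inner_pointP s; have ia := inner_point_add s.
have comb u (a b : rat) : 0 <= a -> 0 < b -> addv u -> cham s u ->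
    a * u y + b * inner_point s y != 0.
  move=> a0 b0 uD us; apply: (H _ (addv_lin a b uD ia)) => i iu.
  by rewrite ltr_wpDl ?mulr_gt0 ?mulr_ge0 ?us ?ip.
case: (ltrgtP (inner_point s y) 0) => iy; last by have := H _ ia ip; rewrite iy eqxx.
- right=> u uD us; rewrite leNgt; apply/negP => uy.
  have := comb u (- inner_point s y) (u y); rewrite oppr_ge0 ltW // => /(_ isT uy uD us).
  by rewrite mulNr [u y * _]mulrC addNr eqxx.
- left=> u uD us; rewrite leNgt; apply/negP => uy.
  have := comb u (inner_point s y) (- u y); rewrite oppr_gt0 uy ltW // => /(_ isT isT uD us).
  by rewrite mulNr [u y * _]mulrC subrr eqxx.
Qed.

Definition nowall s (g : ser w (C s)) u := forall n, n != 0 -> Pi u g n = 0.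

Lemma nowall_scham s (g : ser w (C s)) u : g 0 = 1 -> addv u -> scham s u -> nowall g u.
Proof.
move=> g0 uD us n n0; apply/eqP; apply: contraT => gn.
have := Pi_supp g0 n0 gn; have /seed_coneP[n1 n2] := ser_supp gn.
rewrite (addv_coE s n uD) => /eqP; rewrite psumr_eq0 => [/allP H|i _]; last first.
  case iu: (i \in uf S); last by rewrite n2 ?iu ?mulr0.
  by rewrite mulr_ge0 ?ler0z ?n1 // ltW ?us.
move: n0; rewrite -(negbK (n == 0)) => /negP[]; apply/negPn/eqP; apply: (@co_inj _ _ _ s) => i; rewrite co0.
case iu: (i \in uf S); last by rewrite n2 ?iu.
have := H i; rewrite mem_index_enum => /(_ isT)/=; rewrite mulf_eq0 intr_eq0 gt_eqF ?us //=.
by move/eqP.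
Qed.

Definition linked s k (ku : k \in uf S) (g : ser w (C s)) (g' : ser w (C (bmut s ku))) :=
  (forall u, addv u -> 0 < u (s k) -> forall n, Pi u g' n = Pi u g n) /\
  (forall u, addv u -> u (s k) < 0 -> forall n, Pi u g' (tau s k n) = Pi (u \o tau s k) g n).

Lemma tau_eq0 s k n : k \in uf S -> (tau s k n == 0) = (n == 0).
Proof. by move=> ku; rewrite -[RHS](inj_eq (can_inj (tauK s ku))) tau0. Qed.

Lemma psi1_neq0 k : psi (qk S k) 1 != 0.
Proof. by rewrite gt_eqF // psi_ge0 // qk_gt1. Qed.

Lemma bs_neq0 s k : s k != 0.
Proof. by apply/eqP => e; have := co_bs s k k; rewrite e co0 eqxx => /eqP; rewrite eq_sym oner_eq0. Qed.

Lemma nowall_neq0 s k (g : ser w (C s)) u : k \in uf S -> scattering g -> addv u ->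
  nowall g u -> u (s k) != 0.
Proof.
move=> ku sg uD nw; apply/eqP => uk; have := psi1_neq0 k.
by rewrite -(Pi_wall ku sg uD uk) nw ?eqxx // bs_neq0.
Qed.

Lemma nowall_trop s k (ku : k \in uf S) (g : ser w (C s))
    (g' : ser w (C (bmut s ku))) u : scattering g' ->
  linked g g' -> addv u -> nowall g' u -> nowall g (trop s k u).
Proof.
move=> sg' [lp ln] uD nw n n0.
have := nowall_neq0 ku sg' uD nw; rewrite addv_bmut_k // oppr_eq0.
case: (ltrgtP (u (s k)) 0) => // uk _.
- by rewrite trop_neg ?ltW // -ln // nw // tau_eq0.
- by rewrite trop_pos ?ltW // -lp // nw.
Qed.

Definition lseed s (ks : seq {k | k \in uf S}) := foldl (fun t (x : {k | k \in uf S}) => bmut t (valP x)) s ks.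

(** The recursion peels off the root end, where the diagram is mutated; [ltrop_rcons] gives the step
    at the other end, where the tree grows. *)
Fixpoint ltrop s (ks : seq {k | k \in uf S}) u : N -> rat :=
  if ks is x :: l then trop s (val x) (ltrop (bmut s (valP x)) l u) else u.

Lemma ltrop_rcons s ks (x : {k | k \in uf S}) u :
  ltrop s (rcons ks x) u = ltrop s ks (trop (lseed s ks) (val x) u).
Proof. by elim: ks s => //= k1 l IH s; rewrite IH. Qed.

Lemma lseed_rcons s ks (x : {k | k \in uf S}) :
  lseed s (rcons ks x) = bmut (lseed s ks) (valP x).
Proof. by rewrite /lseed foldl_rcons. Qed.

Lemma ltrop_add s ks u : addv u -> addv (ltrop s ks u).
Proof. by elim: ks s => //= k l IH s uD; apply/trop_add/IH. Qed.

Lemma linked_exists s k (ku : k \in uf S) (g : ser w (C s)) : scattering g ->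
  exists2 g' : ser w (C (bmut s ku)), scattering g' & linked g g'.
Proof. by move=> /(scattering_mutate ku)[g' [sg' lp ln]]; exists g'. Qed.

Lemma ltrop_nowall s ks (g : ser w (C s)) u : scattering g -> addv u ->
  scham (lseed s ks) u -> nowall g (ltrop s ks u).
Proof.
elim: ks s g => [|k l IH] s g sg uD us; first exact: nowall_scham (proj1 sg) uD us.
have [g' sg' lk] := linked_exists (valP k) sg.
exact: nowall_trop sg' lk (ltrop_add _ _ uD) (IH _ _ sg' uD us).
Qed.

(* A is the linear map by which the composite tropical mutation acts on the chamber
   of the final seed.  Crossing the k-th wall of this chamber changes A by tau_k or
   not at all, according to the sign of the c-vector, which is detected on the
   support of the wall function in the cone of the initial seed. *)
Record transport s ks (g : ser w (C s)) (A B : N -> N) : Prop := Transport {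
  trD : forall x y, A (x + y) = A x + A y;
  trK : cancel A B;
  trVK : cancel B A;
  tr_form : forall x y, form S (A x) (A y) = form S x y;
  tr_cham : forall u, addv u -> cham (lseed s ks) u -> ltrop s ks u = u \o A;
  tr_wall : forall k (ku : k \in uf S), exists sg : bool,
    (forall u, addv u -> cham (bmut (lseed s ks) ku) u ->
      ltrop s ks (trop (lseed s ks) k u) =
      if sg then u \o tau (lseed s ks) k \o A else u \o A) /\
    (forall u, addv u -> facet (lseed s ks) k u ->
      Pi (ltrop s ks u) g (if sg then B (lseed s ks k) else - B (lseed s ks k)) =
      psi (qk S k) 1) }.

End Tropical.

(** * Linearity of composite tropical mutations on chambers *)

Section Chambers.
Context (I : finType) (N : zmodType) (S : seed_datum I N).
Local Notation w := (form_twist S).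
Local Notation C s := (seed_cone s).
Implicit Types (s t : bseed S) (i k : I) (n m : N) (u v : N -> rat).

(** The map x / (x^2 - 1) is injective for x > 1: the cross-multiplied difference is x_k - x_i times
    the positive number x_i x_k + 1. It lets the multiplicity of a wall be read off its function. *)
Lemma psi1_inj i k : psi (qk S i) 1 = psi (qk S k) 1 -> mult S i = mult S k.
Proof.
have q2 j : qk S j ^+ 2 - 1 != 0.
  by rewrite subr_eq0 gt_eqF // exprn_egt1 // qk_gt1.
have E j : psi (qk S j) 1 = qk S j / (qk S j ^+ 2 - 1).
  by rewrite /psi mul1r muln1.
rewrite !E => e.
have {e} : (qk S k - qk S i) * (qk S i * qk S k + 1) = 0.
  have := congr1 (fun x => x * (qk S i ^+ 2 - 1) * (qk S k ^+ 2 - 1)) e.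
  rewrite /= divfK ?q2 // mulrAC divfK ?q2 // => e'.
  by apply/eqP; rewrite -subr_eq0 subr0; move/eqP: e'; rewrite -subr_eq0;
    apply: etrans; congr (_ == 0); ring.
move/eqP; rewrite mulf_eq0 subr_eq0 orbC gt_eqF /=; last first.
  by rewrite addr_gt0 // mulr_gt0 // (lt_trans _ (qk_gt1 S _)).
rewrite /qk => /eqP e.
have {e} ee : (qden S %/ mult S k = qden S %/ mult S i)%N.
  by move/eqP: e; rewrite eq_le !ler_eXn2l // -eqn_leq => /eqP.
have := divnK (qden_mult S k); rewrite ee -{2}(divnK (qden_mult S i)) => /eqP.
rewrite eqn_pmul2l; first by move/eqP.
by rewrite divn_gt0 ?mult_gt0 // dvdn_leq ?qden_gt0 ?qden_mult.
Qed.

Lemma transport_nil s (g : ser w (C s)) : scattering g -> transport [::] g id id.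
Proof.
move=> sg; split => //= k ku; exists true; split=> u uD.
  by move=> us; rewrite trop_neg //; exact: (cham_bmut_k uD us).
by move=> [uk _]; apply: Pi_wall.
Qed.

Section TransportTheory.
Context (s : bseed S) (l : seq {k | k \in uf S}) (g : ser w (C s)) (A B : N -> N).
Hypothesis T : transport l g A B.

Lemma trN x : A (- x) = - A x.
Proof.
have A0 : A 0 = 0 by apply: (addrI (A 0)); rewrite -(trD T) !addr0.
by apply: (addrI (A x)); rewrite -(trD T) !subrr.
Qed.

Lemma trVD x y : B (x + y) = B x + B y.
Proof. by rewrite -{1}(trVK T x) -{1}(trVK T y) -(trD T) (trK T). Qed.

Lemma trVN x : B (- x) = - B x.
Proof.
have B0 : B 0 = 0 by apply: (addrI (B 0)); rewrite -trVD !addr0.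
by apply: (addrI (B x)); rewrite -trVD !subrr.
Qed.

Lemma trMz x (z : int) : A (x *~ z) = A x *~ z.
Proof.
have n j : A (x *+ j) = A x *+ j.
  elim: j => [|j IH]; last by rewrite !mulrS (trD T) IH.
  by apply: (addrI (A 0)); rewrite -(trD T) !addr0.
by case: z => j; rewrite ?NegzE ?mulrNz -?pmulrn ?trN n.
Qed.

Lemma trVMz x (z : int) : B (x *~ z) = B x *~ z.
Proof. by rewrite -{1}(trVK T x) -trMz (trK T). Qed.

Lemma tr_formV x y : form S (B x) y = form S x (A y).
Proof. by rewrite -(tr_form T) (trVK T). Qed.

End TransportTheory.

Definition side (b : bool) (r : rat) := if b then 0 <= r else r <= 0.

Lemma wall_shape t y k b :
  (forall u, addv u -> cham t u -> side b (u y)) ->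
  (exists u0, [/\ addv u0, facet t k u0 & u0 y = 0]) ->
  y = t k *~ co t k y.
Proof.
wlog -> : y b / b = true => [H|Hy [u0 [uD [u1 u2] u0y]]].
  case: b => Hy; first exact: (H y true).
  move=> [u0 [uD uf0 u0y]]; apply: oppr_inj; rewrite -mulrNz -coN.
  apply: (H (- y) true) => // [u ua us|].
    by rewrite /side addvN // oppr_ge0; exact: Hy.
  by exists u0; split; rewrite // addvN // u0y oppr0.
have c0 i : i \in uf S -> 0 <= co t i y.
  move=> iu; have := Hy _ (@cov_add _ _ _ t i); rewrite /= ler0z; apply => j _.
  by rewrite cov_s ler0n.
have cf i : i \notin uf S -> co t i y = 0.
  move=> iu; have ne j : j \in uf S -> cov t i (t j) = 0.
    by move=> ju; rewrite cov_s; case: eqP iu => // ->; rewrite ju.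
  apply/eqP; rewrite -(intr_eq0 rat) eq_le; apply/andP; split; last first.
    by apply: (Hy _ (@cov_add _ _ _ t i)) => j ju; rewrite ne.
  rewrite -oppr_ge0; apply: (Hy (fun n => - cov t i n)) => [a a'|j ju].
    by rewrite cov_add opprD.
  by rewrite ne ?oppr0.
apply: (@co_inj _ _ _ t) => i; rewrite coMz co_bs.
have [->|ik] := eqVneq i k; first by rewrite mul1r.
rewrite mul0r; case iu: (i \in uf S); last by rewrite cf ?iu.
move: u0y => /eqP; rewrite (addv_coE t y uD) psumr_eq0 => [/allP H|j _]; last first.
  case ju: (j \in uf S); last by rewrite cf ?ju ?mulr0.
  rewrite mulr_ge0 ?ler0z ?c0 //.
  by have [->|jk] := eqVneq j k; [rewrite u1 | exact/ltW/u2].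
have := H i; rewrite mem_index_enum => /(_ isT)/=.
by rewrite mulf_eq0 intr_eq0 gt_eqF ?u2 //= => /eqP.
Qed.

Section Cons.
Context (s : bseed S) (x : {k | k \in uf S}) (l : seq {k | k \in uf S}).
Local Notation k1 := (val x).
Local Notation ku1 := (valP x).
Local Notation s1 := (bmut s ku1).
Local Notation t := (lseed s1 l).
Local Notation e := (s k1).
Local Notation tau1 := (tau s k1).
Context (g : ser w (C s)) (g1 : ser w (C s1)).
Hypotheses (sg : scattering g) (sg1 : scattering g1) (lk : linked g g1).
Context (A B : N -> N).
Hypothesis T : transport l g1 A B.
(** For u in the chamber of t, u(y) is the value at e of u carried back to s1, so the sign of y on
    the chamber selects the branch of the first tropical mutation. *)
Let y := A e.

Lemma ltrop_e u : addv u -> ltrop s1 l u (s1 k1) = - ltrop s1 l u e.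
Proof. by move=> uD; rewrite addv_bmut_k //; exact: ltrop_add. Qed.

Lemma inner_neq0 u : addv u -> scham t u -> u y != 0.
Proof.
move=> uD us; have nw := ltrop_nowall sg1 uD us.
have := nowall_neq0 ku1 sg1 (ltrop_add _ _ uD) nw.
by rewrite ltrop_e // oppr_eq0 (tr_cham T uD (scham_cham us)).
Qed.

Section NonWall.
Variables (b : bool) (M MV : N -> N).
Hypothesis side_y : forall u, addv u -> cham t u -> side b (u y).
Hypothesis trop_side : forall v, addv v -> side b (v e) -> trop s k1 v = v \o M.
Hypothesis Pi_side : forall v, addv v -> side b (v e) -> v e != 0 ->
  forall n, Pi (trop s k1 v) g (MV n) = Pi v g1 n.
Hypothesis MVN : forall n, MV (- n) = - MV n.

(** If y does not vanish inside the k-th facet, the same branch of the first mutation acts on both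
    sides of it, so sign and wall data are inherited from the shorter path through M. *)
Lemma nonwall k (ku : k \in uf S) :
  (forall u, addv u -> facet t k u -> u y != 0) ->
  exists sg : bool,
    (forall u, addv u -> cham (bmut t ku) u ->
      ltrop s (x :: l) (trop t k u) =
      if sg then u \o tau t k \o (A \o M) else u \o (A \o M)) /\
    (forall u, addv u -> facet t k u ->
      Pi (ltrop s (x :: l) u) g (if sg then MV (B (t k)) else - MV (B (t k))) =
      psi (qk S k) 1).
Proof.
move=> fy; have [sgn [IHa IHb]] := tr_wall T ku; exists sgn; split=> [u uD us|u uD uf0].
  pose z := if sgn then tau t k y else y.
  have Tz v : addv v -> cham (bmut t ku) v -> ltrop s1 l (trop t k v) e = v z.
    by move=> vD vs; rewrite IHa // /z; case: (sgn).
  have tD v : addv v -> addv (trop t k v) by exact: trop_add.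
  have inner v : addv v -> scham (bmut t ku) v -> v z != 0.
    move=> vD vs; have := @ltrop_nowall _ _ _ s1 (rcons l (Sub k ku)) g1 v sg1 vD.
    rewrite lseed_rcons ltrop_rcons [bmut t _](_ : _ = bmut t ku); last first.
      by congr bmut; exact: bool_irrelevance.
    move=> /(_ vs) nw; have := nowall_neq0 ku1 sg1 (ltrop_add _ _ (tD _ vD)) nw.
    by rewrite (ltrop_e (tD _ vD)) oppr_eq0 (Tz _ vD (scham_cham vs)).
  (* This point lies in both chambers. There z, which plays the role of y beyond the facet, has the
     same nonzero value as y, so its constant sign is the same. *)
  pose u0 := facet_point t k.
  have uD0 : addv u0 by exact: facet_point_add.
  have f0 := facet_pointP t k; have f0' := facet_bmut ku uD0 f0.
  have E0 : u0 z = u0 y.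
    rewrite -Tz //; last exact: facet_cham f0'.
    rewrite trop_pos; last by rewrite /u0 (proj1 f0).
    by rewrite (tr_cham T uD0 (facet_cham f0)).
  have u0y := fy _ uD0 f0; have u0s := side_y uD0 (facet_cham f0).
  have zs : forall v, addv v -> cham (bmut t ku) v -> side b (v z).
    have [H|H] := cham_sign inner; have := H _ uD0 (facet_cham f0'); rewrite E0;
    move: (u0s) (u0y); rewrite /side; case: (b) => // h1 h2 h3.
      by case/eqP: h2; apply/eqP; rewrite eq_le h1 h3.
    by case/eqP: h2; apply/eqP; rewrite eq_le h1 h3.
  rewrite /= trop_side ?Tz ?zs //; last by apply: ltrop_add; exact: tD.
  by rewrite IHa //; case: (sgn).
have us := facet_cham uf0.
have vD : addv (ltrop s1 l u) by exact: ltrop_add.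
have ve : ltrop s1 l u e = u y by rewrite (tr_cham T uD us).
have := IHb u uD uf0; rewrite /= => <-.
rewrite -Pi_side ?ve ?side_y ?fy //.
by case: (sgn); rewrite ?MVN.
Qed.

End NonWall.

Section OnWall.
Variables (k : I) (ku : k \in uf S) (c : int).
Hypothesis yE : y = t k *~ c.

Lemma wall_e : e = B (t k) *~ c.
Proof. by rewrite -(trVMz T) -yE (trK T). Qed.

(** The basis vector e is primitive and B maps into the lattice. *)
Lemma wall_unit : c = 1 \/ c = -1.
Proof.
have := congr1 (co s k1) wall_e; rewrite coMz co_bs eqxx => /(congr1 absz).
rewrite abszM => /esym/eqP; rewrite muln_eq1 => /andP[_ /eqP]; lia.
Qed.

(** The facet is carried onto the hyperplane of e. The wall function there has a coefficient at - e
    but none at e, since the mutated cone contains only - e; this fixes the sign of the c-vector,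
    and [psi1_inj] gives equal multiplicities. *)
Lemma wall_cases : mult S k = mult S k1 /\
  ((c = -1 /\ (forall u, addv u -> cham (bmut t ku) u ->
      ltrop s1 l (trop t k u) = u \o tau t k \o A)) \/
   (c = 1 /\ (forall u, addv u -> cham (bmut t ku) u ->
      ltrop s1 l (trop t k u) = u \o A))).
Proof.
have [sgn [IHa IHb]] := tr_wall T ku.
have uD0 := @facet_point_add _ _ _ t k; have f0 := facet_pointP t k.
have := IHb _ uD0 f0; set v := ltrop s1 l _.
have vD : addv v by exact: ltrop_add.
have v0 : v (s1 k1) = 0.
  rewrite /v ltrop_e // (tr_cham T uD0 (facet_cham f0)) /= -/y yE addvMz //.
  by rewrite (proj1 f0) mul0r oppr0.
have W := Pi_wall ku1 sg1 vD v0.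
have notin : Pi v g1 e = 0.
  apply/eqP; apply: contraT => /ser_supp me.
  have := @cmem_mulrn _ _ _ s1 k1 1 ku1; rewrite mulr1n bmut_k => mo.
  by have := mem_opp me mo => e0; have := bs_neq0 s k1; rewrite e0 eqxx.
have := wall_unit => cu; move: (wall_e) IHa.
have ne := psi1_neq0 S k.
have We : Pi v g1 (- e) = psi (qk S k1) 1 by rewrite -(bmut_k s ku1).
case: cu => -> eE IHa.
- rewrite mulr1z in eE; move: IHa; rewrite -eE; case: (sgn) => IHa.
    by move=> E; rewrite -E notin eqxx in ne.
  by rewrite We => /psi1_inj ->; split => //; right.
- rewrite mulrNz mulr1z in eE; have {}eE : B (t k) = - e by rewrite eE opprK.
  move: IHa; rewrite eE opprK; case: (sgn) => IHa.
    by rewrite We => /psi1_inj ->; split => //; left.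
  by move=> E; rewrite -E notin eqxx in ne.
Qed.

(** A preserves the form and sends e to plus or minus t_k, so with equal multiplicities it
    intertwines the two transvections. *)
Lemma wall_comm n : mult S k = mult S k1 -> A (tau1 n) = tau t k (A n).
Proof.
move=> dk; rewrite /tau (trD T) (trMz T) -/y yE; congr (_ + _).
rewrite -mulrzA; congr (_ *~ _); apply: (@intr_inj rat).
have E : form S e n = form S (B (t k)) n * c%:~R by rewrite wall_e form_mulrzl.
have cc : c%:~R * c%:~R = 1 :> rat by case: wall_unit => ->.
rewrite intrM !psE //; last exact: ku1.
rewrite -(tr_formV T) -dk E.
transitivity (c%:~R * c%:~R * ((mult S k)%:R * form S (B (t k)) n)); last by rewrite cc mul1r.
ring.
Qed.

End OnWall.

Let y_inner u : addv u -> scham t u -> u y != 0 := @inner_neq0 u.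

Lemma transport_cons : exists A' B', transport (x :: l) g A' B'.
Proof.
have inn := inner_point_add t; have inP := inner_pointP t.
have ltD u : addv u -> addv (ltrop s1 l u) by exact: ltrop_add.
have tauK1 := tauK s ku1; have tauVK1 := tauVK s ku1.
have lte u : addv u -> cham t u -> ltrop s1 l u e = u y.
  by move=> uD us; rewrite (tr_cham T uD us).
have tau1N n : tau1 (- n) = - tau1 n.
  by rewrite /tau psN ?mulrNz ?opprD //; exact: ku1.
have tauV1N n : tauV s k1 (- n) = - tauV s k1 n.
  by apply: (can_inj tauK1); rewrite tauVK1 tau1N tauVK1.
have onwall k (ku : k \in uf S) b :
    (forall u, addv u -> cham t u -> side b (u y)) ->
    (exists u0, [/\ addv u0, facet t k u0 & u0 y = 0]) ->
    exists c, y = t k *~ c by move=> h1 h2; exists (co t k y); exact: wall_shape h1 h2.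
have [pos|neg] := cham_sign y_inner.
- exists A, B; split.
  + exact: trD T.
  + exact: trK T.
  + exact: trVK T.
  + exact: tr_form T.
  + move=> u uD us /=; rewrite trop_pos ?(tr_cham T uD us) //.
    exact: pos.
  + move=> k ku; have [[u0 u0P]|nofacet] := pselect (exists u0, [/\ addv u0, facet t k u0 & u0 y = 0]).
      have [c yE] := onwall k ku true pos (ex_intro _ u0 u0P).
      have [dk [[c1 _]|[c1 W]]] := wall_cases ku yE.
        have := pos _ inn (scham_cham inP); rewrite yE c1 mulrNz mulr1z addvN //.
        by rewrite oppr_ge0 leNgt inP.
      (* Beyond this facet u(y) is nonpositive, so the first mutation acts by tau_k1 there;
         [wall_comm] moves it to the far end as tau_k. *)
      rewrite c1 mulr1z in yE; exists true; split=> u uD us.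
        rewrite /= W // trop_neg //; first by apply/funext => n /=; rewrite (wall_comm ku (c := 1)) ?mulr1z.
        * exact: ku1.
        * exact: addv_comp uD (trD T).
        * by rewrite /= -/y yE; exact: cham_bmut_k uD us.
      have eB : B (t k) = e by rewrite -yE (trK T).
      have ve : ltrop s1 l u e = 0 by rewrite lte ?yE ?(proj1 us) //; exact: facet_cham us.
      rewrite eB /= trop_pos ?ve // (Pi_wall ku1 sg) ?ve //; first by rewrite /qk dk.
      exact: ltD.
    apply: (@nonwall true id id pos) => //.
    * by move=> v vD vs; rewrite trop_pos.
    * move=> v vD vs ve n; rewrite trop_pos //; apply/esym/(proj1 lk) => //.
      by rewrite lt_neqAle eq_sym ve.
    * by move=> u uD uf0; apply/eqP => uy; apply: nofacet; exists u.
- exists (A \o tau1), (tauV s k1 \o B); split.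
  + by move=> a b /=; rewrite tauD ?(trD T) //; exact: ku1.
  + by move=> a /=; rewrite (trK T) tauK1.
  + by move=> a /=; rewrite tauVK1 (trVK T).
  + by move=> a b /=; rewrite (tr_form T) form_tau //; exact: ku1.
  + move=> u uD us /=; rewrite trop_neg ?(tr_cham T uD us) //.
    * exact: ku1.
    * exact: addv_comp uD (trD T).
    * exact: neg.
  + move=> k ku; have [[u0 u0P]|nofacet] := pselect (exists u0, [/\ addv u0, facet t k u0 & u0 y = 0]).
      have [c yE] := onwall k ku false neg (ex_intro _ u0 u0P).
      have [dk [[c1 W]|[c1 _]]] := wall_cases ku yE; last first.
        have := neg _ inn (scham_cham inP); rewrite yE c1 mulr1z.
        by rewrite leNgt inP.
      (* Beyond this facet the first mutation is trivial, and by [wall_comm] the tau_k at the far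
         end supplies the tau_k1 contained in the new map: crossing does not change it. *)
      rewrite c1 mulrNz mulr1z in yE; exists false; split=> u uD us.
        rewrite /= W // trop_pos.
          apply/funext => n /=; rewrite -(wall_comm ku (c := -1)) ?mulrNz ?mulr1z //.
        rewrite /= -/y yE (_ : tau t k (- t k) = - t k).
          by rewrite addvN // oppr_ge0; exact: cham_bmut_k uD us.
        by rewrite /tau psN // psk oppr0 mulr0z addr0.
      have eB : B (t k) = - e by rewrite -[t k]opprK -yE (trVN T) (trK T).
      have ve : ltrop s1 l u e = 0.
        by rewrite lte ?yE ?addvN ?(proj1 us) ?oppr0 //; exact: facet_cham us.
      rewrite /= eB tauV1N opprK (_ : tauV s k1 e = e); last first.
        by rewrite /tauV psk mulr0z subr0.
      rewrite trop_pos ?ve // (Pi_wall ku1 sg) ?ve //; first by rewrite /qk dk.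
      exact: ltD.
    apply: (@nonwall false tau1 (tauV s k1) neg) => //.
    * by move=> v vD vs; rewrite trop_neg //; exact: ku1.
    * move=> v vD vs ve n; rewrite trop_neg //; last exact: ku1.
      by rewrite -(proj2 lk) ?tauVK1 // lt_neqAle ve.
    * by move=> u uD uf0; apply/eqP => uy; apply: nofacet; exists u.
Qed.

End Cons.
Lemma transport_exists s l (g : ser w (C s)) : scattering g ->
  exists A B, transport l g A B.
Proof.
elim: l s g => [|x l IH] s g sg; first by exists id, id; exact: transport_nil.
have [g1 sg1 lk] := linked_exists (valP x) sg.
have [A [B T]] := IH _ g1 sg1.
exact: transport_cons sg sg1 lk _ _ T.
Qed.

End Chambers.

(** * Transposed g-vectors *)

Section GVectors.
Context (I : finType) (N : zmodType) (S : seed_datum I N).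
Local Notation w := (form_twist S).
Local Notation C s := (seed_cone s).
Implicit Types (i j l : I) (n m : N) (u : N -> rat) (t : tree S).

Definition root_co i n : int := projT1 (cid (seed0_basis S n)) i.

Lemma root_coE n : n = \sum_i seed0 S i *~ root_co i n.
Proof. by rewrite /root_co; case: cid => v []. Qed.

Lemma root_co_uniq n (v : I -> int) : n = \sum_i seed0 S i *~ v i ->
  forall i, root_co i n = v i.
Proof.
move=> e i; rewrite /root_co; case: cid => c /= [_ cu].
rewrite (cu [ffun i => v i]) ?ffunE // e.
by apply: eq_bigr => j _; rewrite ffunE.
Qed.

Definition root_seed : bseed S.
Proof.
exists (seed0 S) root_co.
- move=> i x y; apply: (root_co_uniq (v := fun i => root_co i x + root_co i y)).
  rewrite {1}(root_coE x) {1}(root_coE y) -big_split; apply: eq_bigr => j _ /=.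
  by rewrite mulrzDr.
- exact: root_coE.
- move=> i j; apply: (root_co_uniq (v := fun i => (i == j)%:R)).
  rewrite (bigD1 j) //= eqxx mulr1z big1 ?addr0 // => l /negbTE ->.
  by rewrite mulr0z.
- exact: seed0_int.
Defined.

Fixpoint tpath t : seq {k | k \in uf S} :=
  if t is Child t x then rcons (tpath t) x else [::].

Definition tseed t := lseed root_seed (tpath t).

Lemma tseed_child t x : tseed (Child t x) = bmut (tseed t) (valP x).
Proof. by rewrite /tseed /= lseed_rcons. Qed.

Lemma seedE t : seed t = bs (tseed t).
Proof. by elim: t => [//|t IH x]; rewrite tseed_child /= IH. Qed.

Lemma pos_partE (x : rat) : pos_part x = if 0 <= x then x else 0.
Proof. by rewrite /pos_part; case: leP. Qed.

Lemma pos_partN (x : rat) : pos_part x = x + pos_part (- x).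
Proof. by rewrite !pos_partE oppr_ge0; case: (ltrgtP x 0) => h; lra. Qed.

Lemma pos_partM (a x : rat) : 0 <= a -> pos_part (a * x) = a * pos_part x.
Proof. by move=> a0; rewrite /pos_part maxr_pMr // mulr0. Qed.

Lemma cham_cov (s : bseed S) i : cham s (cov s i).
Proof. by move=> j _; rewrite cov_s ler0n. Qed.

Lemma cov_inj (s : bseed S) n m : (forall i, cov s i n = cov s i m) -> n = m.
Proof. by move=> e; apply: (@co_inj _ _ _ s) => i; apply: (@intr_inj rat); exact: e. Qed.

Lemma cov_tau (s : bseed S) k i n : k \in uf S ->
  cov s i (tau s k n) = cov s i n + (i == k)%:R * (mult S k)%:R * form S (s k) n.
Proof. by move=> ku; rewrite cov_add addvMz ?cov_s ?psE ?mulrA //; exact: cov_add. Qed.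

Lemma cov_bmut_neq (s : bseed S) k (ku : k \in uf S) i n : i != k ->
  cov (bmut s ku) i n = cov s i n.
Proof. by move=> ik; rewrite /cov bmut_co_neq. Qed.

Lemma rect_pos (s : bseed S) k i : k \in uf S -> (rect s k i)%:~R = pos_part (eps S s k i).
Proof.
move=> ku; rewrite rectE // /eps -psE // /pos_part.
by case: leP => h; [rewrite max_r ?ler0z | rewrite max_l ?lerz0 // ltW].
Qed.

Lemma cov_bmut_k (s : bseed S) k (ku : k \in uf S) n :
  cov (bmut s ku) k n = - cov s k n + \sum_l cov s l n * pos_part (eps S s k l).
Proof.
rewrite /cov /= /bmut_co eqxx intrD intrN; congr (_ + _).
by rewrite mulrz_sumr; apply: eq_bigr => l _; rewrite intrM rect_pos.
Qed.

Section Child.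
Context (t : tree S) (x : {k | k \in uf S}) (g : ser w (C root_seed)).
Hypothesis scat : scattering g.
Local Notation k := (val x).
Local Notation ku := (valP x).
Local Notation s := (tseed t).
Local Notation s' := (bmut s ku).
Context (A B A' B' : N -> N).
Hypotheses (T : transport (tpath t) g A B) (T' : transport (tpath (Child t x)) g A' B').

(* The sign sg is the tropical sign of the c-vector B (e_k). *)
Lemma child_sign : exists sg : bool,
  [/\ forall l, if sg then 0 <= cov root_seed l (B (s k)) else cov root_seed l (B (s k)) <= 0,
      forall n, A' n = if sg then tau s k (A n) else A n
    & forall n, B' n = if sg then B (tauV s k n) else B n].
Proof.
have [sg [H1 H2]] := tr_wall T ku; exists sg.
have EA n : A' n = if sg then tau s k (A n) else A n.
  apply: (@cov_inj s') => i.
  have uD : addv (cov s' i) by exact: cov_add.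
  have uc : cham s' (cov s' i) by exact: cham_cov.
  have uc' : cham (lseed root_seed (tpath (Child t x))) (cov s' i).
    by rewrite -/(tseed _) tseed_child.
  have := congr1 (fun F => F n) (tr_cham T' uD uc').
  rewrite /= ltrop_rcons H1 // => /= <-.
  by case: (sg).
split => //.
- move=> l; have f0 := facet_pointP s k.
  have := H2 _ (@facet_point_add _ _ _ s k) f0.
  case: (sg) => E.
    have /ser_supp/seed_coneP[h _] : Pi (ltrop root_seed (tpath t) (facet_point s k)) g (B (s k)) != 0.
      by rewrite E psi1_neq0.
    by rewrite /cov ler0z.
  have /ser_supp/seed_coneP[h _] : Pi (ltrop root_seed (tpath t) (facet_point s k)) g (- B (s k)) != 0.
    by rewrite E psi1_neq0.
  by rewrite /cov lerz0 -oppr_ge0 -coN.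
- move=> n; apply: (can_inj (trK T')); rewrite (trVK T') EA.
  by case: (sg); rewrite (trVK T) // tauVK //; exact: ku.
Qed.

Hypothesis gE : forall i j, g_dag t j i = cov s i (A (seed0 S j)).
(** Transposing the exchange matrix rescales c-vectors: [c_dag] consists of the root coordinates of
    B(e_j) up to the factor d_j / d_l. *)
Hypothesis cE : forall l j, j \in uf S ->
  (mult S l)%:R * c_dag t l j = (mult S j)%:R * cov root_seed l (B (s j)).

Let dpos i : 0 < (mult S i)%:R :> rat. Proof. by rewrite ltr0n mult_gt0. Qed.
Let dneq i : (mult S i)%:R != 0 :> rat. Proof. by rewrite gt_eqF. Qed.

(** A nonpositive c-vector kills the last sum of the recursion. For a nonnegative one the positive
    parts disappear and the sum becomes d_k {e_k, A(.)}, which is the effect of tau_k on the k-th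
    coordinate, as e_k = - e_k'. *)
Lemma child_g i j : g_dag (Child t x) j i = cov s' i (A' (seed0 S j)).
Proof.
have [sg [sgn EA _]] := child_sign.
rewrite EA /= -![sval x]/(val x); have [->|ik] := eqVneq i k; last first.
  by rewrite gE cov_bmut_neq //; case: (sg) => //; rewrite cov_tau ?(negbTE ik) ?mul0r ?addr0 //; exact: ku.
have base : - g_dag t j k + \sum_l g_dag t j l * pos_part (eps_dag t l k) =
    cov s' k (A (seed0 S j)).
  rewrite cov_bmut_k gE; congr (_ + _); apply: eq_bigr => l _.
  by rewrite gE /eps_dag seedE.
rewrite base {base}.
have cl l : c_dag t l k = (mult S l)%:R^-1 * ((mult S k)%:R * cov root_seed l (B (s k))).
  by rewrite -cE ?mulKf //; exact: ku.
have csgn l : if sg then 0 <= c_dag t l k else c_dag t l k <= 0.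
  have := sgn l; rewrite cl; case: (sg) => h.
    by rewrite mulr_ge0 ?invr_ge0 ?mulr_ge0 // ltW.
  by rewrite pmulr_rle0 ?invr_gt0 // pmulr_rle0.
case: (sg) csgn => csgn; last first.
  rewrite big1 ?subr0 // => l _; rewrite pos_partE; case: ifP => h; last by rewrite mulr0.
  by have -> : c_dag t l k = 0; [apply/eqP; rewrite eq_le csgn h | rewrite mulr0].
rewrite /tau cov_add addvMz; last exact: cov_add.
congr (_ + _); rewrite psE; last exact: ku.
have -> : cov s' k (s k) = -1.
  rewrite -[s k]opprK -(bmut_k s ku) addvN ?cov_s ?eqxx //; exact: cov_add.
rewrite mulN1r; congr (- _).
rewrite -(tr_formV T) (addv_coE root_seed (u := fun n => form S n (seed0 S j))); last first.
  by move=> a b; rewrite formDl.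
rewrite mulr_sumr; apply: eq_bigr => l _.
rewrite pos_partE csgn cl /eps_dag /eps /= -/(cov root_seed l _).
by field; rewrite dneq.
Qed.

(** The recursions for [c_dag] and for B(e_j) use positive parts of opposite exchange entries;
    pos_part p = p + pos_part (- p) and the constant sign of the c-vector reconcile them. *)
Lemma child_c l j : j \in uf S ->
  (mult S l)%:R * c_dag (Child t x) l j = (mult S j)%:R * cov root_seed l (B' (s' j)).
Proof.
move=> ju; have [sg [sgn _ EB]] := child_sign.
have covD : addv (cov root_seed l) by exact: cov_add.
have hk := cE l ku; rewrite EB /= -![sval x]/(val x); case: (eqVneq j k) => [->|jk].
  have -> : (if sg then B (tauV s k (s' k)) else B (s' k)) = - B (s k).
    rewrite bmut_k -(trVN T); case: (sg) => //; congr B.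
    by rewrite /tauV psN ?psk ?oppr0 ?mulr0z ?oppr0 ?addr0 //; exact: ku.
  by rewrite addvN // !mulrN hk.
have ps' : ps s k (s' j) = ps s k (s j).
  by rewrite bmut_neq // psD ?psMz ?psk ?mul0r ?addr0 //; exact: ku.
have hB : cov root_seed l (if sg then B (tauV s k (s' j)) else B (s' j)) =
    cov root_seed l (B (s j)) + cov root_seed l (B (s k)) *
      (pos_part (eps S s k j) - (if sg then eps S s k j else 0)).
  rewrite -rect_pos; last exact: ku.
  have -> : eps S s k j = (ps s k (s j))%:~R by rewrite psE //; exact: ku.
  case: (sg); rewrite /tauV ?ps' bmut_neq // ?subr0.
    by rewrite -addrA -mulrzBr (trVD T) (trVMz T) covD addvMz // intrB.
  by rewrite (trVD T) (trVMz T) covD addvMz.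
rewrite hB.
have X : eps_dag t k j = - ((mult S j)%:R / (mult S k)%:R * eps S s k j).
  rewrite /eps_dag /eps seedE (form_skew S (s j)) mulrA divfK // ?mulrN ?opprK //.
set h := cov root_seed l (B (s k)) in hk *; set p := eps S s k j in X *.
have eX : (mult S k)%:R * pos_part (eps_dag t k j) = (mult S j)%:R * pos_part (- p).
  rewrite -!pos_partM ?ltW // X; congr pos_part; field; exact: dneq.
have eh : (mult S l)%:R * pos_part (- c_dag t l k) = (mult S k)%:R * pos_part (- h).
  by rewrite -!pos_partM ?ltW // !mulrN hk.
move: (eps_dag t k j) X eX => Y X eX; rewrite !mulrDr cE // !mulrA hk eh.
have -> : (mult S k)%:R * h * pos_part Y =
    h * ((mult S j)%:R * pos_part (- p)) by rewrite -eX; ring.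
rewrite X.
have -> : (mult S k)%:R * pos_part (- h) * - ((mult S j)%:R / (mult S k)%:R * p) =
    - ((mult S j)%:R * pos_part (- h) * p) by field; exact: dneq.
have hs := sgn l; rewrite -/h in hs; rewrite -addrA; congr (_ + _).
rewrite [pos_part p]pos_partN (pos_partE (- h)) oppr_ge0.
case: (sg) hs => hs; last by rewrite hs; ring.
by case: ifP => h'; [have -> : h = 0 by apply/eqP; rewrite eq_le hs h' | ]; ring.
Qed.

End Child.
Definition ttrop t u := ltrop root_seed (tpath t) u.

Lemma ttrop_child t x u :
  ttrop (Child t x) u = ttrop t (trop (tseed t) (val x) u).
Proof. by rewrite /ttrop /= ltrop_rcons. Qed.

Lemma transport_dag t (g : ser w (C root_seed)) A B : scattering g ->
  transport (tpath t) g A B ->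
  (forall i j, g_dag t j i = cov (tseed t) i (A (seed0 S j))) /\
  (forall l j, j \in uf S -> (mult S l)%:R * c_dag t l j =
     (mult S j)%:R * cov root_seed l (B (tseed t j))).
Proof.
move=> scat; elim: t A B => [|t IH x] A' B' T'.
  have AE n : A' n = n.
    apply: (@cov_inj root_seed) => i.
    have uD : addv (cov root_seed i) by exact: cov_add.
    by have := congr1 (fun F => F n) (tr_cham T' uD (cham_cov root_seed i)).
  have BE n : B' n = n by rewrite -{2}(trVK T' n) AE.
  split=> [i j|l j _] /=; first by rewrite AE cov_s eq_sym.
  rewrite BE cov_s; case: eqP => [->|_] //; by rewrite !mulr0.
have [A [B T]] := transport_exists (tpath t) scat.
have [gE cE] := IH A B T; split; last by rewrite tseed_child; exact: (child_c T T' cE).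
by rewrite tseed_child; exact: (child_g T T' gE cE).
Qed.

Lemma ttrop_cov t i n : ttrop t (cov (tseed t) i) n =
  \sum_j G_tilde t i j * (root_co j n)%:~R.
Proof.
have [g scat] := scattering_exists root_seed.
have [A [B T]] := transport_exists (tpath t) scat.
have [gE _] := transport_dag scat T.
have uD : addv (cov (tseed t) i) by exact: cov_add.
rewrite /ttrop (tr_cham T uD (cham_cov _ i)).
have vD : addv (cov (tseed t) i \o A) by exact: addv_comp uD (trD T).
rewrite (addv_coE root_seed n vD); apply: eq_bigr => j _.
by rewrite /G_tilde gE.
Qed.

End GVectors.

(** * Monomial valuations of expansions *)

Lemma ex_minimum (T : eqType) (r : seq T) (F : T -> rat) x0 : x0 \in r ->
  exists2 x, x \in r & forall y, y \in r -> F x <= F y.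
Proof.
elim: r x0 => // a r IH x0 _; case: r IH => [_|b r IH].
  by exists a; rewrite ?inE // => y; rewrite inE => /eqP ->.
have [x xr xmin] := IH b (mem_head _ _).
have [ax|/ltW xa] := leP (F a) (F x).
  exists a; rewrite ?mem_head // => y; rewrite inE => /orP[/eqP ->|/xmin] //.
  exact: le_trans.
by exists x; [rewrite inE xr orbT | move=> y; rewrite inE => /orP[/eqP ->|/xmin]].
Qed.

Section Torus.
Context (kk : fieldType) (I : finType) (N : zmodType) (S : seed_datum I N).
Local Notation A := (qtorus kk S).
Local Notation K := (laurent kk).
Local Notation z := (z kk S).
Implicit Types (f g a b : A) (n m : N).

(* Stands in for nonzero coefficients, as [laurent kk] has no integral domain
   structure. *)
Definition regular (c : K) := forall x : K, x * c = 0 -> x = 0.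

Lemma regular1 : regular 1. Proof. by move=> x; rewrite mulr1. Qed.

Lemma regularM c c' : regular c -> regular c' -> regular (c * c').
Proof. by move=> h h' x; rewrite mulrA => /h'/h. Qed.

Lemma regular_qpow r : regular (qpow kk S r).
Proof.
move=> x e; have := congr1 (fun y => y * basis (trivial_cocycle kk) (- Num.floor ((qden S)%:R * r))) e.
rewrite /qpow mul0r -mulrA basisM subrr scale1r.
by rewrite [basis _ 0](_ : _ = 1) // mulr1.
Qed.

Lemma coefTD f g n : (f + g)@_n = f@_n + g@_n.
Proof. exact: mcoeffD. Qed.

Lemma coefTZ (c : K) f n : (c *: f)@_n = c * f@_n.
Proof. exact: mcoeffZ. Qed.

Lemma coefT0 n : (0 : A)@_n = 0.
Proof. exact: mcoeff0. Qed.

Lemma coefTz m n : (z m)@_n = (m == n)%:R.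
Proof. by rewrite /Defs.z /basis mcoeffU. Qed.

Lemma coefT_sum (T : Type) (r : seq T) (F : T -> A) n :
  (\sum_(x <- r) F x)@_n = \sum_(x <- r) (F x)@_n.
Proof.
apply: (big_ind2 (fun (x : A) y => x@_n = y)) => //; first exact: coefT0.
by move=> x1 y1 x2 y2 <- <-; rewrite coefTD.
Qed.

Lemma torusE f : f = \sum_(x <- msupp f) f@_x *: z x.
Proof. by rewrite -[LHS](lext_basis (f : {malg K[N]})). Qed.

Lemma in_supp f n : (n \in msupp f) = (f@_n != 0).
Proof. by rewrite -mcoeff_neq0. Qed.

Section Extremal.
Variables (e : N) (ht_e : N -> rat) (u : N -> rat).
Hypotheses (htD : addv ht_e) (hte : ht_e e = 1) (uD : addv u).

(* G_n is a string z^n, ..., z^(n + J e) with regular end coefficients; the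
   extremal term of a sum of such strings cannot cancel. *)
Lemma string_sum (a b : A) (G : N -> A) (J : N -> nat) (m0 : rat) :
  b = \sum_(n <- msupp a) a@_n *: G n ->
  (forall n m, (G n)@_m != 0 -> exists2 i, (i <= J n)%N & m = n + e *+ i) ->
  (forall n, regular ((G n)@_n)) -> (forall n, regular ((G n)@_(n + e *+ J n))) ->
  (forall n i, J (n + e *+ i) = J n) ->
  (forall n, b@_n != 0 -> m0 <= u n) <->
  (forall n, a@_n != 0 -> m0 <= u n + (J n)%:R * Num.min 0 (u e)).
Proof.
move=> bE supp low high Jinv.
have coefb m : b@_m = \sum_(n <- msupp a) a@_n * (G n)@_m.
  by rewrite bE coefT_sum; apply: eq_bigr => n _; rewrite coefTZ.
have uMn x j : u (x *+ j) = j%:R * u x by rewrite additiveMn // mulr_natl.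
have sgn_e : u e < 0 \/ 0 <= u e by case: (ltP (u e) 0); [left | right].
have only n0 m : n0 \in msupp a -> regular ((G n0)@_m) ->
    (forall n, n \in msupp a -> (G n)@_m != 0 -> n = n0) -> b@_m != 0.
  move=> n0a reg H; rewrite coefb (big_fsetD1 n0) //= big1_fset ?addr0.
    by move: n0a; rewrite in_supp; apply: contraNneq => /reg ->.
  move=> n; rewrite in_fsetD1 => /andP[ne na] _.
  have [->|/(H n na) E] := eqVneq ((G n)@_m) 0; first by rewrite mulr0.
  by rewrite E eqxx in ne.
split=> [hb n an|ha m]; last first.
  rewrite coefb => ne.
  have [n [na]] : exists n, a@_n != 0 /\ (G n)@_m != 0.
    have [|n nr] := @hasP _ (fun n => a@_n * (G n)@_m != 0) (msupp a) _.
      apply/negPn/negP => /hasPn none; move: ne; rewrite big1_seq ?eqxx //.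
      by move=> n /= /none; rewrite negbK => /eqP.
    move=> an; exists n; split; first by rewrite -in_supp.
    by apply: contraNneq an => ->; rewrite mulr0.
  move=> /supp[i iJ ->]; apply: le_trans (ha n na) _; rewrite uD uMn lerD2l.
  have [ue|ue] := sgn_e; last by rewrite min_l // mulr0 mulr_ge0.
  by rewrite min_r ?(ltW ue) // ler_nM2r // ler_nat.
pose val x := u x + (J x)%:R * Num.min 0 (u e).
have na : n \in msupp a by rewrite in_supp.
have [n1 n1a min1] := ex_minimum val na.
apply: le_trans (min1 n na); rewrite /val.
(* For u(e) < 0 the least value on a string is at its top end. Another string through the top of n1
   has the same length, and minimality forces it to start at n1. *)
have [ue|ue] := sgn_e.
  rewrite min_r ?(ltW ue) // -uMn -uD; apply: hb; apply: (only n1) => // n' n'a.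
  move=> /supp[i iJ E]; have n'E : n' = n1 + e *+ J n1 - e *+ i by rewrite E addrK.
  have JJ : J n' = J n1 by rewrite -(Jinv n' i) -E Jinv.
  have := min1 n' n'a; rewrite /val JJ min_r ?(ltW ue) // lerD2r n'E uD uD addvN // !uMn -addrA.
  rewrite -mulrBl lerDl => h; have iJ1 : (J n1 <= i)%N.
    by rewrite leqNgt; apply: contraL h => h; rewrite -ltNge nmulr_llt0 // subr_gt0 ltr_nat.
  have iE : i = J n1 by apply/eqP; rewrite eqn_leq iJ1 -JJ iJ.
  by rewrite iE addrK.
rewrite min_l // mulr0 addr0.
(* For u(e) >= 0 the least value is at the bottom end. As u(e) may be 0, ties are broken by the
   e-coordinate [ht_e]. *)
pose r := [seq x <- msupp a | val x == val n1].
have n1r : n1 \in r by rewrite mem_filter eqxx.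
have [n2 n2r min2] := ex_minimum ht_e n1r.
move: n2r; rewrite mem_filter => /andP[/eqP v2 n2a].
have vu x : val x = u x by rewrite /val min_l // mulr0 addr0.
rewrite -vu -v2 vu; apply: hb; apply: (only n2) => // n' n'a /supp[i iJ E].
have n'E : n' = n2 - e *+ i by rewrite E addrK.
have n'r : n' \in r.
  rewrite mem_filter n'a andbT eq_le min1 // andbT -v2 !vu n'E uD addvN // uMn.
  by rewrite gerDl oppr_le0 mulr_ge0.
have := min2 n' n'r; rewrite n'E htD addvN // lerDl oppr_ge0 additiveMn // hte.
by rewrite lern0 => /eqP ->; rewrite mulr0n subr0.
Qed.

End Extremal.
End Torus.

(** * One mutation on Laurent expansions *)

Section MutationTorus.
Context (kk : fieldType) (I : finType) (N : zmodType) (S : seed_datum I N).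
Local Notation A := (qtorus kk S).
Local Notation K := (laurent kk).
Local Notation z := (z kk S).
Context (F : fraction_skew_field A) (s : bseed S) (k : I) (ku : k \in uf S).
Implicit Types (a b f g : A) (n m : N) (r c : int) (x y : F).
Local Notation emb := (emb F).
Local Notation e := (s k).
Local Notation p := (ps s k).

Definition bin_exp r : rat := (2 * r%:~R - 1) / (mult S k)%:R.
Lemma bin_spec : {b : int -> A | forall r, b r = 1 + qpow kk S (bin_exp r) *: z e}.
Proof. by exists (fun r => 1 + qpow kk S (bin_exp r) *: z e). Qed.

(* The factor 1 + q_k^(2r-1) z^(e_k); opaque, since unfolding it in conversion
   tests is very costly. *)
Definition bin r : A := sval bin_spec r.

Lemma binE r : bin r = 1 + qpow kk S (bin_exp r) *: z e.
Proof. exact: (svalP bin_spec). Qed.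

Lemma multk_neq0 : (mult S k)%:R != 0 :> rat.
Proof. by rewrite pnatr_eq0 -lt0n mult_gt0. Qed.

Lemma qden_div : (qden S)%:R / (mult S k)%:R \is a (@Num.int rat).
Proof.
by rewrite -(divnK (qden_mult S k)) natrM mulfK ?multk_neq0 // rpred_nat.
Qed.

Lemma bin_exp_int r : (qden S)%:R * bin_exp r \is a Num.int.
Proof.
by rewrite /bin_exp mulrCA rpredM ?qden_div // rpredB ?rpredM ?rpred_int ?rpred1 ?rpred_nat.
Qed.

Lemma form_p n : form S e n = (p n)%:~R / (mult S k)%:R.
Proof. by rewrite psE // mulrC mulKf ?multk_neq0. Qed.

Lemma zz m n : z m * z n = qpow kk S (- form S m n) *: z (m + n).
Proof. exact: basisM. Qed.

Lemma bin_mul r a : bin r * a = a + qpow kk S (bin_exp r) *: (z e * a).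
Proof. by rewrite binE mulrDl mul1r -scalerAl. Qed.

Lemma mul_bin r a : a * bin r = a + qpow kk S (bin_exp r) *: (a * z e).
Proof. by rewrite binE mulrDr mulr1 -scalerAr. Qed.

Lemma bin_z r n : bin r * z n = z n * bin (r - p n).
Proof.
rewrite bin_mul mul_bin !zz !scalerA -!qpowD; try exact: bin_exp_int.
have -> : bin_exp r + - form S e n = bin_exp (r - p n) + - form S n e.
  rewrite (form_skew S e n) form_p /bin_exp intrB; field; exact: multk_neq0.
by rewrite [n + e]addrC.
Qed.

Lemma binC r c : bin r * bin c = bin c * bin r.
Proof.
apply: etrans (bin_mul r (bin c)) _; apply: etrans _ (esym (mul_bin r (bin c))).
by have -> : z e * bin c = bin c * z e by apply: etrans (mul_bin c (z e)) (esym (bin_mul c (z e))).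
Qed.

Lemma bin_neq0 r : bin r != 0.
Proof.
apply/eqP => /(congr1 (fun f : A => f@_0)) /eqP.
rewrite binE coefTD coefTZ coefT0 coefTz (negbTE (bs_neq0 s k)) mulr0 addr0.
by rewrite -[X in X@_0]/(z 0) coefTz eqxx oner_eq0.
Qed.

Lemma emb_neq0 a : (emb a == 0) = (a == 0).
Proof. by rewrite -(rmorph0 emb) (inj_eq (@emb_inj _ F)). Qed.

Lemma emb_unit a : a != 0 -> emb a \is a GRing.unit.
Proof. by move=> a0; apply: frac_unit; rewrite emb_neq0. Qed.

Lemma embM a b : emb (a * b) = emb a * emb b.
Proof. exact: rmorphM. Qed.

Lemma binomial_factorE (m : rat) r : m = 2 * r%:~R - 1 -> binomial_factor F s k m = emb (bin r).
Proof. by move=> ->; rewrite binE. Qed.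

(* The ratio Psi(q^(2c) x) / Psi(x) of dilogarithms at q = q_k, x = z^(e_k). *)
Definition Rf c : F :=
  match c with
  | Posz j => \prod_(1 <= r < j.+1) emb (bin r%:Z)
  | Negz j => \prod_(1 <= r < j.+2) (emb (bin (1 - r%:Z)))^-1
  end.

Lemma mutation_monomialE n : mutation_monomial F s k n = emb (z n) * Rf (- p n).
Proof.
rewrite /mutation_monomial /Rf.
have -> : Num.floor (- (mult S k)%:R * form S e n) = - p n.
  have -> : - (mult S k)%:R * form S e n = (- p n)%:~R by rewrite intrN psE // mulNr.
  exact: intrKfloor.
case: (- p n) => j; congr (_ * _); apply: eq_bigr => r _.
  by apply: binomial_factorE.
congr (_^-1); apply: binomial_factorE; rewrite intrB; ring.
Qed.

Lemma Rf0 : Rf 0 = 1.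
Proof. by rewrite -[0]/(Posz 0) /Rf big_geq. Qed.

Lemma RfS c : Rf (c + 1) = Rf c * emb (bin (c + 1)).
Proof.
case: c => [j|[|j]].
- have -> : Posz j + 1 = j.+1 :> int by lia.
  by rewrite /Rf big_nat_recr.
- rewrite [Negz 0 + 1](_ : _ = 0) // Rf0 /Rf big_nat1 subrr mulVr //.
  exact/emb_unit/bin_neq0.
- have -> : Negz j.+1 + 1 = Negz j by rewrite !NegzE; lia.
  rewrite /Rf [in RHS]big_nat_recr //=.
  have -> : 1 - j.+2%:Z = Negz j :> int by rewrite NegzE; lia.
  rewrite -mulrA mulVr ?mulr1 //; exact/emb_unit/bin_neq0.
Qed.

Lemma RfP c : Rf (c - 1) = Rf c * (emb (bin c))^-1.
Proof. by rewrite -{2}(subrK 1 c) RfS subrK mulrK //; exact/emb_unit/bin_neq0. Qed.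

Lemma int_step (P : int -> Prop) c0 : P c0 ->
  (forall c, P c -> P (c + 1)) -> (forall c, P c -> P (c - 1)) -> forall c, P c.
Proof.
move=> P0 up down c; rewrite -(subrK c0 c) addrC; elim/int_ind: (c - c0) => [|j|j].
- by rewrite addr0.
- by move=> /up; rewrite -addrA; congr P; lia.
- by move=> /down; rewrite -addrA; congr P; lia.
Qed.

Lemma Rf_bin c r : GRing.comm (emb (bin r)) (Rf c).
Proof.
have cb c' : GRing.comm (emb (bin r)) (emb (bin c')).
  rewrite /GRing.comm.
  rewrite -(embM (bin r) (bin c')).
  rewrite -(embM (bin c') (bin r)).
  rewrite (binC r c').
  reflexivity.
apply: (int_step (P := fun c => GRing.comm (emb (bin r)) (Rf c)) (c0 := 0)) => [|{}c IH|{}c IH].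
- by rewrite Rf0; exact: commr1.
- by rewrite RfS; apply: commrM.
- by rewrite RfP; apply: commrM => //; apply: commrV.
Qed.

Lemma emb_bin_z r n : emb (bin r) * emb (z n) = emb (z n) * emb (bin (r - p n)).
Proof.
apply: etrans (esym (embM (bin r) (z n))) _.
apply: etrans _ (embM (z n) (bin (r - p n))).
exact: congr1 (bin_z r n).
Qed.

(** Moving z^n to the left rescales x = z^(e_k) by q_k^(-2p), and the ratios of dilogarithms
    telescope: R_c(q_k^(-2p) x) R_(-p)(x) = R_(c-p)(x). This makes the mutation multiplicative. *)
Lemma Rf_z c n : Rf c * emb (z n) * Rf (- p n) = emb (z n) * Rf (c - p n).
Proof.
have eb r := emb_unit (bin_neq0 r).
apply: (int_step (P := fun c => Rf c * emb (z n) * Rf (- p n) = emb (z n) * Rf (c - p n)) (c0 := 0)) => [|{}c IH|{}c IH].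
- by rewrite Rf0 mul1r sub0r.
- have -> : c + 1 - p n = c - p n + 1 by rewrite addrAC.
  rewrite (RfS c) (RfS (c - p n)) [RHS]mulrA -IH -(mulrA (Rf c)) emb_bin_z.
  have -> : c + 1 - p n = c - p n + 1 by rewrite addrAC.
  by rewrite -!mulrA (Rf_bin (- p n) (c - p n + 1)).
- apply: (mulIr (eb (c - p n))); rewrite -mulrA -(Rf_bin (- p n)) mulrA.
  have -> : Rf (c - 1) * emb (z n) * emb (bin (c - p n)) = Rf c * emb (z n).
    rewrite -mulrA -emb_bin_z mulrA; congr (_ * _).
    by have := RfS (c - 1); rewrite subrK => <-.
  rewrite IH -mulrA; congr (_ * _).
  by have := RfS (c - 1 - p n); rewrite [c - 1 - _ + 1]addrAC subrK => ->.
Qed.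

Lemma embD a b : emb (a + b) = emb a + emb b.
Proof. exact: rmorphD. Qed.

Lemma emb1 : emb 1 = 1. Proof. exact: rmorph1. Qed.
Lemma emb0 : emb 0 = 0. Proof. exact: rmorph0. Qed.

Lemma emb_sum (T : Type) (r : seq T) (G : T -> A) :
  emb (\sum_(i <- r) G i) = \sum_(i <- r) emb (G i).
Proof. by apply: (big_morph emb); [exact: embD | exact: emb0]. Qed.

Definition sc (c : K) : F := emb (c *: 1).

Lemma scE (c : K) a : emb (c *: a) = sc c * emb a.
Proof.
apply: etrans _ (embM (c *: 1) a); congr (emb _).
by rewrite -scalerAl mul1r.
Qed.

Lemma sc1 : sc 1 = 1.
Proof. by rewrite /sc scale1r emb1. Qed.

Lemma sc0 : sc 0 = 0.
Proof. by rewrite /sc scale0r emb0. Qed.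

Lemma scD (c d : K) : sc (c + d) = sc c + sc d.
Proof. by rewrite /sc scalerDl embD. Qed.

Lemma scM (c d : K) : sc (c * d) = sc c * sc d.
Proof. by rewrite -(scE c (d *: 1)) /sc scalerA. Qed.

Lemma sc_central (c : K) x : GRing.comm (sc c) x.
Proof.
have ca a : GRing.comm (sc c) (emb a).
  rewrite /GRing.comm -(scE c a); apply: etrans _ (embM a (c *: 1)).
  by congr (emb _); rewrite -scalerAr mulr1.
have [[a b] /andP[_ /eqP ->]] := fracP x.
by apply: commrM => //; apply: commrV.
Qed.

(** [mon] and [mu] are sealed behind opaque specifications for the same reason as [bin]. *)
Definition mon_spec : {m : N -> F | forall n, m n = emb (z n) * Rf (- p n)}.
Proof. by exists (fun n => emb (z n) * Rf (- p n)). Qed.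
Definition mon n : F := sval mon_spec n.

Lemma monE n : mon n = emb (z n) * Rf (- p n).
Proof. exact: (svalP mon_spec). Qed.

Lemma monM m n : mon m * mon n = sc (qpow kk S (- form S m n)) * mon (m + n).
Proof.
rewrite !monE -[LHS]mulrA [Rf _ * _]mulrA Rf_z mulrA -embM zz scE -[LHS]mulrA.
by rewrite psD // opprD.
Qed.

Definition mu_spec : {m : A -> F | forall f, m f = mutation_torus F s k f}.
Proof. by exists (mutation_torus F s k). Qed.
Definition mu f : F := sval mu_spec f.

Lemma muE f : mu f = mutation_torus F s k f.
Proof. exact: (svalP mu_spec). Qed.

Lemma muEw f (d : {fset N}) : (msupp f `<=` d)%fset ->
  mu f = \sum_(n <- d) sc f@_n * mon n.
Proof.
move=> sfd; rewrite muE /mutation_torus (big_fset_incl _ sfd).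
  apply: eq_bigr => n _; rewrite mutation_monomialE. rewrite -monE; exact: erefl.
by move=> n _ /mcoeff_outdom ->; rewrite -/(sc 0) sc0 mul0r.
Qed.

Lemma muD f g : mu (f + g) = mu f + mu g.
Proof.
set d := (msupp f `|` msupp g `|` msupp (f + g))%fset.
have [sf sg sfg] : [/\ msupp f `<=` d, msupp g `<=` d
                     & msupp (f + g) `<=` d]%fset.
  by split; apply/fsubsetP => x xf; rewrite !in_fsetU xf ?orbT.
apply: etrans (muEw sfg) _.
apply: etrans _ (congr2 (fun y1 y2 => y1 + y2) (esym (muEw sf)) (esym (muEw sg))).
apply: etrans _ (big_split _ _ _ _ _); apply: eq_bigr => n _.
by rewrite coefTD scD mulrDl.
Qed.

Lemma muZ (c : K) f : mu (c *: f) = sc c * mu f.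
Proof.
set d := (msupp f `|` msupp (c *: f))%fset.
have [sf sg] : [/\ msupp f `<=` d & msupp (c *: f) `<=` d]%fset.
  by split; apply/fsubsetP => x xf; rewrite !in_fsetU xf ?orbT.
apply: etrans (muEw sg) _; apply: etrans _ (congr1 (fun y => sc c * y) (esym (muEw sf))).
apply: etrans _ (esym (mulr_sumr _ _ _ _)); apply: eq_bigr => n _.
by rewrite coefTZ scM mulrA.
Qed.

Lemma mu_z n : mu (z n) = mon n.
Proof.
rewrite (muEw (d := [fset n]%fset)).
  by rewrite big_seq_fset1 coefTz eqxx sc1 mul1r.
by apply/fsubsetP => m; rewrite in_supp coefTz inE; have [_|_] := eqVneq n m; rewrite ?eqxx.
Qed.

Lemma mu0 : mu 0 = 0.
Proof. by have := muZ 0 0; rewrite scale0r sc0 mul0r. Qed.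

Lemma torus_ind (P : A -> Prop) :
  P 0 -> (forall f g, P f -> P g -> P (f + g)) ->
  (forall (c : K) f, P f -> P (c *: f)) -> (forall n, P (z n)) ->
  forall f, P f.
Proof. exact: basis_ind. Qed.

Lemma muM f g : mu (f * g) = mu f * mu g.
Proof.
have addl f1 f2 h : mu (f1 * h) = mu f1 * mu h -> mu (f2 * h) = mu f2 * mu h ->
    mu ((f1 + f2) * h) = mu (f1 + f2) * mu h.
  move=> e1 e2; apply: etrans (congr1 mu (mulrDl f1 f2 h)) _.
  apply: etrans (muD (f1 * h) (f2 * h)) _; apply: etrans (congr2 (fun x y : F => x + y) e1 e2) _.
  apply: etrans (esym (mulrDl (mu f1) (mu f2) (mu h))) _.
  by rewrite (muD f1 f2).
have addr f1 f2 h : mu (h * f1) = mu h * mu f1 -> mu (h * f2) = mu h * mu f2 ->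
    mu (h * (f1 + f2)) = mu h * mu (f1 + f2).
  move=> e1 e2; apply: etrans (congr1 mu (mulrDr h f1 f2)) _.
  apply: etrans (muD (h * f1) (h * f2)) _; apply: etrans (congr2 (fun x y : F => x + y) e1 e2) _.
  apply: etrans (esym (mulrDr (mu h) (mu f1) (mu f2))) _.
  by rewrite (muD f1 f2).
have scl (c : K) h1 h2 : mu (h1 * h2) = mu h1 * mu h2 ->
    mu ((c *: h1) * h2) = mu (c *: h1) * mu h2.
  move=> eh; apply: etrans (congr1 mu (esym (scalerAl c h1 h2))) _.
  apply: etrans (muZ c (h1 * h2)) _; apply: etrans (congr1 (fun y : F => (sc c) * y) eh) _.
  apply: etrans (mulrA _ _ _) _.
  by rewrite (muZ c h1).
have scr (c : K) h1 h2 : mu (h1 * h2) = mu h1 * mu h2 ->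
    mu (h1 * (c *: h2)) = mu h1 * mu (c *: h2).
  move=> eh; apply: etrans (congr1 mu (esym (scalerAr c h1 h2))) _.
  apply: etrans (muZ c (h1 * h2)) _; apply: etrans (congr1 (fun y : F => (sc c) * y) eh) _.
  apply: etrans _ (esym (congr1 (fun y : F => (mu h1) * y) (muZ c h2))).
  apply: etrans (mulrA _ _ _) _; apply: etrans _ (esym (mulrA _ _ _)).
  by rewrite (sc_central c (mu h1)).
elim/torus_ind: f => [|f1 f2 e1 e2|c f ef|m]; [| exact: addl | exact: scl |].
  apply: etrans (congr1 mu (mul0r g)) _; apply: etrans mu0 _.
  apply: etrans (esym (mul0r (mu g))) _; by rewrite mu0.
elim/torus_ind: g => [|f1 f2 e1 e2|c f ef|n]; [| exact: addr | exact: scr |].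
  apply: etrans (congr1 mu (mulr0 (z m))) _; apply: etrans mu0 _.
  apply: etrans (esym (mulr0 (mu (z m)))) _; by rewrite mu0.
apply: etrans (congr1 mu (zz m n)) _; apply: etrans (muZ _ (z (m + n))) _.
by rewrite (mu_z m) (mu_z n) (mu_z (m + n)) (monM m n).
Qed.

Definition binprod (rr : nat -> int) (j : nat) : A := \prod_(i < j) bin (rr i).

Lemma binprodS rr j : binprod rr j.+1 = binprod rr j * bin (rr j).
Proof. by rewrite /binprod big_ord_recr. Qed.

Lemma binprod0 rr : binprod rr 0 = 1.
Proof. by rewrite /binprod big_ord0. Qed.

Lemma coef_mulz f m : (f * z e)@_(m + e) = qpow kk S (- form S m e) * f@_m.
Proof.
elim/torus_ind: f => [|f1 f2 e1 e2|c f ef|n].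
- by rewrite mul0r !coefT0 mulr0.
- rewrite (congr1 (fun h : A => h@_(m + e)) (mulrDl f1 f2 (z e))).
  apply: etrans (coefTD (f1 * z e) (f2 * z e) (m + e)) _.
  apply: etrans (congr2 (fun x y : K => x + y) e1 e2) _; rewrite (coefTD f1 f2).
  exact: esym (mulrDr _ _ _).
- rewrite -(congr1 (fun h : A => h@_(m + e)) (scalerAl c f (z e))).
  apply: etrans (coefTZ c (f * z e) (m + e)) _.
  apply: etrans (congr1 (fun x : K => c * x) ef) _; rewrite (coefTZ c f).
  exact: mulrCA.
rewrite zz coefTZ !coefTz (inj_eq (addIr e)).
by case: eqP => [->|_]; rewrite ?mulr0.
Qed.

Lemma coef_mul_bin f r m : (f * bin r)@_(m + e) =
  f@_(m + e) + qpow kk S (bin_exp r) * (qpow kk S (- form S m e) * f@_m).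
Proof.
apply: etrans (congr1 (fun h : A => h@_(m + e)) (mul_bin r f)) _.
apply: etrans (coefTD f (qpow kk S (bin_exp r) *: (f * z e)) (m + e)) _.
congr (_ + _); apply: etrans (coefTZ (qpow kk S (bin_exp r)) (f * z e) (m + e)) _.
by congr (_ * _); exact: coef_mulz.
Qed.

Lemma bin_string rr j n : let G := z n * binprod rr j in
  [/\ forall m, G@_m != 0 -> exists2 i, (i <= j)%N & m = n + e *+ i,
      regular (G@_n) & regular (G@_(n + e *+ j))].
Proof.
elim: j => [|j [supp low high]] /=.
  rewrite binprod0 mulr1 mulr0n addr0 coefTz eqxx; split=> [m||]; try exact: regular1.
  by rewrite coefTz; have [<- _|] := eqVneq n m;
    [exists 0%N; rewrite ?addr0 | rewrite eqxx].
rewrite (congr1 ( *%R (z n)) (binprodS rr j)) mulrA.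
move: (z n * binprod rr j) supp low high => G supp low high.
have GE := coef_mul_bin G (rr j).
have out i m : m = n + e *+ i -> (j < i)%N -> G@_m = 0.
  move=> -> ji; apply/eqP; apply: contraT => /supp[l lj /addrI/(@axis_inj _ _ _ s k) E].
  by move: ji; rewrite E ltnNge lj.
split=> [m||].
- have := GE (m - e); rewrite subrK => ->.
  have [g0|/supp[i ij ->]] := eqVneq (G@_m) 0; last by exists i => //; exact: leqW.
  rewrite g0 add0r; have [->|/supp[i ij E] _] := eqVneq (G@_(m - e)) 0.
    by rewrite !mulr0 eqxx.
  by exists i.+1 => //; rewrite mulrSr addrA -E subrK.
- have := GE (n - e); rewrite subrK => ->; rewrite (_ : G@_(n - e) = 0).
    rewrite !mulr0 addr0; exact: low.
  apply/eqP; apply: contraT => /supp[i ij] /addrI Ei.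
  have : s k *+ i.+1 == 0 by rewrite mulrS -Ei subrr.
  by rewrite axis_eq0.
- have -> : n + e *+ j.+1 = n + e *+ j + e by rewrite mulrSr addrA.
  have E : n + e *+ j + e = n + e *+ j.+1 by rewrite mulrSr addrA.
  rewrite GE (out j.+1 _ E (ltnSn j)) add0r.
  apply: regularM; first exact: regular_qpow.
  by apply: regularM; [exact: regular_qpow | exact: high].
Qed.

(** R_(-C) is the inverse of the clearing product of indices 0, -1, ..., 1 - C; the j further steps
    from R_(-C) to R_(j-C) contribute the indices 1 - C, ..., j - C. *)
Lemma Rf_binprod (C j : nat) :
  Rf (j%:Z - C%:Z) * emb (binprod (fun i => - i%:Z) C) =
  emb (binprod (fun i => i%:Z + 1 - C%:Z) j).
Proof.
elim: j => [|j IH].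
  rewrite binprod0 emb1 sub0r; elim: C => [|C IH]; first by rewrite binprod0 emb1 oppr0 Rf0 mulr1.
  rewrite binprodS embM.
  have bc : emb (binprod (fun i => - i%:Z) C) * emb (bin (- C%:Z)) =
            emb (bin (- C%:Z)) * emb (binprod (fun i => - i%:Z) C).
    elim: (C) (- C%:Z) => [|l IHl] r; first by rewrite binprod0 emb1 mul1r mulr1.
    rewrite binprodS embM -mulrA -[emb (bin _) * emb (bin r)]embM (binC _ r) embM mulrA IHl.
    by rewrite mulrA.
  rewrite bc mulrA; have := RfS (- C.+1%:Z).
  have -> : - C.+1%:Z + 1 = - C%:Z :> int by lia.
  by move=> <-.
have -> : j.+1%:Z - C%:Z = j%:Z - C%:Z + 1 :> int by lia.
rewrite RfS -mulrA binprodS embM -IH.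
have -> : j%:Z + 1 - C%:Z = j%:Z - C%:Z + 1 :> int by lia.
move: (j%:Z - C%:Z) => c; rewrite -mulrA; congr (_ * _).
elim: (C) => [|l IHl]; first by rewrite binprod0 emb1 mul1r mulr1.
by rewrite binprodS embM mulrA IHl -!mulrA -embM (binC (c + 1)) embM.
Qed.

Section Clear.
Variables (a' : A) (C : nat).
Hypothesis bound : forall n, n \in msupp a' -> (p n <= C%:Z).

(* Multiplying by sufficiently many factors 1 + q_k^m z^(e_k), m < 0, clears all
   denominators. *)
Lemma mu_clear : mu a' * emb (binprod (fun i => - i%:Z) C) =
  emb (\sum_(n <- msupp a') a'@_n *:
    (z n * binprod (fun i => i%:Z + 1 - C%:Z) `|C%:Z - p n|)).
Proof.
rewrite (muEw (fsubset_refl _)) emb_sum mulr_suml; apply: eq_big_seq => n na.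
rewrite scE embM -Rf_binprod monE -!mulrA; congr (_ * (_ * (Rf _ * _))).
have := bound na; lia.
Qed.

End Clear.

Lemma supp_bound a' : exists C : nat, forall n, n \in msupp a' -> (p n <= C%:Z).
Proof.
exists (\sum_(n <- msupp a') `|p n|)%N => n na.
rewrite (big_rem n) //=; lia.
Qed.

Lemma ps_shift n i : p (n + e *+ i) = p n.
Proof. by rewrite psD // psMn // psk mul0rn addr0. Qed.

Lemma cov_e : cov s k e = 1.
Proof. by rewrite cov_s eqxx. Qed.

Lemma mu_inj a' : mu a' = 0 -> a' = 0.
Proof.
move=> m0; have [C bound] := supp_bound a'.
have := mu_clear bound; rewrite m0 mul0r => /esym/eqP; rewrite emb_neq0 => /eqP/esym b0.
(* With b = 0, u = 0 and threshold 1 the left side of [string_sum] is vacuous, and the right side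
   gives 1 <= 0 at any exponent of a'. *)
have [str1 _] := string_sum (@cov_add _ _ _ s k) cov_e (u := fun=> 0)
  (fun _ _ => esym (addr0 0)) 1 b0
  (fun n => let: And3 h _ _ := bin_string _ _ n in h)
  (fun n => let: And3 _ h _ := bin_string _ _ n in h)
  (fun n => let: And3 _ _ h := bin_string _ _ n in h)
  (fun n i => congr1 (fun x : int => `|C%:Z - x|%N) (ps_shift n i)).
have {}str1 : forall n, a'@_n != 0 -> False.
  have zero m : (0 : A)@_m != 0 -> 1 <= (0 : rat) by rewrite coefT0 eqxx.
  by move=> n an; have := str1 zero n an; rewrite min_l // mulr0 addr0 ler10.
by rewrite (torusE a') big1_seq // => n /=; rewrite in_supp => /str1.
Qed.

(** After multiplication by the clearing product, a term of a' at n is a string of length C - p n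
    and a term of a one of length C. Applying [string_sum] to both expansions of the same product at
    threshold C min(0, u(e)) leaves the discrepancy p n min(0, u(e)), the correction term of
    [trop]. *)
Lemma mu_val a' a (v : N -> rat) : addv v -> mu a' = emb a ->
  (forall n, a'@_n != 0 -> 0 <= v n) <->
  (forall n, a@_n != 0 -> 0 <= trop s k v n).
Proof.
move=> vD E; have [C bound] := supp_bound a'.
set u := trop s k v; have uD : addv u by exact: trop_add.
have ue : u e = v e by rewrite /u /trop form_diag mulr0 mul0r addr0.
have e1 := mu_clear bound; rewrite E -embM in e1.
have {}e1 := @emb_inj _ F _ _ e1.
have e2 : a * binprod (fun i => - i%:Z) C =
    \sum_(n <- msupp a) a@_n *: (z n * binprod (fun i => - i%:Z) C).
  by rewrite {1}(torusE a) mulr_suml; apply: eq_bigr => n _; rewrite -scalerAl.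
have str1 := string_sum (@cov_add _ _ _ s k) cov_e uD (C%:R * Num.min 0 (u e)) e1
  (fun n => let: And3 h _ _ := bin_string _ _ n in h)
  (fun n => let: And3 _ h _ := bin_string _ _ n in h)
  (fun n => let: And3 _ _ h := bin_string _ _ n in h)
  (fun n i => congr1 (fun x : int => `|C%:Z - x|%N) (ps_shift n i)).
have str2 := string_sum (@cov_add _ _ _ s k) cov_e uD (C%:R * Num.min 0 (u e)) e2
  (fun n => let: And3 h _ _ := bin_string _ C n in h)
  (fun n => let: And3 _ h _ := bin_string _ C n in h)
  (fun n => let: And3 _ _ h := bin_string _ C n in h)
  (fun n i => erefl C).
have key n : a'@_n != 0 ->
    u n + (`|C%:Z - p n|%N)%:R * Num.min 0 (u e) = v n + C%:R * Num.min 0 (u e).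
  move=> an; have pb : p n <= C%:Z by apply: bound; rewrite in_supp.
  have -> : (`|C%:Z - p n|%N)%:R = C%:R - (p n)%:~R :> rat.
    by rewrite -[C%:R]/((C%:Z)%:~R) -intrB pmulrn; congr (_%:~R); lia.
  have -> : u n = v n + (p n)%:~R * Num.min 0 (u e) by rewrite ue psE.
  by rewrite mulrBl -addrA [X in _ + X]addrC subrK.
split=> H n an.
  have H' m (am : a'@_m != 0) :
      C%:R * Num.min 0 (u e) <= u m + (`|C%:Z - p m|%N)%:R * Num.min 0 (u e).
    by rewrite (key m am) lerDr; exact: H.
  by have := (proj1 str2) ((proj2 str1) H') n an; rewrite lerDr.
have H' m (am : a@_m != 0) :
    C%:R * Num.min 0 (u e) <= u m + C%:R * Num.min 0 (u e).
  by rewrite lerDr; exact: H.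
by have := (proj1 str1) ((proj2 str2) H') n an; rewrite (key n an) lerDr.
Qed.

End MutationTorus.

Section Fractions.
Context (R : unitRingType).
Implicit Types a b c d x y : R.

Lemma left_to_right_fraction b d x y : b \is a GRing.unit -> y \is a GRing.unit ->
  b^-1 * d = x / y -> d * y = b * x.
Proof. by move=> bU yU e; rewrite -(mulVKr bU d) e -!mulrA mulVr // mulr1. Qed.

Lemma eq_fractions a b c d x y :
  b \is a GRing.unit -> d \is a GRing.unit -> y \is a GRing.unit ->
  d * y = b * x -> a / b = c / d <-> a * x = c * y.
Proof.
move=> bU dU yU e; split=> [E|E].
  by rewrite -(mulrVK bU a) E -mulrA -e !mulrA mulrVK.
apply: (mulIr dU); apply: (mulIr yU); rewrite mulrVK // -E -!mulrA e.
by rewrite mulKr.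
Qed.

End Fractions.

Section MutationPullback.
Context (kk : fieldType) (I : finType) (N : zmodType) (S : seed_datum I N).
Local Notation A := (qtorus kk S).
Context (F : fraction_skew_field A) (s : bseed S) (k : I) (ku : k \in uf S).
Implicit Types (a b : A) (x y : F).
Local Notation emb := (emb F).
Local Notation mu := (mu F s k).

Lemma fractionP x : (fraction x).2 != 0 /\ x = emb (fraction x).1 / emb (fraction x).2.
Proof. by have /andP[h /eqP e] := xchooseP (fracP x). Qed.

Lemma mu_unit a : a != 0 -> mu a \is a GRing.unit.
Proof.
by move=> a0; apply: frac_unit; apply: contraNneq a0 => /(mu_inj ku)/eqP.
Qed.

Lemma mu_injective a b : mu a = mu b -> a = b.
Proof.
move=> E; apply/eqP; rewrite -subr_eq0; apply/eqP; apply: (mu_inj (F := F) ku).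
have := muD F s ku (a - b) b; rewrite (congr1 mu (subrK b a)) E => {}E.
apply: (addIr (mu b)); rewrite add0r; exact: esym E.
Qed.

Lemma mutation_pullbackE x : mutation_pullback (bs s) k x =
  mu (fraction x).1 / mu (fraction x).2.
Proof. by rewrite !muE. Qed.

Lemma mutation_pullback_emb a : mutation_pullback (bs s) k (emb a) = mu a.
Proof.
rewrite mutation_pullbackE; have [b0] := fractionP (emb a).
move: (fraction _).1 (fraction _).2 b0 => a1 b1 b0 e.
have -> : a1 = a * b1.
  apply: (@emb_inj _ F); apply: etrans _ (esym (embM F a b1)).
  by rewrite e mulrVK //; exact: emb_unit.
by rewrite (muM F s ku a b1) mulrK //; exact: mu_unit.
Qed.

(* Two fractions a / b = c / d are compared through a common right multiple
   b d' = d b' of the denominators. *)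
Lemma mutation_pullback_inj : injective (mutation_pullback (F := F) (bs s) k).
Proof.
move=> x y; rewrite !mutation_pullbackE; have [b0 xE] := fractionP x.
have [d0 yE] := fractionP y; move=> E; apply: etrans xE _; apply: etrans _ (esym yE).
move: (fraction x) (fraction y) b0 d0 E => [a b] [c d] /= b0 d0 E.
have [[d' b'] /andP[/= b'0 /eqP D]] := fracP ((emb b)^-1 * emb d).
have crossF : emb d * emb b' = emb b * emb d'.
  exact: left_to_right_fraction (emb_unit F b0) (emb_unit F b'0) D.
have cross : d * b' = b * d'.
  apply: (@emb_inj _ F); apply: etrans (embM F d b') _.
  exact: etrans crossF (esym (embM F b d')).
have mcross : mu d * mu b' = mu b * mu d'.
  apply: etrans (esym (muM F s ku d b')) _.
  exact: etrans (congr1 mu cross) (muM F s ku b d').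
have key : a * d' = c * b'.
  apply: mu_injective; apply: etrans (muM F s ku a d') _.
  apply: etrans _ (esym (muM F s ku c b')).
  exact: (proj1 (eq_fractions _ _ (mu_unit b0) (mu_unit d0) (mu_unit b'0) mcross) E).
apply: (proj2 (eq_fractions _ _ (emb_unit F b0) (emb_unit F d0) (emb_unit F b'0) crossF)).
apply: etrans (esym (embM F a d')) _.
exact: etrans (congr1 emb key) (embM F c b').
Qed.

End MutationPullback.

(** * Universally polynomial elements *)

Section UniversallyPolynomial.
Context (kk : fieldType) (I : finType) (N : zmodType) (S : seed_datum I N).
Local Notation A := (qtorus kk S).
Context (F : fraction_skew_field A).
Implicit Types (t : tree S) (f p : A).
Local Notation emb := (emb F).

Lemma pullback_inj t : injective (pullback (F := F) t).
Proof.
elim: t => [//|t IH x] a b /= /IH; rewrite seedE.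
exact: (mutation_pullback_inj (valP x)).
Qed.

(** Membership in the quantum cluster algebra supplies a Laurent expansion at every intermediate
    vertex, so [mu_val] applies edge by edge. *)
Lemma ttrop_val p t f' (v : N -> rat) : addv v ->
  quantum_cluster_algebra (emb p) -> emb p = pullback t (emb f') ->
  (forall n, f'@_n != 0 -> 0 <= v n) <-> (forall n, p@_n != 0 -> 0 <= ttrop t v n).
Proof.
move=> vD Oq; elim: t f' v vD => [|t IH x] f' v vD /= E.
  by have -> : p = f' by exact: (@emb_inj _ F).
have [ft Et] := Oq t; rewrite ttrop_child.
apply: iff_trans _ (IH ft _ (trop_add _ _ vD) Et).
apply: (@mu_val _ _ _ _ F _ _ (valP x)) => //.
by rewrite -mutation_pullback_emb ?(valP x) // -seedE; apply: (@pullback_inj t); rewrite -E Et.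
Qed.

Lemma polynomial_inP (s : bseed S) f :
  polynomial_in (bs s) f <-> forall i n, f@_n != 0 -> 0 <= cov s i n.
Proof.
split=> [H i n /H[v ->]|H n fn].
  rewrite /cov co_sum; apply: (big_ind (fun x : int => 0 <= x%:~R :> rat)) => //.
    by move=> x y; rewrite intrD; apply: addr_ge0.
  by move=> j _; rewrite coMn co_bs ler0z mulrn_wge0.
exists [ffun i => `|co s i n|%N]; rewrite {1}(coE s n); apply: eq_bigr => i _.
by rewrite ffunE pmulrn gez0_abs // -(@ler0z rat); exact: H.
Qed.

(** The conclusion of the theorem includes integrality; it holds because on its chamber the
    transport is composition with a lattice map. *)
Lemma ttrop_cov_int t i n : ttrop t (cov (tseed t) i) n \is a Num.int.
Proof.
have [g scat] := scattering_exists (root_seed S).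
have [B [B' T]] := transport_exists (tpath t) scat.
by rewrite /ttrop (tr_cham T (@cov_add _ _ _ _ i) (cham_cov _ i)) /= rpred_int.
Qed.

End UniversallyPolynomial.

Theorem proposition4p3 (kk : fieldType) (I : finType) (N : zmodType)
    (S : seed_datum I N) (F : fraction_skew_field (qtorus kk S))
    (kk_char0 : [pchar kk] =i pred0)
    (f : F) (p : qtorus kk S)
    (f_in_Oq : quantum_cluster_algebra f)
    (f_eq_p : f = emb F p)
    (p_polynomial : polynomial_in (seed0 S) p) :
  universally_polynomial f <->
  (forall (t : tree S) (v : {ffun I -> nat}),
     p@_(\sum_i seed0 S i *+ v i) != 0 ->
     forall i : I, \sum_j G_tilde t i j * (v j)%:R \is a Num.nat).
Proof.
have GE (t : tree S) (v : {ffun I -> nat}) i : \sum_j G_tilde t i j * (v j)%:R =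
    ttrop t (cov (tseed t) i) (\sum_i seed0 S i *+ v i).
  rewrite ttrop_cov; apply: eq_bigr => j _.
  by rewrite (root_co_uniq (v := fun i => (v i)%:Z)).
subst f; split=> [[_ U] t v pv i|H].
  have [ft [/[swap] Et]] := U t; rewrite seedE => /polynomial_inP P.
  rewrite natrEint GE ttrop_cov_int /=.
  exact: (proj1 (ttrop_val (@cov_add _ _ _ (tseed t) i) f_in_Oq Et) (P i) _ pv).
split=> // t; have [ft Et] := f_in_Oq t; exists ft; split=> //.
rewrite seedE; apply/polynomial_inP => i.
apply: (proj2 (ttrop_val (@cov_add _ _ _ _ i) f_in_Oq Et)) => n pn.
have [v nE] := p_polynomial n pn; rewrite nE -GE.
by apply: natr_ge0; apply: H; rewrite -nE.
Qed.
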